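(* Let $G$ be a group with a finite symmetric set of generators $\Gamma$, and suppose that $G$ has polynomial growth with growth index $d$. Let $\{S_n\}_{n\ge0}$ be the symmetric random walk on $G$ with respect to $\Gamma$ started at the identity $e$, with law $\mathbf{P}$ and expectation $\mathbf{E}$, and let $\mathcal{C}_n=\mathrm{Cap}(\{S_0,\dots,S_n\})$ be the capacity of its range. Assume that $d\ge6$. Then there is $\sigma_d>0$ such that $$\frac{\mathcal{C}_n-\mathbf{E}[\mathcal{C}_n]}{\sigma_d\,n^{1/2}}\longrightarrow \mathcal{N}(0,1)\quad\text{in distribution as } n\to\infty,$$ where $\mathcal{N}(0,1)$ stands for the standard normal random variable.
   Context: Let $G$ be a group with a finite symmetric set of generators $\Gamma$ (i.e. $\Gamma=\Gamma^{-1}$). Let $\{X_n\}_{n\ge1}$ be independent random elements uniformly distributed on $\Gamma$. The symmetric random walk on $G$ with respect to $\Gamma$ started at $g\in G$ is given by $S_0=g$, $S_{n+1}=S_nX_{n+1}$, and its law is denoted $\mathbf{P}_g$; we write $\mathbf{P}=\mathbf{P}_e$, where $e$ is the identity of $G$. Capacity: for a set $A\subseteq G$, let $\tau_A^+=\inf\{n\ge1: S_n\in A\}$ be the first return time to $A$, and let $\mathrm{Cap}(A)=\sum_{g\in A}\mathbf{P}_g(\tau_A^+=\infty)$. The range is the random set $\mathcal{R}_n=\{S_0,\dots,S_n\}$, and $\mathcal{C}_n=\mathrm{Cap}(\mathcal{R}_n)$. Growth index: for $g\in G$ let $\rho(g)=\inf\{m\ge0: g=\gamma_1\cdots\gamma_m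 \text{ for some } \gamma_1,\dots,\gamma_m\in\Gamma\}$ be the word length, and let $\mathcal{V}(n)=|\{g\in G:\rho(g)\le n\}|$ be the growth function. The group has polynomial growth with (integer) growth index $d\ge0$ if $\mathcal{V}(n)\asymp n^d$, i.e. $\mathcal{V}(n)$ is bounded above and below by positive constant multiples of $n^d$ for all $n\ge1$. The growth index does not depend on the choice of $\Gamma$. *)

(* Defs.v *)
From HB Require Import structures.
From mathcomp Require Import all_boot all_order all_algebra finmap.
From mathcomp Require Import monoid.
From mathcomp Require Import all_classical all_reals all_analysis.

Set Implicit Arguments.
Unset Strict Implicit.
Unset Printing Implicit Defensive.
Import Order.TTheory GRing.Theory Num.Theory.
Import numFieldNormedType.Exports.
Local Open Scope classical_set_scope.
Local Open Scope ring_scope.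

Definition generates (G : groupType) (Gamma : {fset G}) : Prop :=
  forall H : {pred G}, group_closed H -> {subset Gamma <= H} ->
  forall g, g \in H.

Definition symmetric_set (G : groupType) (Gamma : {fset G}) : Prop :=
  forall g, g \in Gamma -> (g^-1)%g \in Gamma.

Definition word_length (R : realType) (G : groupType) (Gamma : {fset G})
    (g : G) : \bar R :=
  ereal_inf [set (size s)%:R%:E | s in
    [set s : seq G | {subset s <= Gamma} /\ g = (\prod_(a <- s) a)%g]].

Definition growth (R : realType) (G : groupType) (Gamma : {fset G}) (n : nat) :
    \bar R :=
  counting [set g : G | (word_length R Gamma g <= n%:R%:E)%E].

Definition polynomial_growth (R : realType) (G : groupType) (Gamma : {fset G})
    (d : nat) : Prop :=
  exists c C : R, [/\ 0 < c, 0 < C & forall n, (1 <= n)%N ->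
    ((c * n%:R ^+ d)%:E <= growth R Gamma n <= (C * n%:R ^+ d)%:E)%E].

Section RandomWalk.
Context {disp : measure_display} {T : measurableType disp} {R : realType}.
Context (P : probability T R) {G : groupType}.
Implicit Types (X : nat -> T -> G) (A : set G).

(* G carries the discrete sigma-algebra. *)
Definition random_elements X : Prop :=
  forall n (B : set G), measurable (X n @^-1` B).

Definition mutually_independent X : Prop :=
  forall (J : {fset nat}) (B : nat -> set G),
    P (\bigcap_(j in [set` J]) (X j @^-1` B j)) =
    (\prod_(j <- J) P (X j @^-1` B j))%E.

Definition uniform_on (Gamma : {fset G}) (Y : T -> G) : Prop :=
  forall g, g \in Gamma -> P (Y @^-1` [set g]) = (#|` Gamma|%:R^-1)%:E.

(* Steps are numbered from 0: [X n] is the increment between the times [n] and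
   [n.+1]. *)
Fixpoint walk X (g : G) (n : nat) (w : T) : G :=
  if n is m.+1 then (walk X g m w * X m w)%g else g.

Definition return_time A (s : nat -> G) : \bar R :=
  ereal_inf [set n%:R%:E | n in [set n | (1 <= n)%N /\ A (s n)]].

(* The walks from all starting points are driven by the same increments, so the
   law of the walk started at [g] is the image of [P] under [walk X g]. *)
Definition capacity X A : \bar R :=
  \esum_(g in A) P [set w | return_time A (walk X g ^~ w) = +oo%E].

Definition walk_range X (n : nat) (w : T) : set G :=
  [set walk X 1%g k w | k in [set k | (k <= n)%N]].

(* The range is finite and every term of its capacity is at most 1, so that
   [fine] is harmless. *)
Definition range_capacity X (n : nat) (w : T) : R :=
  fine (capacity X (walk_range X n w)).

(* Convergence of distribution functions at the continuity points of the limit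
   law. *)
Definition converges_in_distribution (Y : nat -> T -> R)
    (mu : probability (measurableTypeR R) R) : Prop :=
  forall x : R, mu [set x] = 0%E ->
    pushforward P (Y n) `]-oo, x]%classic @[n --> \oo] --> mu `]-oo, x]%classic.

End RandomWalk.

(* Main.v *)
(* A walk is encoded by the word of its steps, and expectations are averages over
   the words of given length in the generators.

   Growth of degree at least 6 makes the return probabilities of order at most
   n^-3. Hence the defect C(A) + C(B) - C(A u B) between the capacities of two
   consecutive pieces of the range has a second moment of order log^2 only, and
   the capacity of the range is, up to an error of small standard deviation
   relative to sqrt n, a sum of independent capacities of long blocks. This gives
   the convergence of sd(C_n) / sqrt n to some sigma, and the theorem by
   Lindeberg's replacement argument for the sum over blocks. To see that sigma is
   positive, note that E C_n grows linearly, so that a block consisting of a walk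
   going back and forth along one edge lowers the expected capacity;
   the number of such blocks has fluctuations of order sqrt n. *)
Require Import Defs.
From HB Require Import structures.
From mathcomp Require Import all_boot all_order all_algebra finmap.
From mathcomp Require Import monoid.
From mathcomp Require Import all_classical all_reals all_analysis.
From mathcomp Require Import measurable_realfun.
From mathcomp Require Import ring lra zify.

Set Implicit Arguments.
Unset Strict Implicit.
Unset Printing Implicit Defensive.
Import Order.TTheory GRing.Theory Num.Theory.
Import numFieldNormedType.Exports.
Local Open Scope classical_set_scope.
Local Open Scope ring_scope.

(** * Averages over words *)

(** Degree 6 enters the estimates as a lower bound of order [64 ^ j] on the number of products of
    [2 ^ j.+1] generators. The decay n^-3 is derived from it by elementary means: at even times the
    heat kernel is a Gram matrix, its drop from the identity to x is half a squared distance, and a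
    word of length [2 ^ j.+1] costs [4 ^ j] times the cost of a word of length 2. With decay n^-3,
    the Green function averaged over p further steps is of order p^-2, and its double sum over two
    adjacent pieces is harmonic: this is where the logarithm in the defect comes from. Escape
    probabilities are truncated at N steps, so that every estimate is one on finite sums, uniform in
    N; the limit in N is taken last. The limit sigma has to exist before its positivity is shown:
    linear growth of the mean yields a large increment only at infinitely many times, and this is
    enough once the whole sequence converges. For the replacement argument a test function needs no
    derivatives, only quadratic expansions with a uniform cubic error; averaging over words
    preserves this class, and the Gaussian side is a convolution semigroup. *)

Section WordMean.
Context {R : realType} {G : groupType} (Gamma : {fset G}).

Fixpoint words n : seq (seq G) :=
  if n is m.+1 then [seq a :: s | a <- Gamma, s <- words m] else [:: [::]].

Definition mean n (f : seq G -> R) : R :=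
  (#|` Gamma|%:R ^+ n)^-1 * \sum_(s <- words n) f s.

Lemma in_words n s :
  s \in words n -> size s = n /\ {subset s <= Gamma}.
Proof.
elim: n s => [s|n IH s] /=; first by rewrite inE => /eqP ->.
move=> /allpairsP[[a t] /= [aG /IH[tn tG] ->]]; split => /=; first by rewrite tn.
by move=> b; rewrite inE => /orP[/eqP->//|/tG].
Qed.

Lemma mem_words s : {subset s <= Gamma} -> s \in words (size s).
Proof.
elim: s => [_|a s IH sG]; first by rewrite inE.
apply/allpairsP; exists (a, s); split => //=; first by apply: sG; rewrite inE eqxx.
by apply: IH => x xs; apply: sG; rewrite inE xs orbT.
Qed.

Lemma mean0 f : mean 0 f = f [::].
Proof. by rewrite /mean /= big_seq1 expr0 invr1 mul1r. Qed.

Lemma meanS n f : mean n.+1 f =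
  #|` Gamma|%:R^-1 * \sum_(a <- Gamma) mean n (fun s => f (a :: s)).
Proof.
rewrite /mean /= big_allpairs_dep exprS invfM -mulrA; congr (_ * _).
by rewrite mulr_sumr.
Qed.

Lemma eq_mean n f g :
  (forall s, size s = n -> {subset s <= Gamma} -> f s = g s) ->
  mean n f = mean n g.
Proof.
move=> fg; congr (_ * _); apply: eq_big_seq => s /in_words[]; exact: fg.
Qed.

Lemma le_mean n f g :
  (forall s, size s = n -> {subset s <= Gamma} -> f s <= g s) ->
  mean n f <= mean n g.
Proof.
move=> fg; apply: ler_wpM2l; first by rewrite invr_ge0 exprn_ge0.
rewrite big_seq [leRHS]big_seq; apply: ler_sum => s /in_words[]; exact: fg.
Qed.

Lemma meanD n f g : mean n (fun s => f s + g s) = mean n f + mean n g.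
Proof. by rewrite /mean big_split mulrDr. Qed.

Lemma meanZ n c f : mean n (fun s => c * f s) = c * mean n f.
Proof. by rewrite /mean -mulr_sumr mulrCA. Qed.

Lemma meanZr n c f : mean n (fun s => f s * c) = mean n f * c.
Proof. by rewrite /mean -mulr_suml mulrA. Qed.

Lemma meanN n f : mean n (fun s => - f s) = - mean n f.
Proof. by rewrite /mean sumrN mulrN. Qed.

Lemma meanB n f g : mean n (fun s => f s - g s) = mean n f - mean n g.
Proof. by rewrite meanD meanN. Qed.

Lemma mean_sum n I (r : seq I) (P : pred I) (F : I -> seq G -> R) :
  mean n (fun s => \sum_(i <- r | P i) F i s) =
  \sum_(i <- r | P i) mean n (F i).
Proof. by rewrite /mean exchange_big mulr_sumr. Qed.

Lemma mean_swap n m (f : seq G -> seq G -> R) :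
  mean n (fun s => mean m (f s)) = mean m (fun t => mean n (f^~ t)).
Proof.
rewrite /mean -!mulr_sumr mulrCA; congr (_ * (_ * _)).
exact: exchange_big.
Qed.

Lemma mean_cat n m f :
  mean (n + m) f = mean n (fun s => mean m (fun t => f (s ++ t))).
Proof.
elim: n f => [|n IH] f; first by rewrite mean0.
rewrite addSn !meanS; congr (_ * _); apply: eq_bigr => a _; exact: IH.
Qed.

Lemma mean_ge0 n f :
  (forall s, size s = n -> {subset s <= Gamma} -> 0 <= f s) -> 0 <= mean n f.
Proof.
move=> f0; rewrite mulr_ge0 ?invr_ge0 ?exprn_ge0// big_seq sumr_ge0 // => s.
by move=> /in_words[]; exact: f0.
Qed.

Hypothesis Gamma0 : Gamma != fset0.

Lemma card_gens_gt0 : 0 < #|` Gamma|%:R :> R.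
Proof. by rewrite ltr0n cardfs_gt0. Qed.

Lemma mean_cst n c : mean n (fun=> c) = c.
Proof.
elim: n => [|n IH]; first by rewrite mean0.
rewrite meanS; under eq_bigr do rewrite IH.
rewrite big_const_seq count_predT iter_addr_0 -[c *+ _]mulr_natl mulrA.
by rewrite mulVf ?mul1r// gt_eqF// card_gens_gt0.
Qed.

Lemma mean_bound n f c :
  (forall s, size s = n -> {subset s <= Gamma} -> f s <= c) -> mean n f <= c.
Proof. by move=> fc; rewrite -[leRHS](mean_cst n); exact: le_mean. Qed.

Lemma norm_mean_le n f : `|mean n f| <= mean n (fun s => `|f s|).
Proof.
rewrite /mean normrM ger0_norm ?invr_ge0 ?exprn_ge0//.
by rewrite ler_wpM2l ?invr_ge0 ?exprn_ge0// ler_norm_sum.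
Qed.

Lemma mean_CS n f g :
  mean n (fun s => f s * g s) ^+ 2 <=
  mean n (fun s => f s ^+ 2) * mean n (fun s => g s ^+ 2).
Proof.
set F := mean n (fun s => f s ^+ 2); set H := mean n (fun s => g s ^+ 2).
set FH := mean n _.
have F0 : 0 <= F by apply: mean_ge0 => s _ _; exact: sqr_ge0.
have H0 : 0 <= H by apply: mean_ge0 => s _ _; exact: sqr_ge0.
have K (a b : R) : 0 <= a ^+ 2 * F + b ^+ 2 * H + 2 * a * b * FH.
  rewrite -!meanZ -!meanD; apply: mean_ge0 => s _ _.
  by have := sqr_ge0 (a * f s + b * g s); congr (_ <= _); ring.
have [H00|Hn0] := eqVneq H 0; last first.
  have Hp : 0 < H by rewrite lt_neqAle eq_sym Hn0.
  have := K H (- FH); have -> : H ^+ 2 * F + (- FH) ^+ 2 * H + 2 * H * - FH * FH =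
    H * (F * H - FH ^+ 2) by ring.
  by rewrite pmulr_rge0// subr_ge0.
(* For H = 0 the form is linear in its second coefficient; the value F + 1 leaves
   [- ((F + 2) * FH ^+ 2)], which forces FH = 0. *)
have := K (- FH) (F + 1); rewrite H00 mulr0 addr0 mulr0.
have -> : (- FH) ^+ 2 * F + 2 * - FH * (F + 1) * FH =
  - ((F + 2) * FH ^+ 2) by ring.
rewrite oppr_ge0 => h.
have F2 : 0 < F + 2 by lra.
by move: h; rewrite pmulr_rle0.
Qed.

Definition norm2 n f := Num.sqrt (mean n (fun s => f s ^+ 2)).

Lemma norm2_ge0 n f : 0 <= norm2 n f.
Proof. exact: sqrtr_ge0. Qed.

Lemma norm2_sq n f : norm2 n f ^+ 2 = mean n (fun s => f s ^+ 2).
Proof. by rewrite sqr_sqrtr//; apply: mean_ge0 => s _ _; exact: sqr_ge0. Qed.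

Lemma eq_norm2 n f g :
  (forall s, size s = n -> {subset s <= Gamma} -> f s = g s) ->
  norm2 n f = norm2 n g.
Proof. by move=> fg; congr Num.sqrt; apply: eq_mean => s ns sG; rewrite fg. Qed.

Lemma mean_norm_le n f : mean n (fun s => `|f s|) <= norm2 n f.
Proof.
rewrite -[leLHS]ger0_norm; last by apply: mean_ge0.
rewrite -sqrtr_sqr ler_wsqrtr//.
have := mean_CS n (fun s => `|f s|) (fun=> 1).
under eq_mean do rewrite mulr1.
under [X in _ * X]eq_mean do rewrite expr1n.
by rewrite mean_cst mulr1; under [leRHS]eq_mean do rewrite real_normK ?num_real//.
Qed.

Lemma norm2D n f g : norm2 n (fun s => f s + g s) <= norm2 n f + norm2 n g.
Proof.
rewrite -[leRHS]ger0_norm ?addr_ge0 ?norm2_ge0// -sqrtr_sqr ler_wsqrtr//.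
rewrite sqrrD !norm2_sq.
have -> : mean n (fun s => (f s + g s) ^+ 2) = mean n (fun s => f s ^+ 2) +
   mean n (fun s => f s * g s) *+ 2 + mean n (fun s => g s ^+ 2).
  rewrite -mulr_natl -meanZ -!meanD; apply: eq_mean => s _ _; ring.
rewrite lerD2r lerD2l lerMn2r/=.
rewrite (le_trans (ler_norm _))// -sqrtr_sqr -sqrtrM ?ler_wsqrtr ?mean_CS//.
by apply: mean_ge0 => s _ _; exact: sqr_ge0.
Qed.

Lemma norm2N n f : norm2 n (fun s => - f s) = norm2 n f.
Proof. by congr Num.sqrt; apply: eq_mean => s _ _; rewrite sqrrN. Qed.

Lemma norm2_le n f g :
  (forall s, size s = n -> {subset s <= Gamma} -> `|f s| <= g s) ->
  norm2 n f <= norm2 n g.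
Proof.
move=> fg; rewrite ler_wsqrtr//; apply: le_mean => s sn sG.
by rewrite -real_normK ?num_real// lerXn2r ?nnegrE// ?fg// (le_trans _ (fg s sn sG)).
Qed.

Lemma norm2_cst n c : norm2 n (fun=> c) = `|c|.
Proof. by rewrite /norm2 mean_cst sqrtr_sqr. Qed.

Lemma norm2_bound n f c :
  (forall s, size s = n -> {subset s <= Gamma} -> `|f s| <= c) ->
  0 <= c -> norm2 n f <= c.
Proof. by move=> fc c0; rewrite -(ger0_norm c0) -(norm2_cst n); exact: norm2_le. Qed.

End WordMean.

(** * Heat kernel decay *)

Section HeatKernel.
Context {R : realType} {G : groupType} (Gamma : {fset G}).
Hypothesis Gamma0 : Gamma != fset0.
Hypothesis Gammasym : symmetric_set Gamma.
Local Notation mean := (@mean R G Gamma).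

Definition wprod (s : seq G) : G := (\prod_(a <- s) a)%g.

Lemma wprod_nil : wprod [::] = 1%g. Proof. by rewrite /wprod big_nil. Qed.

Lemma wprod_cons a s : wprod (a :: s) = (a * wprod s)%g.
Proof. by rewrite /wprod big_cons. Qed.

Lemma wprod_cat s t : wprod (s ++ t) = (wprod s * wprod t)%g.
Proof. by rewrite /wprod big_cat. Qed.

Lemma sum_inv (F : G -> R) :
  \sum_(a <- Gamma) F (a^-1)%g = \sum_(a <- Gamma) F a.
Proof.
rewrite -(big_map (fun a => a^-1)%g xpredT F); apply: perm_big.
apply: uniq_perm; rewrite ?map_inj_uniq ?fset_uniq//; first exact: invg_inj.
move=> a; apply/mapP/idP => [[b bG ->]|aG]; first exact: Gammasym.
by exists (a^-1)%g; rewrite ?invgK//; exact: Gammasym.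
Qed.

Lemma meanSr n (f : seq G -> R) : mean n.+1 f =
  mean n (fun s => #|` Gamma|%:R^-1 * \sum_(a <- Gamma) f (rcons s a)).
Proof.
rewrite -addn1 mean_cat; apply: eq_mean => s _ _.
by rewrite meanS; under eq_bigr do rewrite mean0 cats1.
Qed.

(** Reversing a word and inverting its letters permutes the words, since [Gamma] is symmetric. The
    induction peels the first letter on one side and the last one on the other. *)
Lemma mean_inv n (F : G -> R) :
  mean n (fun s => F (wprod s)) = mean n (fun s => F (wprod s)^-1%g).
Proof.
elim: n F => [|n IH] F; first by rewrite !mean0 wprod_nil invg1.
rewrite meanS meanSr meanZ mean_sum; congr (_ * _).
rewrite [RHS](eq_bigr (fun a => mean n (fun s => F (a^-1 * (wprod s)^-1)%g))); last first.
  move=> a _; apply: eq_mean => s _ _.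
  by rewrite -cats1 wprod_cat wprod_cons wprod_nil mulg1 invgM.
rewrite (sum_inv (fun a => mean n (fun s => F (a * (wprod s)^-1)%g))).
apply: eq_bigr => a _; rewrite -(IH (fun x => F (a * x)%g)).
by apply: eq_mean => s _ _; rewrite wprod_cons.
Qed.

Definition hk n (x : G) : R := mean n (fun s => (wprod s == x)%:R).

Lemma hk_ge0 n x : 0 <= hk n x.
Proof. by apply: mean_ge0. Qed.

Lemma hkD n m x : hk (n + m) x = mean n (fun s => hk m ((wprod s)^-1 * x)%g).
Proof.
rewrite /hk mean_cat; apply: eq_mean => s _ _; apply: eq_mean => t _ _.
by rewrite wprod_cat -(inj_eq (mulgI (wprod s)^-1%g)) mulKg.
Qed.

Lemma hk_convol n m x : hk (n + m) x = mean n (fun s => hk m (wprod s * x)%g).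
Proof.
rewrite hkD (mean_inv _ (fun y => hk m (y * x)%g)).
by [].
Qed.

Lemma hk_sum (S : seq G) n : uniq S -> \sum_(x <- S) hk n x <= 1.
Proof.
move=> uS; rewrite -mean_sum; apply: mean_bound => // s _ _.
rewrite -natr_sum (ler_nat _ _ 1); under eq_bigr do rewrite eq_sym.
have -> : (\sum_(i <- S) (i == wprod s) = count_mem (wprod s) S)%N.
  by rewrite -sum1_count [RHS]big_mkcond; apply: eq_bigr => i _ /=; case: eqP.
by rewrite count_uniq_mem // leq_b1.
Qed.

Lemma sum_hkM n u (S : seq G) (F : G -> R) : uniq S ->
  (forall s, s \in words Gamma n -> (wprod s * u^-1)%g \in S) ->
  \sum_(x <- S) hk n (x * u)%g * F x = mean n (fun s => F (wprod s * u^-1)%g).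
Proof.
move=> uS Su; under eq_bigr do rewrite /hk -meanZr.
rewrite -mean_sum; congr (_ * _); apply: eq_big_seq => s sw.
rewrite (bigD1_seq (wprod s * u^-1)%g) ?Su//= mulgVK eqxx mul1r big1 ?addr0//.
move=> x xs; case: eqP => [e|]; last by rewrite mul0r.
by rewrite e mulgK eqxx in xs.
Qed.

(* The Gram matrix of the translates of [hk n]: positivity of [hk (n + n)] gives
   the maximum at 1 and the parallelogram inequality below. *)
Lemma hk_gram n (us : seq (G * R)) :
  0 <= \sum_(u <- us) \sum_(v <- us)
         u.2 * v.2 * hk (n + n) (u.1^-1 * v.1)%g.
Proof.
pose S := undup [seq (wprod s * u.1^-1)%g | s <- words Gamma n, u <- us].
have -> : \sum_(u <- us) \sum_(v <- us)
    u.2 * v.2 * hk (n + n) (u.1^-1 * v.1)%g =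
   \sum_(x <- S) (\sum_(u <- us) u.2 * hk n (x * u.1)%g) ^+ 2.
  under [RHS]eq_bigr do rewrite expr2 mulr_suml.
  rewrite [RHS]exchange_big; apply: eq_big_seq => u uus /=.
  under [RHS]eq_bigr do rewrite mulr_sumr.
  rewrite [RHS]exchange_big; apply: eq_big_seq => v vus /=.
  rewrite hk_convol.
  under [RHS]eq_bigr do rewrite mulrACA.
  rewrite -mulr_sumr; congr (_ * _).
  rewrite (sum_hkM (fun x => hk n (x * v.1)%g)) ?undup_uniq//.
    by apply: eq_mean => s _ _; rewrite mulgA.
  by move=> s sw; rewrite mem_undup; apply/allpairsP; exists (s, u).
by apply: sumr_ge0 => x _; exact: sqr_ge0.
Qed.

Lemma hk_max n x : hk (n + n) x <= hk (n + n) 1%g.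
Proof.
have := hk_gram n [:: (1%g, 1); (x, -1)].
rewrite !big_cons !big_nil /= invg1 !mul1g mulVg mulg1.
have -> : hk (n + n) x^-1%g = hk (n + n) x.
  rewrite /hk (mean_inv _ (fun y => (y == x^-1%g)%:R)).
  by apply: eq_mean => s _ _; rewrite (inj_eq invg_inj).
lra.
Qed.

Lemma hk_inv n x : hk n x^-1%g = hk n x.
Proof.
rewrite /hk (mean_inv _ (fun y => (y == x^-1%g)%:R)).
by apply: eq_mean => s _ _; rewrite (inj_eq invg_inj).
Qed.

(** Half the squared l2 distance between the translates of [hk n] by 1 and by x is
    [hk (n + n) 1 - hk (n + n) x]. The coefficients 1, -2, 1 at 1, x, x y express that the squared
    distance from 1 to x y is at most twice the sum of the squared distances from 1 to x and from x
    to x y. *)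
Lemma hk_parallelogram n x y :
  hk (n + n) 1%g - hk (n + n) (x * y)%g <=
  2 * (hk (n + n) 1%g - hk (n + n) x) + 2 * (hk (n + n) 1%g - hk (n + n) y).
Proof.
have := hk_gram n [:: (1%g, 1); (x, -2); ((x * y)%g, 1)].
rewrite !big_cons !big_nil /= invg1 !mul1g !mulVg mulg1 mulKg hk_inv mulg1.
rewrite (hk_inv _ (x * y)%g) -(hk_inv _ ((x * y)^-1 * x)%g) invgM invgK mulKg.
lra.
Qed.

Definition return_prob n := hk (n + n) 1%g.

Lemma return_probS n :
  mean 2 (fun s => hk (n + n) (wprod s)) = return_prob n.+1.
Proof.
have -> : return_prob n.+1 = hk (2 + (n + n)) 1%g by rewrite /return_prob addnS addSn.
rewrite hk_convol.
by apply: eq_mean => s _ _; rewrite mulg1.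
Qed.

Lemma hk_le_prob n (w : seq G) : size w = 2 -> {subset w <= Gamma} ->
  hk (n + n) 1%g - hk (n + n) (wprod w) <=
  #|` Gamma|%:R ^+ 2 * (return_prob n - return_prob n.+1).
Proof.
move=> w2 wG; rewrite -return_probS.
rewrite -[return_prob n](mean_cst Gamma0 2) -meanB.
rewrite /mean mulrA mulfV ?mul1r; last by rewrite expf_neq0 ?gt_eqF ?card_gens_gt0.
have ww : w \in words Gamma 2 by have := mem_words wG; rewrite w2.
rewrite [leRHS](big_rem w)//= lerDl.
by apply: sumr_ge0 => s _; rewrite subr_ge0 hk_max.
Qed.

(** Cutting the word in two halves, each with coefficient 2 in the parallelogram inequality, costs a
    factor 4: doubling the distance quadruples the cost, as in diffusive scaling. *)
Lemma hk_le_dyadic n j (w : seq G) : size w = (2 ^ j.+1)%N ->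
  {subset w <= Gamma} ->
  hk (n + n) 1%g - hk (n + n) (wprod w) <=
  4 ^+ j * (#|` Gamma|%:R ^+ 2 * (return_prob n - return_prob n.+1)).
Proof.
elim: j w => [w w2 wG|j IH w w2 wG]; first by rewrite expr0 mul1r; exact: hk_le_prob.
rewrite -(cat_take_drop (2 ^ j.+1) w) wprod_cat.
rewrite (le_trans (hk_parallelogram _ _ _))//.
have s1 : size (take (2 ^ j.+1) w) = (2 ^ j.+1)%N.
  by rewrite size_takel// w2 leq_exp2l.
have s2 : size (drop (2 ^ j.+1) w) = (2 ^ j.+1)%N.
  by rewrite size_drop w2 [X in (X - _)%N]expnS mul2n -addnn addnK.
have h1 := IH _ s1 (fun x xt => wG _ (mem_take xt)).
have h2 := IH _ s2 (fun x xt => wG _ (mem_drop xt)).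
rewrite exprS -mulrA; lra.
Qed.

(* Summing [hk (n + n)] over the products of [2 ^ j.+1] generators: at each of
   them the kernel is close to its value at 1, and the total mass is 1. *)
Lemma return_prob_nash n j :
  (size (undup [seq wprod s | s <- words Gamma (2 ^ j.+1)]))%:R *
  (return_prob n -
   4 ^+ j * (#|` Gamma|%:R ^+ 2 * (return_prob n - return_prob n.+1))) <= 1.
Proof.
set W := undup _.
apply: le_trans (hk_sum (n + n) (undup_uniq [seq wprod s | s <- words Gamma (2 ^ j.+1)])).
have sumW (y : R) : (size W)%:R * y = \sum_(x <- W) y.
  by rewrite big_const_seq count_predT iter_addr_0 mulr_natl.
rewrite sumW -/W big_seq [leRHS]big_seq.
apply: ler_sum => x; rewrite mem_undup => /mapP[w /in_words[w1 w2] ->].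
by have := hk_le_dyadic n w1 w2; rewrite /return_prob; lra.
Qed.

Lemma return_prob_ge0 n : 0 <= return_prob n.
Proof. exact: hk_ge0. Qed.

Lemma return_prob_decr n : return_prob n.+1 <= return_prob n.
Proof.
rewrite -return_probS; apply: mean_bound => // s _ _; exact: hk_max.
Qed.

Lemma hk_le_return n x : hk n x <= return_prob n./2.
Proof.
rewrite -[in hk n x](odd_double_half n) -addnn hkD.
by apply: mean_bound => // s _ _; exact: hk_max.
Qed.

Lemma return_prob_le1 n : return_prob n <= 1.
Proof. by apply: mean_bound => // s _ _; rewrite (ler_nat _ _ 1) leq_b1. Qed.

Lemma bernoulli_inv (x : R) n : 0 <= x <= 1 -> (1 - x) ^+ n * (1 + n%:R * x) <= 1.
Proof.
move=> /andP[x0 x1]; elim: n => [|n IH]; first by rewrite expr0 mul0r addr0 mulr1.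
apply: le_trans IH; rewrite exprS mulrAC mulrC ler_wpM2l ?exprn_ge0 ?subr_ge0//.
rewrite -natr1; have n0 : 0 <= n%:R :> R by [].
have := mulr_ge0 n0 (sqr_ge0 x); have := sqr_ge0 x; nra.
Qed.

(** * Return probabilities under volume growth of degree 6 *)

Section Decay.
Variable kappa : R.
Hypothesis kappa1 : 1 <= kappa.
Hypothesis volume_ge : forall j,
  64 ^+ j <= kappa * (size (undup [seq wprod s | s <- words Gamma (2 ^ j.+1)]))%:R.

Let B := (#|` Gamma| ^ 2)%N.

Lemma kappa_gt0 : 0 < kappa.
Proof. exact: lt_le_trans ltr01 kappa1. Qed.

Lemma B_gt0 : (0 < B)%N.
Proof. by rewrite expn_gt0 cardfs_gt0 Gamma0. Qed.

(** At scale [2 ^ j] the volume is at least [64 ^ j = (2 ^ j) ^ 6] up to [kappa], so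
    [return_prob_nash] bounds [return_prob n] minus [4 ^ j * B] times its next drop by
    [kappa * 64 ^- j]. The excess over this level therefore contracts at each step. *)
Lemma return_prob_step n j :
  return_prob n.+1 - kappa * 64 ^- j <=
  (1 - (4 ^+ j * B%:R)^-1) * (return_prob n - kappa * 64 ^- j).
Proof.
have := return_prob_nash n j; have := volume_ge j.
set W := (size _)%:R => W64 Wn.
have p64 : 0 < 64 ^+ j :> R by rewrite exprn_gt0.
have q0 : 0 < 4 ^+ j * B%:R :> R by rewrite mulr_gt0 ?exprn_gt0 ?ltr0n ?B_gt0.
have k0 := kappa_gt0.
have W0 : 0 < W by rewrite -(pmulr_rgt0 _ k0) (lt_le_trans p64).
have h : return_prob n - (4 ^+ j * B%:R) * (return_prob n - return_prob n.+1) <=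
    kappa * 64 ^- j.
  have : return_prob n - (4 ^+ j * B%:R) * (return_prob n - return_prob n.+1) <= W^-1.
    by rewrite -[leRHS]mul1r ler_pdivlMr// mulrC -mulrA /B natrX.
  move=> /le_trans; apply.
  by rewrite ler_pdivlMr// mulrC ler_pdivrMr// mulrC.
move: h q0; set q := 4 ^+ j * B%:R; set k := kappa * _ => h q0.
have -> : (1 - q^-1) * (return_prob n - k) = (q - 1) * (return_prob n - k) / q.
  by field; rewrite gt_eqF.
by rewrite ler_pdivlMr//; nra.
Qed.

Lemma return_prob_iter n m j :
  return_prob (n + m) - kappa * 64 ^- j <=
  (1 - (4 ^+ j * B%:R)^-1) ^+ m * (return_prob n - kappa * 64 ^- j).
Proof.
elim: m => [|m IH]; first by rewrite addn0 expr0 mul1r.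
rewrite addnS; apply: le_trans (return_prob_step _ _) _.
rewrite exprS -mulrA ler_wpM2l// subr_ge0 invf_le1 -?natrX -?natrM ?ltr0n ?ler1n;
by rewrite muln_gt0 expn_gt0 B_gt0.
Qed.

(** With x = 1 / (4 ^ j B), Bernoulli's inequality gives (1 - x) ^ (127 / x) <= 1 / (1 + 127). The
    value 128 = 2 * 64 closes the induction of [return_prob_block_time]: the old bound divided by
    128 and the new error are both [kappa * 64 ^- j], and their sum is
    [128 * kappa * 64 ^- j.+1]. *)
Lemma return_prob_block n j :
  return_prob (n + 127 * B * 4 ^ j) <= return_prob n / 128 + kappa * 64 ^- j.
Proof.
have k0 : 0 <= kappa * 64 ^- j by rewrite mulr_ge0 ?invr_ge0 ?exprn_ge0// ltW// kappa_gt0.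
rewrite -lerBlDr (le_trans (return_prob_iter _ _ _))//.
have q0 : (0 < (4 ^+ j * B%:R)^-1 :> R) && ((4 ^+ j * B%:R)^-1 <= 1 :> R).
  by rewrite -natrX -natrM invr_gt0 invf_le1 ?ltr0n ?ler1n muln_gt0 expn_gt0 B_gt0.
have := @bernoulli_inv (4 ^+ j * B%:R)^-1 (127 * B * 4 ^ j).
have -> : (127 * B * 4 ^ j)%:R * (4 ^+ j * B%:R)^-1 = 127 :> R.
  rewrite !natrM natrX; field.
  by rewrite gt_eqF ?card_gens_gt0 //= expf_neq0.
case/andP: q0 => q0 q1; rewrite (ltW q0) q1 => /(_ isT).
set z := _ ^+ _ => hz.
have z0 : 0 <= z by rewrite exprn_ge0// subr_ge0.
have := return_prob_ge0 n; have := mulr_ge0 z0 k0; nra.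
Qed.

(* From one time to the next [return_prob] drops by a factor [64 = 4 ^+ 3]. *)
Definition block_time j := (\sum_(i < j) 127 * B * 4 ^ i)%N.

Lemma block_time_le j : (block_time j <= 127 * B * 4 ^ j)%N.
Proof.
rewrite /block_time -big_distrr /= leq_mul2l; apply/orP; right.
elim: j => [|j IH]; first by rewrite big_ord0.
by rewrite big_ord_recr /= expnS; lia.
Qed.

Lemma return_prob_block_time j :
  return_prob (block_time j) <= 128 * kappa * 64 ^- j.
Proof.
elim: j => [|j IH].
  by rewrite expr0 invr1 mulr1 (le_trans (return_prob_le1 _))//; move: kappa1; lra.
rewrite /block_time big_ord_recr /= -/(block_time j).
apply: le_trans (return_prob_block _ _) _.
rewrite exprS invfM; move: IH; set y := 64 ^- j => IH.
have y0 : 0 <= y by rewrite invr_ge0 exprn_ge0.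
nra.
Qed.

Lemma return_prob_decr_le n m : (n <= m)%N -> return_prob m <= return_prob n.
Proof.
elim: m => [|m IH]; first by rewrite leqn0 => /eqP ->.
rewrite leq_eqVlt => /orP[/eqP -> //|]; rewrite ltnS => /IH.
by apply: le_trans; exact: return_prob_decr.
Qed.

Definition decay_cst : R := 128 * kappa * (4 * (127 * B)%:R) ^+ 3.

(** For T * 4 ^ j <= n < T * 4 ^ j.+1 the time [block_time j] has passed, and [64 ^- j] is the cube
    of [4 ^- j], hence of order n^-3. Times below T are covered by the trivial bound 1. *)
Lemma return_prob_decay n : return_prob n <= decay_cst / n.+1%:R ^+ 3.
Proof.
set T := (127 * B)%N.
have T0 : (0 < T)%N by rewrite muln_gt0 B_gt0.
have main j : (n.+1 <= T * 4 ^ j.+1)%N -> return_prob n <= 128 * kappa * 64 ^- j ->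
    return_prob n <= decay_cst / n.+1%:R ^+ 3.
  move=> nT /le_trans; apply; rewrite ler_pdivlMr ?exprn_gt0//.
  rewrite /decay_cst -!mulrA !ler_wpM2l ?(ltW kappa_gt0)//.
  rewrite mulrC ler_pdivrMr ?exprn_gt0//.
  have -> : 64 ^+ j = (4 ^+ j) ^+ 3 :> R by rewrite -exprM mulnC exprM; congr (_ ^+ _); ring.
  rewrite -exprMn lerXn2r ?nnegrE ?mulr_ge0 ?exprn_ge0//.
  by rewrite -natrX -!natrM ler_nat (leq_trans nT)// expnS; lia.
have [nT|nT] := ltnP n T.
  apply: (main 0%N); first by lia.
  by rewrite expr0 invr1 mulr1 (le_trans (return_prob_le1 _))//; move: kappa1; lra.
pose j := trunc_log 4 (n %/ T).
have nT0 : (0 < n %/ T)%N by rewrite divn_gt0.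
have /andP[j1 j2] := trunc_log_bounds (isT : (1 < 4)%N) nT0.
apply: (main j).
  by rewrite mulnC -ltn_divLR.
apply: le_trans (return_prob_block_time j).
apply: return_prob_decr_le; apply: leq_trans (block_time_le _) _.
by rewrite mulnC -leq_divRL.
Qed.

Lemma hk_decay n x : hk n x <= 8 * decay_cst / n.+1%:R ^+ 3.
Proof.
apply: le_trans (hk_le_return _ _) _; apply: le_trans (return_prob_decay _) _.
have d0 : 0 <= decay_cst by rewrite mulr_ge0 ?exprn_ge0 ?mulr_ge0 ?(ltW kappa_gt0).
rewrite ler_pdivlMr ?exprn_gt0// mulrAC ler_pdivrMr ?exprn_gt0//.
rewrite [leRHS]mulrAC mulrC ler_wpM2r//.
(* [return_prob n./2] is a return probability at time n or n - 1, and n + 1 <= 2 * (n./2 + 1). *)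
have -> : 8 = 2 ^+ 3 :> R by ring.
rewrite -exprMn lerXn2r ?nnegrE// ?mulr_ge0// -natrM ler_nat.
by have := odd_double_half n; lia.
Qed.

End Decay.

End HeatKernel.

(** * Volume growth *)

Section Volume.
Context {R : realType} {G : groupType} (Gamma : {fset G}).

Lemma word_length_leP n g : (word_length R Gamma g <= n%:R%:E)%E ->
  exists s, [/\ (size s <= n)%N, {subset s <= Gamma} & g = wprod s].
Proof.
move=> h; have : (word_length R Gamma g < n.+1%:R%:E)%E.
  by rewrite (le_lt_trans h)// lte_fin ltr_nat.
move=> /ereal_inf_lt[_ [s [sG gs] <-]]; rewrite lte_fin ltr_nat ltnS => sn.
by exists s.
Qed.

Lemma growth_le n (S : seq G) :
  (forall s, (size s <= n)%N -> {subset s <= Gamma} -> wprod s \in S) ->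
  (growth R Gamma n <= (size S)%:R%:E)%E.
Proof.
move=> h.
have sub : [set g | (word_length R Gamma g <= n%:R%:E)%E] `<=` [set` S].
  by move=> g /= /word_length_leP[s [sn sG ->]]; exact: h.
have fin : finite_set [set g | (word_length R Gamma g <= n%:R%:E)%E].
  exact: sub_finite_set sub (finite_seq S).
rewrite /growth /counting asboolT// lee_fin ler_nat uniq_leq_size//.
by move=> g; rewrite in_fset_set// inE => /sub.
Qed.

Lemma pad_word a0 (s : seq G) k : symmetric_set Gamma -> a0 \in Gamma ->
  {subset s <= Gamma} ->
  exists t, [/\ size t = (size s + k.*2)%N, {subset t <= Gamma} & wprod t = wprod s].
Proof.
move=> sym a0G sG; elim: k => [|k [t [t1 t2 t3]]]; first by exists s; rewrite addn0.
exists [:: a0, (a0^-1)%g & t]; split => /=.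
- by rewrite t1 doubleS !addnS.
- by move=> x; rewrite !inE => /or3P[/eqP->|/eqP->|/t2]//; exact: sym.
- by rewrite !wprod_cons mulgA mulgV mul1g.
Qed.

(* Padding by [a0 * a0^-1] preserves parity, whence the factor 2: words of the
   wrong parity are lengthened by one generator. *)
Lemma growth_le_words m : symmetric_set Gamma -> Gamma != fset0 ->
  (growth R Gamma m.*2.+1 <=
   (2 * size (undup [seq wprod s | s <- words Gamma m.+1.*2]))%:R%:E)%E.
Proof.
move=> sym /fset0Pn[a0 a0G]; set W := undup _.
have -> : (2 * size W)%N = size (W ++ [seq (x * a0^-1)%g | x <- W]).
  by rewrite size_cat size_map mul2n addnn.
have inW t : size t = m.+1.*2 -> {subset t <= Gamma} -> wprod t \in W.
  by move=> t1 t2; rewrite mem_undup; apply: map_f; rewrite -t1 mem_words.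
apply: growth_le => s sn sG; rewrite mem_cat.
have [k ks] : exists k, (size s + k.*2 = m.+1.*2)%N \/ (size s + k.*2 = m.*2.+1)%N.
  have := odd_double_half (size s); set u := (size s)./2.
  by case: (odd (size s)) => h; [exists (m - u)%N; right|exists (m.+1 - u)%N; left];
    move: sn; rewrite -h -!muln2; lia.
have [t [t1 t2 t3]] := pad_word k sym a0G sG.
case: ks => ks; first by rewrite -t3 inW ?t1.
apply/orP; right; apply/mapP; exists (wprod (t ++ [:: a0])).
  apply: inW; first by rewrite size_cat t1 ks addn1 doubleS.
  by move=> x; rewrite mem_cat inE => /orP[/t2|/eqP->].
by rewrite wprod_cat wprod_cons wprod_nil mulg1 mulgK t3.
Qed.

(** Without generators every ball is the singleton of 1, whereas c * r ^ d > 1 as soon as r > 1 /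
    c. *)
Lemma growth_gens d : polynomial_growth R Gamma d -> (6 <= d)%N -> Gamma != fset0.
Proof.
move=> [c [C [c0 _ h]]] d6; apply/negP => /eqP G0.
pose r := (Num.truncn c^-1).+1.
have r1 : c^-1 < r%:R by exact: truncnS_gt.
have /andP[h1 _] := h r isT.
have : (growth R Gamma r <= (size [:: 1%g : G])%:R%:E)%E.
  apply: growth_le => -[|a s] _ sG; first by rewrite wprod_nil inE.
  by have := sG a; rewrite inE eqxx G0 inE => /(_ isT).
move=> /(le_trans h1); rewrite lee_fin /= leNgt => /negP; apply.
rewrite -ltr_pdivrMl// mulr1 (lt_le_trans r1)// -natrX ler_nat.
by rewrite -{1}(expn1 r) leq_pexp2l//; lia.
Qed.

Lemma volume_ge d : symmetric_set Gamma -> polynomial_growth R Gamma d ->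
  (6 <= d)%N -> exists2 kappa : R, 1 <= kappa & forall j, 64 ^+ j <=
  kappa * (size (undup [seq wprod s | s <- words Gamma (2 ^ j.+1)]))%:R.
Proof.
move=> sym pg d6; have G0 := growth_gens pg d6; move: pg => [c [C [c0 _ h]]].
(* The 2 is the parity factor of [growth_le_words], c the lower growth constant; adding 1 ensures
   [1 <= kappa]. *)
exists (1 + 2 / c); first by rewrite lerDl divr_ge0// ltW.
move=> j; set W := (size _).
have p2 : (0 < 2 ^ j)%N by rewrite expn_gt0.
have := @growth_le_words (2 ^ j).-1 sym G0.
rewrite prednK// -[X in words _ X]mul2n -expnS -/W => hW.
have /andP[h1 _] := h (2 ^ j).-1.*2.+1 isT.
have := le_trans h1 hW; rewrite lee_fin => {hW h1}.
set r := _.*2.+1 => hr.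
have : c * 64 ^+ j <= (2 * W)%:R.
  apply: le_trans hr; rewrite ler_wpM2l ?(ltW c0)//.
  have -> : 64 = 2 ^+ 6 :> R by ring.
  rewrite -exprM mulnC exprM -!natrX ler_nat.
  apply: (@leq_trans (r ^ 6)); first by rewrite leq_exp2r// /r; lia.
  by rewrite leq_pexp2l.
rewrite natrM => hc; rewrite mulrDl mul1r -[leLHS]add0r lerD//.
by rewrite mulrAC ler_pdivlMr// mulrC.
Qed.

End Volume.

(** * Capacity and its defect of additivity *)

Section Capacity.
Context {R : realType} {G : groupType} (Gamma : {fset G}).
Hypothesis Gamma0 : Gamma != fset0.
Hypothesis Gammasym : symmetric_set Gamma.
Local Notation mean := (@mean R G Gamma).
Local Notation hk := (@hk R G Gamma).
Implicit Types (A B : seq G) (s t : seq G).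

(** [scanl] omits the starting point, in accordance with return times being at least 1. *)
Definition avoids A g s : bool :=
  all (fun y => y \notin A) (scanl (fun x y => x * y)%g g s).

Definition escape N A g : R := mean N (fun s => (avoids A g s)%:R).

(** Capacity with escape up to time N in place of escape for ever; it decreases to [cap A] as N
    grows. [undup] is there because a list stands for a set. *)
Definition capN N A : R := \sum_(g <- undup A) escape N A g.

Definition greenN N x : R := \sum_(k < N.+1) hk k x.

Lemma foldl_mulg g s : foldl (fun x y => x * y)%g g s = (g * wprod s)%g.
Proof.
elim: s g => [|a s IH] g /=; first by rewrite wprod_nil mulg1.
by rewrite IH wprod_cons mulgA.
Qed.

Lemma avoids_cat A g s t :
  avoids A g (s ++ t) = avoids A g s && avoids A (g * wprod s)%g t.
Proof. by rewrite /avoids scanl_cat all_cat foldl_mulg. Qed.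

Lemma scanl_mulg h g s : scanl (fun x y => x * y)%g (h * g)%g s =
  map (fun x => h * x)%g (scanl (fun x y => x * y)%g g s).
Proof. by elim: s g => [|a s IH] g //=; rewrite -IH mulgA. Qed.

Lemma scanl_mulgE g s : scanl (fun x y => x * y)%g g s =
  [seq (g * wprod (take k s))%g | k <- iota 1 (size s)].
Proof.
elim: s g => [|a s IH] g //=; rewrite take0 wprod_cons wprod_nil mulg1 IH.
congr (_ :: _); rewrite (iotaDl 1 1) -map_comp; apply: eq_map => k /=.
by rewrite wprod_cons mulgA.
Qed.

Lemma avoids_mulg A h g s :
  avoids (map (fun x => h * x)%g A) (h * g)%g s = avoids A g s.
Proof.
rewrite /avoids scanl_mulg all_map; apply: eq_all => x /=.
by rewrite (mem_map (mulgI h)).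
Qed.

Lemma eq_avoids A B g s : A =i B -> avoids A g s = avoids B g s.
Proof. by move=> AB; apply: eq_all => x /=; rewrite AB. Qed.

Lemma escape_ge0 N A g : 0 <= escape N A g.
Proof. exact: mean_ge0. Qed.

Lemma escape_le1 N A g : escape N A g <= 1.
Proof. by apply: mean_bound => // s _ _; rewrite (ler_nat _ _ 1) leq_b1. Qed.

Lemma escapeS N A g : escape N.+1 A g <= escape N A g.
Proof.
rewrite /escape -addn1 mean_cat; apply: le_mean => s _ _.
apply: mean_bound => // t _ _; rewrite avoids_cat ler_nat.
by case: (avoids A g s) => //; exact: leq_b1.
Qed.

Lemma escape_cat N A B g : escape N (A ++ B) g <= escape N A g.
Proof.
apply: le_mean => s _ _; rewrite ler_nat.
suff : avoids (A ++ B) g s -> avoids A g s.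
  by case: (avoids (A ++ B) g s) => // ->.
by apply: sub_all => x; rewrite mem_cat negb_or => /andP[].
Qed.

Lemma eq_escape N A B g : A =i B -> escape N A g = escape N B g.
Proof. by move=> AB; apply: eq_mean => s _ _; rewrite (eq_avoids _ _ AB). Qed.

Lemma eq_capN N A B : A =i B -> capN N A = capN N B.
Proof.
move=> AB; rewrite /capN; under eq_bigr do rewrite (eq_escape _ _ AB).
apply: perm_big; apply: uniq_perm; rewrite ?undup_uniq// => x.
by rewrite !mem_undup.
Qed.

Lemma capN_mulg N h A : capN N (map (fun x => h * x)%g A) = capN N A.
Proof.
rewrite /capN undup_map_inj; last exact: mulgI.
rewrite big_map; apply: eq_bigr => g _; apply: eq_mean => s _ _.
by rewrite avoids_mulg.
Qed.

Lemma capN_ge0 N A : 0 <= capN N A.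
Proof. by apply: sumr_ge0 => g _; exact: escape_ge0. Qed.

Lemma capN_le_size N A : capN N A <= (size A)%:R.
Proof.
apply: (@le_trans _ _ (size (undup A))%:R); last by rewrite ler_nat size_undup.
rewrite -[X in _ <= X%:R]count_predT -sum1_count natr_sum.
by apply: ler_sum => g _; exact: escape_le1.
Qed.

Lemma capNS N A : capN N.+1 A <= capN N A.
Proof. by apply: ler_sum => g _; exact: escapeS. Qed.

Lemma sum_undup_cat (F : G -> R) A B : \sum_(x <- undup (A ++ B)) F x =
  \sum_(x <- undup A) F x + \sum_(x <- undup B | x \notin A) F x.
Proof.
rewrite -[\sum_(x <- undup B | _) _]big_filter -big_cat; apply: perm_big.
apply: uniq_perm; first exact: undup_uniq.
  rewrite cat_uniq undup_uniq filter_uniq ?undup_uniq// andbT /=.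
  apply/hasPn => x; rewrite mem_filter => /andP[xA _].
  by rewrite mem_undup.
move=> x; rewrite mem_undup !mem_cat mem_filter !mem_undup.
by case: (x \in A).
Qed.

Lemma sum_undup_le (F : G -> R) A : (forall x, 0 <= F x) ->
  \sum_(x <- undup A) F x <= \sum_(x <- A) F x.
Proof.
move=> F0; elim: A => [|a A IH] //=; case: ifP => aA; rewrite !big_cons ?lerD2l//.
by rewrite (le_trans IH)// lerDr.
Qed.

Lemma mem_catC A B : A ++ B =i B ++ A.
Proof. by move=> x; rewrite !mem_cat orbC. Qed.

Lemma capN_cat_le N A B : capN N (A ++ B) <= capN N A + capN N B.
Proof.
rewrite /capN sum_undup_cat lerD//.
  by apply: ler_sum => g _; exact: escape_cat.
rewrite [leRHS](bigID (mem A)) /= -[leLHS]add0r lerD//.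
  by apply: sumr_ge0 => g _; exact: escape_ge0.
apply: ler_sum => g _.
by rewrite (eq_escape _ _ (mem_catC A B)) escape_cat.
Qed.

Lemma mean_take N k (f : seq G -> R) : (k <= N)%N ->
  mean N (fun s => f (take k s)) = mean k f.
Proof.
move=> kN; rewrite -(subnKC kN) mean_cat; apply: eq_mean => s sk _.
rewrite -[RHS](mean_cst Gamma0 (N - k)); apply: eq_mean => t _ _.
by rewrite take_size_cat.
Qed.

(** Union bound: a path that avoids [A] but not [A ++ B] is at some point b of [B] at some time
    between 1 and N. *)
Lemma escape_diff N A B g : escape N A g - escape N (A ++ B) g <=
  \sum_(b <- B) \sum_(k < N) hk k.+1 (g^-1 * b)%g.
Proof.
rewrite /escape -meanB.
have hkE b (k : 'I_N) : hk k.+1 (g^-1 * b)%g =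
    mean N (fun s => (wprod (take k.+1 s) == (g^-1 * b)%g)%:R).
  by rewrite (mean_take (fun s => (wprod s == (g^-1 * b)%g)%:R) (ltn_ord k)).
under eq_bigr do under eq_bigr do rewrite hkE.
under eq_bigr do rewrite -mean_sum.
rewrite -mean_sum; apply: le_mean => s sN _.
case: (boolP (avoids A g s)) => [av|_]; last first.
  rewrite sub0r; apply: (@le_trans _ _ 0); first by rewrite oppr_le0.
  by apply: sumr_ge0 => b _; apply: sumr_ge0.
case: (boolP (avoids (A ++ B) g s)) => [_|].
  by rewrite subrr; apply: sumr_ge0 => b _; apply: sumr_ge0.
rewrite subr0 /avoids -has_predC => /hasP[x xs /=].
rewrite negbK mem_cat => /orP[xA|xB].
  by move/allP: av => /(_ _ xs); rewrite xA.
move: xs; rewrite scanl_mulgE => /mapP[k]; rewrite mem_iota sN => /andP[k1 kN] xE.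
rewrite (big_rem x)//=; have kN' : (k.-1 < N)%N by lia.
rewrite (bigD1 (Ordinal kN')) //= prednK// xE mulKg eqxx -addrA lerDl.
by rewrite addr_ge0// ?sumr_ge0// => b _; apply: sumr_ge0.
Qed.

(** The defect has three sources: points of [A] whose escape is hindered by [B], points of [B]
    outside [A] hindered by [A], and points of the intersection, which are counted twice. The first
    two are bounded by the Green function without its term at time 0, the last by that term
    alone. *)
Lemma capN_cat_ge N A B : capN N A + capN N B - capN N (A ++ B) <=
  2 * \sum_(a <- A) \sum_(b <- B) greenN N (a^-1 * b)%g.
Proof.
pose S a b : R := \sum_(k < N) hk k.+1 (a^-1 * b)%g.
have S0 a b : 0 <= S a b by apply: sumr_ge0 => k _; exact: hk_ge0.
have SC a b : S b a = S a b.
  by apply: eq_bigr => k _; rewrite -(hk_inv Gammasym) invgM invgK.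
have SS0 D a : 0 <= \sum_(b <- D) S a b by apply: sumr_ge0.
have -> : capN N A + capN N B - capN N (A ++ B) =
  \sum_(a <- undup A) (escape N A a - escape N (A ++ B) a) +
  \sum_(b <- undup B | b \notin A) (escape N B b - escape N (A ++ B) b) +
  \sum_(b <- undup B | b \in A) escape N B b.
  rewrite /capN sum_undup_cat !sumrB.
  rewrite [X in _ + X - _ = _](bigID (mem A)) /=; ring.
apply: (@le_trans _ _ (\sum_(a <- A) \sum_(b <- B) S a b +
   \sum_(a <- A) \sum_(b <- B) S a b +
   \sum_(a <- A) \sum_(b <- B) (a == b)%:R)).
  rewrite !lerD//.
  - apply: le_trans (sum_undup_le A (SS0 B)).
    by apply: ler_sum => a _; exact: escape_diff.
  - rewrite [leRHS]exchange_big /=.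
    under [leRHS]eq_bigr do under eq_bigr do rewrite -SC.
    apply: le_trans (sum_undup_le B (SS0 A)).
    rewrite [leRHS](bigID (mem A)) /= -[leLHS]add0r lerD ?sumr_ge0//.
    apply: ler_sum => b _; rewrite (eq_escape _ _ (mem_catC A B)).
    exact: escape_diff.
  - rewrite [leRHS]exchange_big /=.
    have e0 b : 0 <= \sum_(a <- A) (a == b)%:R :> R by apply: sumr_ge0.
    apply: le_trans (sum_undup_le B e0).
    rewrite [leRHS](bigID (mem A)) /= -[leLHS]addr0 lerD ?sumr_ge0//.
    apply: ler_sum => b bA; apply: le_trans (escape_le1 _ _ _) _.
    by rewrite (big_rem b)//= eqxx lerDl; apply: sumr_ge0.
rewrite mulr_sumr -!big_split; apply: ler_sum => a _.
rewrite mulr_sumr -!big_split; apply: ler_sum => b _ /=.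
have -> : greenN N (a^-1 * b)%g = (a == b)%:R + S a b.
  rewrite /greenN big_ord_recl /hk mean0 wprod_nil; congr (_%:R + _).
  by rewrite -(inj_eq (mulgI a)) mulVKg mulg1.
have : 0 <= (a == b)%:R :> R by [].
lra.
Qed.

Definition trace s := 1%g :: scanl (fun x y => x * y)%g 1%g s.

Arguments trace : simpl never.

Lemma traceE s : trace s = [seq wprod (take k s) | k <- iota 0 (size s).+1].
Proof.
rewrite /trace scanl_mulgE /= take0 wprod_nil; congr (_ :: _).
by apply: eq_map => k; rewrite mul1g.
Qed.

Lemma wprod_in_trace s : wprod s \in trace s.
Proof.
rewrite traceE; apply/mapP; exists (size s); first by rewrite mem_iota add0n ltnSn.
by rewrite take_size.
Qed.

Lemma trace_cat s t :
  trace (s ++ t) =i trace s ++ map (fun x => wprod s * x)%g (trace t).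
Proof.
move=> x; rewrite {1}/trace scanl_cat foldl_mulg mul1g -cat_cons !mem_cat.
rewrite -[in X in scanl _ X t](mulg1 (wprod s)) scanl_mulg -/(trace s).
have -> : (x \in map (fun x => wprod s * x)%g (trace t)) = (x == wprod s) ||
    (x \in map (fun x => wprod s * x)%g (scanl (fun x y => x * y)%g 1%g t)).
  by rewrite /trace map_cons in_cons mulg1.
by have [->|_] := eqVneq x (wprod s); rewrite ?wprod_in_trace.
Qed.

Lemma size_trace s : size (trace s) = (size s).+1.
Proof. by rewrite /trace /= size_scanl. Qed.

(** By translation invariance the second piece may start at the end of the first. The increment from
    the i-th point of the first piece to the j-th point of the second is the product of the letters
    between them. *)
Lemma capN_trace_gap N s t :
  0 <= capN N (trace s) + capN N (trace t) - capN N (trace (s ++ t)) <=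
  2 * \sum_(i < (size s).+1) \sum_(j < (size t).+1)
        greenN N (wprod (drop i s ++ take j t)).
Proof.
rewrite (eq_capN _ (trace_cat s t)) -(capN_mulg N (wprod s) (trace t)).
rewrite subr_ge0 capN_cat_le andTb; apply: le_trans (capN_cat_ge _ _ _) _.
rewrite ler_wpM2l// !traceE -map_comp big_map -[iota 0 _]/(index_iota 0 (size s).+1).
rewrite big_mkord; apply: ler_sum => i _.
rewrite big_map -[iota 0 _]/(index_iota 0 (size t).+1) big_mkord.
apply: ler_sum => j _; rewrite wprod_cat /=.
have e : wprod s = (wprod (take i s) * wprod (drop i s))%g.
  by rewrite -wprod_cat cat_take_drop.
by rewrite e -mulgA mulKg.
Qed.

Lemma cvg_ge_all (u : nat -> R) l x :
  u @ \oo --> l -> (forall n, x <= u n) -> x <= l.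
Proof. by move=> ul h; apply: (cvgr_to_ge ul); exact: nearW. Qed.

Lemma cvg_le_all (u : nat -> R) l x :
  u @ \oo --> l -> (forall n, u n <= x) -> l <= x.
Proof. by move=> ul h; apply: (cvgr_to_le ul); exact: nearW. Qed.

Definition cap A : R := lim (capN N A @[N --> \oo]).

Lemma capN_cvg A : capN N A @[N --> \oo] --> cap A.
Proof.
apply: nonincreasing_is_cvgn.
  by apply/nonincreasing_seqP => n; exact: capNS.
by exists 0 => _ [n _ <-]; exact: capN_ge0.
Qed.

Lemma cap_le_capN N A : cap A <= capN N A.
Proof.
apply: nonincreasing_cvgn_ge; last by apply/cvg_ex; exists (cap A); exact: capN_cvg.
by apply/nonincreasing_seqP => n; exact: capNS.
Qed.

Lemma cap_ge0 A : 0 <= cap A.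
Proof. by apply: cvg_ge_all (@capN_cvg A) _ => n; exact: capN_ge0. Qed.

Lemma cap_le_size A : cap A <= (size A)%:R.
Proof. exact: le_trans (cap_le_capN 0 A) (capN_le_size _ _). Qed.

Lemma eq_cap A B : A =i B -> cap A = cap B.
Proof. by move=> AB; congr lim; under eq_fun do rewrite (eq_capN _ AB). Qed.

(* The defect of additivity of the capacity of the trace under concatenation. *)
Definition gap s t := cap (trace s) + cap (trace t) - cap (trace (s ++ t)).
Definition gapN N s t :=
  capN N (trace s) + capN N (trace t) - capN N (trace (s ++ t)).

Lemma gapN_cvg s t : gapN N s t @[N --> \oo] --> gap s t.
Proof. by apply: cvgB; [apply: cvgD|]; exact: capN_cvg. Qed.

Lemma mean_cvg n (f : nat -> seq G -> R) g :
  (forall s, f N s @[N --> \oo] --> g s) ->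
  mean n (f N) @[N --> \oo] --> mean n g.
Proof.
move=> fg; apply: cvgM; first exact: cvg_cst.
elim: (words Gamma n) => [|s w IH].
  by under eq_fun do rewrite big_nil; rewrite big_nil; exact: cvg_cst.
by under eq_fun do rewrite big_cons; rewrite big_cons; exact: cvgD.
Qed.

(** A bound uniform in the truncation N passes to the limit, the means being finite sums. The 4 is
    the square of the 2 in [capN_trace_gap]. *)
Lemma mean_gap2_le n m c :
  (forall N, mean n (fun s => mean m (fun t =>
     (\sum_(i < n.+1) \sum_(j < m.+1)
        greenN N (wprod (drop i s ++ take j t))) ^+ 2)) <= c) ->
  mean n (fun s => mean m (fun t => gap s t ^+ 2)) <= 4 * c.
Proof.
move=> h.
have cv : mean n (fun s => mean m (fun t => gapN N s t ^+ 2)) @[N --> \oo] -->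
          mean n (fun s => mean m (fun t => gap s t ^+ 2)).
  apply: (@mean_cvg n (fun N s => mean m (fun t => gapN N s t ^+ 2))) => s.
  apply: (@mean_cvg m (fun N t => gapN N s t ^+ 2)) => t.
  by under eq_fun do rewrite expr2; rewrite expr2; apply: cvgM; exact: gapN_cvg.
apply: cvg_le_all cv _ => N; apply: le_trans (ler_wpM2l _ (h N)) => //.
rewrite -meanZ; apply: le_mean => s sn _; rewrite -meanZ; apply: le_mean => t tm _.
have /andP[g0] := capN_trace_gap N s t; rewrite -/(gapN N s t) sn tm => g1.
have -> : 4 = 2 ^+ 2 :> R by ring.
by rewrite -exprMn lerXn2r ?nnegrE// (le_trans g0).
Qed.

End Capacity.

(** * Second moment of the defect *)

Section GapMoment.
Context {R : realType} {G : groupType} (Gamma : {fset G}).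
Hypothesis Gamma0 : Gamma != fset0.
Hypothesis Gammasym : symmetric_set Gamma.
Local Notation mean := (@mean R G Gamma).
Local Notation hk := (@hk R G Gamma).
Local Notation greenN := (@greenN R G Gamma).
Variable K : R.
Hypothesis hk_le : forall n x, hk n x <= K / n.+1%:R ^+ 3.

Definition isq (n : nat) : R := (n.+1%:R ^+ 2)^-1.

Lemma isq_ge0 n : 0 <= isq n. Proof. by rewrite invr_ge0. Qed.

Lemma isq_le n m : (n <= m)%N -> isq m <= isq n.
Proof.
by move=> nm; rewrite /isq lef_pV2 ?posrE ?exprn_gt0// lerXn2r ?nnegrE// ler_nat.
Qed.

Lemma K_ge0 : 0 <= K.
Proof. by have := le_trans (hk_ge0 _ _ _) (hk_le 0 1%g); rewrite expr1n divr1. Qed.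

Lemma icube_step n : (n.+1%:R ^+ 3)^-1 <= 2 * isq n - 2 * isq n.+1.
Proof.
rewrite /isq -[n.+2%:R]natr1; have : 1 <= n.+1%:R :> R by rewrite ler1n.
move: (n.+1%:R : R) => q q1.
have q0 : 0 < q by lra.
have q0' : 0 < q + 1 by lra.
rewrite -subr_ge0.
have -> : 2 * (q ^+ 2)^-1 - 2 * ((q + 1) ^+ 2)^-1 - (q ^+ 3)^-1 =
  (2 * q * (2 * q + 1) - (q + 1) ^+ 2) / (q ^+ 3 * (q + 1) ^+ 2).
  by field; rewrite !gt_eqF.
by rewrite divr_ge0 ?mulr_ge0 ?exprn_ge0 ?(ltW q0) ?(ltW q0')//; nra.
Qed.

Lemma isq_step n : isq n <= 2 * n.+1%:R^-1 - 2 * n.+2%:R^-1.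
Proof.
rewrite /isq -[n.+2%:R]natr1; have : 1 <= n.+1%:R :> R by rewrite ler1n.
move: (n.+1%:R : R) => q q1.
have q0 : 0 < q by lra.
have q0' : 0 < q + 1 by lra.
rewrite -subr_ge0.
have -> : 2 * q^-1 - 2 * (q + 1)^-1 - (q ^+ 2)^-1 =
  (2 * q - (q + 1)) / (q ^+ 2 * (q + 1)).
  by field; rewrite !gt_eqF.
by rewrite divr_ge0 ?mulr_ge0 ?exprn_ge0 ?(ltW q0) ?(ltW q0')//; nra.
Qed.

Lemma sum_icube p M :
  \sum_(k < M) ((p + k).+1%:R ^+ 3)^-1 <= 2 * isq p - 2 * isq (p + M).
Proof.
elim: M => [|M IH]; first by rewrite big_ord0 addn0 subrr.
rewrite big_ord_recr /= addnS; apply: le_trans (lerD IH (icube_step _)) _.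
by rewrite addrA subrK.
Qed.

Lemma sum_isq p M :
  \sum_(k < M) isq (p + k) <= 2 * p.+1%:R^-1.
Proof.
apply: (@le_trans _ _ (2 * p.+1%:R^-1 - 2 * (p + M).+1%:R^-1)); last first.
  by rewrite gerDl oppr_le0 mulr_ge0.
elim: M => [|M IH]; first by rewrite big_ord0 addn0 subrr.
rewrite big_ord_recr /= addnS; apply: le_trans (lerD IH (isq_step _)) _.
by rewrite addrA subrK.
Qed.

Lemma greenN_ge0 N x : 0 <= greenN N x.
Proof. by apply: sumr_ge0 => k _; exact: hk_ge0. Qed.

(** Multiplying by independent random words on both sides only lengthens the walk: k steps become q
    + k + p. *)
Lemma hk_two_sided k p q x :
  mean p (fun a => mean q (fun b => hk k (wprod a * x * wprod b)%g)) =
  hk (q + k + p) x^-1%g.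
Proof.
under eq_mean do under eq_mean do rewrite -(hk_inv Gammasym).
rewrite [LHS]mean_swap /hk [RHS]mean_cat [RHS]mean_cat; apply: eq_mean => b _ _.
rewrite mean_swap; apply: eq_mean => c _ _; apply: eq_mean => a _ _.
congr (nat_of_bool _)%:R; rewrite !wprod_cat; apply/eqP/eqP => [->|h].
  by rewrite !invgM mulVKg mulgVK.
by rewrite !invgM -h -!mulgA mulgV mulg1 mulKg.
Qed.

(** After averaging, the Green function only collects times from p + q on, and the tail of the sum
    of the inverse cubes is of order (p + q)^-2. *)
Lemma greenN_two_sided N p q x :
  mean p (fun a => mean q (fun b => greenN N (wprod a * x * wprod b)%g)) <=
  2 * K * isq (p + q).
Proof.
rewrite /greenN; under eq_mean do under eq_mean do rewrite -/(hk _ _).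
under eq_mean do rewrite mean_sum.
rewrite mean_sum; under eq_bigr do rewrite hk_two_sided.
apply: (@le_trans _ _ (\sum_(k < N.+1) K * ((p + q + k).+1%:R ^+ 3)^-1)).
  apply: ler_sum => k _; apply: le_trans (hk_le _ _) _.
  by have -> : (q + k + p = p + q + k)%N by lia.
rewrite -mulr_sumr mulrAC mulrC ler_wpM2r ?K_ge0//.
apply: le_trans (sum_icube _ _) _.
by rewrite gerDl oppr_le0 mulr_ge0// isq_ge0.
Qed.

Lemma mean_suffixes n i i' (F : seq G -> seq G -> R) : (i <= i' <= n)%N ->
  mean n (fun s => F (drop (n - i) s) (drop (n - i') s)) =
  mean (i' - i) (fun a => mean i (fun u => F u (a ++ u))).
Proof.
move=> /andP[ii' i'n].
have e : n = (n - i' + ((i' - i) + i))%N by lia.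
rewrite {1}e mean_cat -[RHS](mean_cst Gamma0 (n - i')); apply: eq_mean => s sn _.
rewrite mean_cat; apply: eq_mean => a an _; apply: eq_mean => u un _.
rewrite [in X in F _ X]drop_size_cat//; congr F.
by rewrite catA drop_size_cat// size_cat sn an; lia.
Qed.

Lemma mean_prefixes m j j' (F : seq G -> seq G -> R) : (j <= j' <= m)%N ->
  mean m (fun t => F (take j t) (take j' t)) =
  mean j (fun u => mean (j' - j) (fun b => F u (u ++ b))).
Proof.
move=> /andP[jj' j'm].
have e : m = (j + ((j' - j) + (m - j')))%N by lia.
rewrite {1}e mean_cat; apply: eq_mean => u un _.
rewrite mean_cat; apply: eq_mean => b bn _.
rewrite -[RHS](mean_cst Gamma0 (m - j')); apply: eq_mean => t tn _.
rewrite take_size_cat//; congr F.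
by rewrite catA take_size_cat// size_cat un bn; lia.
Qed.

(* The two subwords are either nested, and then the two ends of the outer one are
   averaged first, or they overlap, and then the longer of the two ends is. *)
Lemma greenN_pair_le N n m i i' j j' :
  (i <= n)%N -> (i' <= n)%N -> (j <= m)%N -> (j' <= m)%N ->
  mean n (fun s => mean m (fun t =>
    greenN N (wprod (drop (n - i) s ++ take j t)) *
    greenN N (wprod (drop (n - i') s ++ take j' t)))) <=
  16 * K ^+ 2 * isq (minn i i' + minn j j') *
    isq (i' - i + (i - i') + (j' - j + (j - j'))).
Proof.
wlog ii' : i i' j j' / (i <= i')%N => [hw|].
  have [ii'|ii'] := orP (leq_total i i'); first exact: hw.
  move=> iN i'N jN j'N; have := hw i' i j' j ii' i'N iN j'N jN.
  rewrite minnC (minnC j') (addnC (i - i')%N) (addnC (j - j')%N).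
  by under eq_mean do under eq_mean do rewrite mulrC.
move=> iN i'N jN j'N; rewrite (minn_idPl ii') (eqP ii') addn0.
set p := (i' - i)%N.
rewrite (mean_suffixes (fun u v => mean m (fun t =>
  greenN N (wprod (u ++ take j t)) * greenN N (wprod (v ++ take j' t))))) ?ii'//.
have KK : 0 <= 2 * K by rewrite mulr_ge0 ?K_ge0.
have [jj'|j'j] := orP (leq_total j j').
  rewrite (minn_idPl jj') (eqP jj') addn0; set q := (j' - j)%N.
  under eq_mean => a _ _. under eq_mean => u _ _.
    rewrite (mean_prefixes (fun v w => greenN N (wprod (u ++ v)) *
      greenN N (wprod ((a ++ u) ++ w)))) ?jj'//; over. over.
  rewrite mean_swap.
  under eq_mean do rewrite mean_swap.
  under eq_mean => u _ _. under eq_mean => v _ _.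
    under eq_mean do rewrite meanZ.
    rewrite meanZ; over. over.
  rewrite -/q.
  apply: (@le_trans _ _ (mean i (fun u => mean j (fun v =>
     greenN N (wprod u * 1 * wprod v)%g * (2 * K * isq (p + q)))))).
    apply: le_mean => u _ _; apply: le_mean => v _ _.
    rewrite wprod_cat mulg1 ler_wpM2l ?greenN_ge0//.
    apply: le_trans (greenN_two_sided N p q (wprod u * wprod v)%g).
    apply: le_mean => a _ _; apply: le_mean => b _ _.
    by rewrite !wprod_cat !mulgA.
  under eq_mean do rewrite meanZr.
  rewrite meanZr.
  apply: le_trans (ler_wpM2r _ (greenN_two_sided N i j 1%g)) _.
    by rewrite mulr_ge0 ?isq_ge0.
  have := mulr_ge0 (sqr_ge0 K) (mulr_ge0 (isq_ge0 (i + j)) (isq_ge0 (p + q))).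
  nra.
rewrite (minn_idPr j'j) (eqP j'j) add0n; set q := (j - j')%N.
under eq_mean => a _ _. under eq_mean => u _ _.
  rewrite (mean_prefixes (fun v w => greenN N (wprod (u ++ w)) *
    greenN N (wprod ((a ++ u) ++ v)))) ?j'j//.
  under eq_mean do rewrite meanZr.
  over. over.
rewrite -/q.
have two_right u v : mean q (fun b => greenN N (wprod (u ++ (v ++ b)))) <=
    2 * K * isq q.
  have := greenN_two_sided N 0 q (wprod u * wprod v)%g; rewrite mean0 add0n.
  by under eq_mean do rewrite wprod_nil mul1g -!wprod_cat -catA.
have two_left u v : mean p (fun a => greenN N (wprod ((a ++ u) ++ v))) <=
    2 * K * isq p.
  have := greenN_two_sided N p 0 (wprod u * wprod v)%g; rewrite addn0.
  by under eq_mean do rewrite mean0 wprod_nil mulg1 -!wprod_cat catA.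
have mid_right : mean i (fun u => mean j' (fun v =>
    mean q (fun b => greenN N (wprod (u ++ (v ++ b)))))) <= 2 * K * isq (i + j').
  have := greenN_two_sided N i (j' + q) 1%g.
  under eq_mean do rewrite mean_cat.
  under eq_mean do under eq_mean do under eq_mean do rewrite mulg1 -wprod_cat.
  move=> /le_trans; apply; rewrite ler_wpM2l// isq_le//; lia.
have mid_left : mean p (fun a => mean i (fun u => mean j' (fun v =>
    greenN N (wprod ((a ++ u) ++ v))))) <= 2 * K * isq (i + j').
  have := greenN_two_sided N (p + i) j' 1%g.
  rewrite mean_cat.
  under eq_mean do under eq_mean do under eq_mean do rewrite mulg1 -wprod_cat.
  move=> /le_trans; apply; rewrite ler_wpM2l// isq_le//; lia.
(* Only the longer of the two ends is averaged, and [isq] of its length replaces [isq (p + q)] at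
   the price of a factor 4. Together with the two factors 2 K this is the constant [16 * K ^+ 2]. *)
have four : forall x y, (y <= x)%N -> isq x <= 4 * isq (x + y).
  move=> x y yx; rewrite /isq ler_pdivlMr ?exprn_gt0// mulrC.
  rewrite ler_pdivrMr ?exprn_gt0//.
  have -> : 4 = 2 ^+ 2 :> R by ring.
  by rewrite -exprMn lerXn2r ?nnegrE// -natrM ler_nat; lia.
have ai0 := isq_ge0 (i + j').
have [pq|qp] := orP (leq_total p q).
  apply: (@le_trans _ _ (mean p (fun a => mean i (fun u => mean j' (fun v =>
    (2 * K * isq q) * greenN N (wprod ((a ++ u) ++ v))))))).
    apply: le_mean => a _ _; apply: le_mean => u _ _; apply: le_mean => v _ _.
    by rewrite ler_wpM2r ?greenN_ge0.
  under eq_mean do under eq_mean do rewrite meanZ.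
  under eq_mean do rewrite meanZ.
  rewrite meanZ; apply: le_trans (ler_wpM2l _ mid_left) _.
    by rewrite mulr_ge0 ?isq_ge0.
  have h4 := four q p pq; rewrite addnC in h4.
  have := mulr_ge0 (sqr_ge0 K) (mulr_ge0 ai0 (_ : 0 <= 4 * isq (p + q) - isq q)).
  rewrite subr_ge0 => /(_ h4); nra.
rewrite mean_swap.
under eq_mean do rewrite mean_swap.
apply: (@le_trans _ _ (mean i (fun u => mean j' (fun v =>
   mean q (fun b => greenN N (wprod (u ++ (v ++ b)))) * (2 * K * isq p))))).
  apply: le_mean => u _ _; apply: le_mean => v _ _.
  rewrite meanZ ler_wpM2l//; apply: mean_ge0 => b _ _; exact: greenN_ge0.
under eq_mean do rewrite meanZr.
rewrite meanZr; apply: le_trans (ler_wpM2r _ mid_right) _.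
  by rewrite mulr_ge0 ?isq_ge0.
have h4 := four p q qp.
have := mulr_ge0 (sqr_ge0 K) (mulr_ge0 ai0 (_ : 0 <= 4 * isq (p + q) - isq p)).
rewrite subr_ge0 => /(_ h4); nra.
Qed.

Definition harm (n : nat) : R := \sum_(k < n) k.+1%:R^-1.

Lemma sum_isq2 n m : \sum_(i < n) \sum_(j < m) isq (i + j) <= 2 * harm m.
Proof.
rewrite exchange_big /harm mulr_sumr; apply: ler_sum => j _ /=.
by under eq_bigr do rewrite addnC; exact: sum_isq.
Qed.

(** The map from (i, i') to the minimum and the absolute difference is at most two-to-one. *)
Lemma sum_min_diff n (F : nat -> nat -> R) : (forall a p, 0 <= F a p) ->
  \sum_(i < n) \sum_(i' < n) F (minn i i') (i' - i + (i - i'))%N <=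
  2 * \sum_(a < n) \sum_(p < n) F a p.
Proof.
move=> F0.
have half : \sum_(i < n) \sum_(i' < n | (i <= i')%N) F i (i' - i)%N <=
    \sum_(a < n) \sum_(p < n) F a p.
  apply: ler_sum => i _.
  rewrite -(big_mkord (fun i' : nat => (i <= i')%N) (fun i' => F i (i' - i)%N)).
  rewrite -(big_mkord xpredT (F i)).
  rewrite (big_cat_nat (n := i)) ?(ltnW (ltn_ord i))//= big_nat_cond big1 ?add0r; last first.
    by move=> k /andP[/andP[_ ki] ik]; move: (leq_trans ki ik); rewrite ltnn.
  rewrite -{1}(add0n (i : nat)) big_addn.
  rewrite (eq_big (fun=> true) (F i)); last 2 first.
  - by move=> k; rewrite leq_addl.
  - by move=> k _; rewrite addnK.
  rewrite [leRHS](big_cat_nat (n := (n - i)%N)) ?leq_subr//= lerDl.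
  by apply: sumr_ge0.
have -> : 2 * \sum_(a < n) \sum_(p < n) F a p =
  \sum_(a < n) \sum_(p < n) F a p + \sum_(a < n) \sum_(p < n) F a p by ring.
apply: le_trans (lerD half half).
rewrite [X in _ <= _ + X](exchange_big_dep xpredT)//= -big_split; apply: ler_sum => i _ /=.
rewrite (bigID (fun i' : 'I_n => (i <= i')%N)) /= lerD//.
  apply: ler_sum => i' ii'; rewrite (minn_idPl ii').
  by rewrite (eqP (_ : i - i' == 0)%N) ?addn0// subn_eq0.
rewrite [leRHS](bigID (fun i' : 'I_n => (i <= i')%N)) /= -[leLHS]add0r lerD ?sumr_ge0//.
apply: le_trans (_ : \sum_(i' < n | ~~ (i <= i')%N) F i' (i - i')%N <= _).
  apply: ler_sum => i'; rewrite -ltnNge => /ltnW ii'; rewrite (minn_idPr ii').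
  by rewrite (eqP (_ : i' - i == 0)%N) ?add0n// subn_eq0.
rewrite le_eqVlt; apply/orP; left; apply/eqP; apply: eq_bigl => i'.
by rewrite -ltnNge; case: ltngtP.
Qed.

(** The square expands into a sum over pairs (i, i') and (j, j'). In terms of minima and differences
    the bound of [greenN_pair_le] becomes a product, and the sum decouples into the square of the
    sum of [isq (i + j)], at most twice a harmonic number. The constant is 16 from the pairs, 2 * 2
    from two uses of [sum_min_diff], and 2 ^ 2 from the square. *)
Lemma greenN_moment N n m :
  mean n (fun s => mean m (fun t =>
    (\sum_(i < n.+1) \sum_(j < m.+1)
      greenN N (wprod (drop i s ++ take j t))) ^+ 2)) <=
  256 * (K * harm m.+1) ^+ 2.
Proof.
pose a i j s t := greenN N (wprod (drop (n - i) s ++ take j t)).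
have aE s t : (\sum_(i < n.+1) \sum_(j < m.+1)
      greenN N (wprod (drop i s ++ take j t))) ^+ 2 =
   \sum_(i < n.+1) \sum_(i' < n.+1) \sum_(j < m.+1) \sum_(j' < m.+1)
      a i j s t * a i' j' s t.
  (* From here on i counts the letters between the chosen point and the junction of the two
     pieces. *)
  rewrite (reindex_inj rev_ord_inj) /=.
  under eq_bigr do under eq_bigr do rewrite subSS -/(a _ _ _ _).
  rewrite expr2 mulr_suml; apply: eq_bigr => i _.
  rewrite mulr_sumr; apply: eq_bigr => i' _.
  rewrite mulr_suml; apply: eq_bigr => j _.
  by rewrite mulr_sumr.
under eq_mean do under eq_mean do rewrite aE.
have mean2_sum k (F : 'I_k -> seq G -> seq G -> R) :
    mean n (fun s => mean m (fun t => \sum_(i < k) F i s t)) =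
    \sum_(i < k) mean n (fun s => mean m (F i s)).
  by under eq_mean do rewrite mean_sum; rewrite mean_sum.
pose b x y := \sum_(j < m.+1) \sum_(j' < m.+1)
  isq (x + minn j j') * isq (y + (j' - j + (j - j')))%N.
apply: (@le_trans _ _ (\sum_(i < n.+1) \sum_(i' < n.+1)
   16 * K ^+ 2 * b (minn i i') (i' - i + (i - i'))%N)).
  rewrite mean2_sum; apply: ler_sum => i _.
  rewrite mean2_sum; apply: ler_sum => i' _.
  rewrite mean2_sum mulr_sumr; apply: ler_sum => j _.
  rewrite mean2_sum mulr_sumr; apply: ler_sum => j' _.
  rewrite mulrA; apply: greenN_pair_le; by rewrite -ltnS ltn_ord.
under eq_bigr do rewrite -mulr_sumr.
rewrite -mulr_sumr.
have b_le x y : b x y <= 2 * \sum_(j < m.+1) \sum_(q < m.+1) isq (x + j) * isq (y + q).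
  apply: (@sum_min_diff m.+1 (fun j q => isq (x + j) * isq (y + q))) => j q.
  by rewrite mulr_ge0 ?isq_ge0.
have b0 x y : 0 <= b x y.
  by apply: sumr_ge0 => j _; apply: sumr_ge0 => q _; rewrite mulr_ge0 ?isq_ge0.
have := @sum_min_diff n.+1 b b0.
set S := \sum_(i < n.+1) _ => S_le.
have : \sum_(x < n.+1) \sum_(y < n.+1) b x y <=
    2 * (\sum_(x < n.+1) \sum_(j < m.+1) isq (x + j)) ^+ 2.
  rewrite expr2 mulr_suml mulr_sumr; apply: ler_sum => x _.
  rewrite mulr_sumr mulr_sumr; apply: ler_sum => y _.
  apply: le_trans (b_le x y) _; rewrite ler_wpM2l//.
  rewrite mulr_suml; apply: ler_sum => j _.
  by rewrite mulr_sumr.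
have := sum_isq2 n.+1 m.+1; set D := \sum_(x < n.+1) \sum_(j < m.+1) _ => D_le.
have D0 : 0 <= D by apply: sumr_ge0 => i _; apply: sumr_ge0 => j _; exact: isq_ge0.
have D2 : D ^+ 2 <= (2 * harm m.+1) ^+ 2 by rewrite lerXn2r ?nnegrE// (le_trans D0).
move=> T_le; have S16 : S <= 16 * harm m.+1 ^+ 2 by move: S_le T_le D2; lra.
rewrite exprMn; have := ler_wpM2l (sqr_ge0 K) S16; nra.
Qed.

End GapMoment.

(** * Standard deviations *)

Section Deviation.
Context {R : realType} {G : groupType} (Gamma : {fset G}).
Hypothesis Gamma0 : Gamma != fset0.
Local Notation mean := (@mean R G Gamma).
Local Notation norm2 := (@norm2 R G Gamma).

Definition centered n (f : seq G -> R) s := f s - mean n f.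

Definition sd n f := norm2 n (centered n f).

Lemma sd_ge0 n f : 0 <= sd n f. Proof. exact: norm2_ge0. Qed.

Lemma eq_sd n f g :
  (forall s, size s = n -> {subset s <= Gamma} -> f s = g s) -> sd n f = sd n g.
Proof.
move=> fg; apply: eq_norm2 => s sn sG.
by rewrite /centered (fg s sn sG) (eq_mean fg).
Qed.

Lemma mean_centered n f : mean n (centered n f) = 0.
Proof. by rewrite /centered meanB mean_cst// subrr. Qed.

Lemma sd_le_norm2 n f : sd n f <= norm2 n f.
Proof.
rewrite /sd /norm2 ler_wsqrtr// /centered.
have -> : mean n (fun s => (f s - mean n f) ^+ 2) =
    mean n (fun s => f s ^+ 2) - mean n f ^+ 2.
  have -> : mean n (fun s => (f s - mean n f) ^+ 2) =
     mean n (fun s => (f s ^+ 2 - 2 * mean n f * f s) + mean n f ^+ 2).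
    by apply: eq_mean => s _ _; ring.
  rewrite meanD meanB meanZ mean_cst//; ring.
by rewrite gerBl sqr_ge0.
Qed.

Lemma sdD n f g : sd n (fun s => f s + g s) <= sd n f + sd n g.
Proof.
apply: le_trans _ (@norm2D R G Gamma n (centered n f) (centered n g)).
rewrite le_eqVlt; apply/orP; left; apply/eqP; apply: eq_norm2 => s _ _.
by rewrite /centered meanD; ring.
Qed.

Lemma sdN n f : sd n (fun s => - f s) = sd n f.
Proof.
rewrite -[RHS]norm2N; apply: eq_norm2 => s _ _.
by rewrite /centered meanN; ring.
Qed.

Lemma sdB n f g : sd n (fun s => f s - g s) <= sd n f + sd n g.
Proof. by apply: le_trans (sdD _ _ _) _; rewrite sdN. Qed.

Lemma sd_dist n f g : `|sd n f - sd n g| <= sd n (fun s => f s - g s).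
Proof.
have h f' g' : sd n f' <= sd n g' + sd n (fun s => f' s - g' s).
  rewrite addrC; apply: le_trans _ (sdD _ _ _).
  by rewrite le_eqVlt; apply/orP; left; apply/eqP; apply: eq_sd => s _ _; rewrite subrK.
have hC : sd n (fun s => g s - f s) = sd n (fun s => f s - g s).
  by rewrite -sdN; apply: eq_sd => s _ _; rewrite opprB.
by rewrite ler_norml; have := h f g; have := h g f; rewrite hC => h1 h2; apply/andP; split; lra.
Qed.

Lemma sd_cst n c : sd n (fun=> c) = 0.
Proof.
rewrite /sd /centered mean_cst// subrr norm2_cst// normr0 //.
Qed.

Lemma mean_takel n m f : mean (n + m) (fun w => f (take n w)) = mean n f.
Proof.
rewrite mean_cat; apply: eq_mean => s sn _.
rewrite -[RHS](mean_cst Gamma0 m); apply: eq_mean => t _ _.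
by rewrite take_size_cat.
Qed.

Lemma mean_dropl n m f : mean (n + m) (fun w => f (drop n w)) = mean m f.
Proof.
rewrite mean_cat -[RHS](mean_cst Gamma0 n); apply: eq_mean => s sn _.
by apply: eq_mean => t _ _; rewrite drop_size_cat.
Qed.

Lemma mean_take_drop n m f g :
  mean (n + m) (fun w => f (take n w) * g (drop n w)) = mean n f * mean m g.
Proof.
rewrite mean_cat -meanZr; apply: eq_mean => s sn _; rewrite -meanZ.
by apply: eq_mean => t _ _; rewrite take_size_cat// drop_size_cat.
Qed.

Lemma sd_take n m f : sd (n + m) (fun w => f (take n w)) = sd n f.
Proof.
congr Num.sqrt; rewrite /centered mean_takel.
exact: (mean_takel n m (fun s => (f s - mean n f) ^+ 2)).
Qed.

Lemma sd_drop n m f : sd (n + m) (fun w => f (drop n w)) = sd m f.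
Proof.
congr Num.sqrt; rewrite /centered mean_dropl.
exact: (mean_dropl n m (fun s => (f s - mean m f) ^+ 2)).
Qed.

Lemma sd_sq n f : sd n f ^+ 2 = mean n (fun s => centered n f s ^+ 2).
Proof. exact: norm2_sq. Qed.

(** The cross term is a mean of a product of centered functions of disjoint groups of letters, hence
    0. *)
Lemma sd_indep n m f g :
  sd (n + m) (fun w => f (take n w) + g (drop n w)) =
  Num.sqrt (sd n f ^+ 2 + sd m g ^+ 2).
Proof.
rewrite /sd /norm2 !sqr_sqrtr; first last.
- by apply: mean_ge0 => s _ _; exact: sqr_ge0.
- by apply: mean_ge0 => s _ _; exact: sqr_ge0.
congr Num.sqrt.
have -> : mean (n + m) (fun w =>
    centered (n + m) (fun w => f (take n w) + g (drop n w)) w ^+ 2) =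
  mean (n + m) (fun w => (centered n f (take n w)) ^+ 2 +
     (centered m g (drop n w)) ^+ 2 +
     2 * (centered n f (take n w) * centered m g (drop n w))).
  apply: eq_mean => s _ _; rewrite /centered meanD mean_takel mean_dropl; ring.
rewrite !meanD meanZ mean_take_drop !mean_centered !mulr0 addr0.
by rewrite (mean_takel n m (fun s => centered n f s ^+ 2))
  (mean_dropl n m (fun s => centered m g s ^+ 2)).
Qed.

End Deviation.

(** * Approximation by sums over blocks *)

Section BlockError.
Context {R : realType} {G : groupType} (Gamma : {fset G}).
Hypothesis Gamma0 : Gamma != fset0.
Hypothesis Gammasym : symmetric_set Gamma.
Local Notation mean := (@mean R G Gamma).
Local Notation norm2 := (@norm2 R G Gamma).
Local Notation sd := (@sd R G Gamma).
Local Notation harm := (@harm R).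
Variable K : R.
Hypothesis hk_le : forall n x, @hk R G Gamma n x <= K / n.+1%:R ^+ 3.

Definition rcap (s : seq G) : R := cap Gamma (trace s).
Local Notation gap := (@gap R G Gamma).

Lemma rcap_cat s t : rcap (s ++ t) = rcap s + rcap t - gap s t.
Proof. by rewrite /gap /rcap; ring. Qed.

Lemma rcap_bound s : 0 <= rcap s <= (size s).+1%:R.
Proof.
by rewrite cap_ge0 //= (le_trans (cap_le_size _ _))// size_trace.
Qed.

Lemma harm_le n m : (n <= m)%N -> harm n <= harm m.
Proof.
move=> nm; rewrite /harm -!(big_mkord xpredT (fun k => k.+1%:R^-1)).
by rewrite [leRHS](big_cat_nat (n := n))//= lerDl; apply: sumr_ge0.
Qed.

Lemma harm_pow2 l : harm (2 ^ l) <= l.+1%:R.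
Proof.
elim: l => [|l IH]; first by rewrite /harm big_ord1 invr1.
rewrite /harm -(big_mkord xpredT (fun k => k.+1%:R^-1)).
rewrite (big_cat_nat (n := (2 ^ l)%N)) ?leq_exp2l//= big_mkord.
rewrite -[l.+2%:R]natr1 lerD//.
rewrite big_nat_cond.
apply: (@le_trans _ _ (\sum_(2 ^ l <= i < 2 ^ l.+1) (2 ^+ l)^-1)).
  rewrite [leRHS]big_nat_cond; apply: ler_sum => i; rewrite andbT => /andP[li _].
  by rewrite lef_pV2 ?posrE ?exprn_gt0// -natrX ler_nat ltnW.
rewrite sumr_const_nat expnS mul2n -addnn addnK -(mulr_natr (2 ^+ l)^-1) natrX.
by rewrite mulVf ?expf_neq0.
Qed.

(** The square root of 4 * 256 * K ^ 2, the constants of [mean_gap2_le] and [greenN_moment]. *)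
Definition kappa : R := 32 * K.

Lemma kappa_ge0 : 0 <= kappa.
Proof. by rewrite mulr_ge0// (K_ge0 hk_le). Qed.

Lemma norm2_gap n m l : (m.+1 <= 2 ^ l)%N ->
  norm2 (n + m) (fun w => gap (take n w) (drop n w)) <= kappa * l.+1%:R.
Proof.
move=> ml; rewrite -[leRHS]ger0_norm; last by apply: mulr_ge0; rewrite ?kappa_ge0.
rewrite -sqrtr_sqr ler_wsqrtr//.
have -> : mean (n + m) (fun w => gap (take n w) (drop n w) ^+ 2) =
    mean n (fun s => mean m (fun t => gap s t ^+ 2)).
  rewrite mean_cat; apply: eq_mean => s sn _; apply: eq_mean => t _ _.
  by rewrite take_size_cat// drop_size_cat.
apply: le_trans (mean_gap2_le Gamma0 Gammasym
  (fun N => greenN_moment Gamma0 Gammasym hk_le N n m)) _.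
rewrite /kappa !exprMn.
have : harm m.+1 ^+ 2 <= l.+1%:R ^+ 2.
  rewrite lerXn2r ?nnegrE ?(K_ge0 hk_le) ?sumr_ge0//.
    exact: le_trans (harm_le ml) (harm_pow2 l).
move=> h; have := ler_wpM2l (sqr_ge0 K) h; nra.
Qed.

Definition blocksum (f : seq G -> R) m q (w : seq G) : R :=
  \sum_(i < q) f (take m (drop (i * m) w)).

Lemma blocksum_cat f m a b u v : size u = (a * m)%N ->
  blocksum f m (a + b) (u ++ v) = blocksum f m a u + blocksum f m b v.
Proof.
move=> um; rewrite /blocksum big_split_ord /=; congr (_ + _).
  apply: eq_bigr => i _; congr (f _).
  have ia : (i * m + m <= size u)%N by rewrite um -mulSnr leq_mul2r ltn_ord orbT.
  rewrite drop_cat; case: ltnP => h; last first.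
    have -> : m = 0%N by lia.
    by rewrite !take0.
  by rewrite takel_cat// size_drop; lia.
apply: eq_bigr => i _; congr (f (take _ _)).
by rewrite drop_cat um mulnDl ltnNge leq_addr /= addKn.
Qed.

Lemma blocksum_take f m q w : (q * m <= size w)%N ->
  blocksum f m q w = blocksum f m q (take (q * m) w).
Proof.
move=> wn; have wq : size (take (q * m) w) = (q * m)%N by rewrite size_takel.
have := @blocksum_cat f m q 0 (take (q * m) w) (drop (q * m) w) wq.
by rewrite addn0 cat_take_drop {3}/blocksum big_ord0 addr0.
Qed.

Lemma sd_bound n f c : (forall s, size s = n -> {subset s <= Gamma} ->
  0 <= f s <= c) -> 0 <= c -> sd n f <= c.
Proof.
move=> fc c0; apply: le_trans (sd_le_norm2 _ _ _) _ => //.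
by apply: norm2_bound => // s sn sG; have /andP[f0 f1] := fc s sn sG; rewrite ger0_norm.
Qed.

Definition sqrt2 : R := Num.sqrt 2.

Lemma sqrt2_sq : sqrt2 ^+ 2 = 2. Proof. by rewrite sqr_sqrtr. Qed.

Lemma sqrt2_ge0 : 0 <= sqrt2. Proof. exact: sqrtr_ge0. Qed.

Lemma sqrt2_ge : 7 / 5 <= sqrt2.
Proof.
have := sqrt2_sq; have : 0 <= sqrt2 by exact: sqrtr_ge0.
move: sqrt2 => r r0 r2; rewrite leNgt; apply/negP => h; nra.
Qed.

(* Halving the number of blocks: the two half errors are independent, so that
   their standard deviations add up in squares, and the gap between the halves
   only costs a logarithm, by [norm2_gap]. *)
Lemma sd_blocksum_err p k q m : (m <= 2 ^ p)%N -> (q <= 2 ^ k)%N ->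
  sd (q * m) (fun w => rcap w - blocksum rcap m q w) <=
  5 * kappa * ((p + 4)%:R * sqrt2 ^+ k - (k + p + 4)%:R).
Proof.
move=> mp; elim: k q => [|k IH] q qk.
  rewrite expr0 mulr1 add0n subrr mulr0.
  have [->|->] : q = 0%N \/ q = 1%N by move: qk; rewrite expn0; lia.
    rewrite (eq_sd (g := fun=> rcap [::])) ?sd_cst// => s.
    by move=> /eqP; rewrite size_eq0 => /eqP -> _; rewrite /blocksum big_ord0 subr0.
  rewrite (eq_sd (g := fun=> 0)) ?sd_cst// => s sm _.
  by rewrite /blocksum big_ord1 mul0n drop0 take_oversize ?subrr// sm mul1n.
pose a := q./2; pose b := (q - a)%N.
have qab : q = (a + b)%N by rewrite /b subnKC// /a; lia.
have ak : (a <= 2 ^ k)%N by move: qk; rewrite /a expnS; lia.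
have bk : (b <= 2 ^ k)%N by move: qk; rewrite /b /a expnS; lia.
have := IH a ak; have := IH b bk.
set X := 5 * kappa * _ => hb ha.
pose err c w := rcap w - blocksum rcap m c w.
have bm : ((b * m).+1 <= 2 ^ (k + p + 1))%N.
  have : (b * m <= 2 ^ k * 2 ^ p)%N by rewrite leq_mul.
  have : (0 < 2 ^ (k + p))%N by rewrite expn_gt0.
  rewrite -expnD addn1 expnS; lia.
rewrite qab mulnDl.
rewrite (eq_sd (g := fun w => (err a (take (a * m) w) + err b (drop (a * m) w)) -
   gap (take (a * m) w) (drop (a * m) w))); last first.
  move=> w wn _; rewrite -{1 2}(cat_take_drop (a * m) w) rcap_cat blocksum_cat.
    by rewrite /err; ring.
  by rewrite size_takel// wn leq_addr.
apply: le_trans (@sdB R G Gamma _ _ _) _.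
rewrite sd_indep//.
have s2X : Num.sqrt (sd (a * m) (err a) ^+ 2 + sd (b * m) (err b) ^+ 2) <= sqrt2 * X.
  have X0 : 0 <= X by apply: le_trans hb; exact: sd_ge0.
  rewrite -[leRHS]ger0_norm; last by apply: mulr_ge0 => //; exact: sqrt2_ge0.
  rewrite -sqrtr_sqr ler_wsqrtr//.
  rewrite exprMn sqrt2_sq.
  have h c : sd (c * m) (err c) <= X -> sd (c * m) (err c) ^+ 2 <= X ^+ 2.
    by move=> hc; rewrite lerXn2r ?nnegrE ?sd_ge0.
  by have := h a ha; have := h b hb; lra.
apply: le_trans (lerD s2X (le_trans (sd_le_norm2 Gamma0 _ _) (norm2_gap _ bm))) _.
(* With z = k + p the new gap costs [kappa * (z + 2)]. The subtracted linear term of the bound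
   absorbs it: since sqrt 2 >= 7 / 5, the quantity 5 * (sqrt 2 * (z + 4) - (z + 5)) is at least 2 z
   + 3. *)
rewrite /X exprS; have := sqrt2_ge; have := kappa_ge0.
have x0 : 0 <= (k + p)%:R :> R by [].
have -> : (k.+1 + p + 4)%:R = (k + p)%:R + 5 :> R by rewrite -natrD; congr _%:R; lia.
have -> : (k + p + 4)%:R = (k + p)%:R + 4 :> R by rewrite -natrD.
have -> : (k + p + 1).+1%:R = (k + p)%:R + 2 :> R by rewrite -natrD; congr _%:R; lia.
move: kappa sqrt2 (sqrt2 ^+ k) x0 ((p + 4)%:R : R) => K' r s.
move: ((k + p)%:R : R) => z z0 P K0 r7.
have h1 := mulr_ge0 K0 z0.
have h2 : 0 <= K' * (z + 4) * (r - 7 / 5) by rewrite !mulr_ge0//; lra.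
nra.
Qed.

(** The price of the incomplete last block: a bound on its own capacity, and the gap between it and
    the full blocks. *)
Definition block_cst p : R := (2 ^ p).+1%:R + kappa * p.+1%:R.

Lemma sd_block_approx p q r : (r < 2 ^ p)%N ->
  sd (q * 2 ^ p + r) (fun w => rcap w - blocksum rcap (2 ^ p) q w) <=
  10 * kappa * (p + 4)%:R * Num.sqrt q%:R + block_cst p.
Proof.
move=> rp; set m := (2 ^ p)%N.
have first : sd (q * m) (fun w => rcap w - blocksum rcap m q w) <=
    10 * kappa * (p + 4)%:R * Num.sqrt q%:R.
  have [->|q0] := posnP q.
    rewrite sqrtr0 mulr0 (eq_sd (g := fun=> rcap [::])) ?sd_cst// => s.
    by move=> /eqP; rewrite mul0n size_eq0 => /eqP -> _; rewrite /blocksum big_ord0 subr0.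
  have [k qk kq] : exists2 k, (q <= 2 ^ k)%N & (2 ^ k <= 2 * q)%N.
    have [q1|q1] := leqP q 1; first by exists 0%N => //; rewrite expn0; lia.
    exists (up_log 2 q); have /andP[h1 h2] := up_log_bounds (isT : (1 < 2)%N) q1 => //.
    have u0 : (0 < up_log 2 q)%N by rewrite up_log_gt0.
    by rewrite -(prednK u0) expnS leq_mul2l ltnW.
  apply: le_trans (sd_blocksum_err (leqnn m) qk) _.
  apply: (@le_trans _ _ (5 * kappa * ((p + 4)%:R * (2 * Num.sqrt q%:R)))); last by nra.
  have k5 : 0 <= 5 * kappa by apply: mulr_ge0 => //; exact: kappa_ge0.
  rewrite (ler_wpM2l k5)//.
  apply: (@le_trans _ _ ((p + 4)%:R * sqrt2 ^+ k)); first by rewrite gerBl.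
  rewrite ler_wpM2l//.
  rewrite -[leLHS]ger0_norm ?exprn_ge0 ?sqrt2_ge0// -sqrtr_sqr.
  rewrite -exprM mulnC exprM sqrt2_sq.
  have -> : 2 * Num.sqrt q%:R = Num.sqrt (4 * q%:R) :> R.
    rewrite sqrtrM// (_ : 4 = 2 ^+ 2); last by ring.
    by rewrite sqrtr_sqr ger0_norm.
  rewrite ler_wsqrtr// -natrX -natrM ler_nat.
  by move: kq; lia.
rewrite (eq_sd (g := fun w => (rcap (take (q * m) w) - blocksum rcap m q (take (q * m) w)) +
   (rcap (drop (q * m) w) - gap (take (q * m) w) (drop (q * m) w)))); last first.
  move=> w wn _; have wq : size (take (q * m) w) = (q * m)%N.
    by rewrite size_takel// wn leq_addr.
  rewrite (@blocksum_take _ _ _ w) ?wn ?leq_addr//.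
  rewrite -{1}(cat_take_drop (q * m) w) rcap_cat; ring.
apply: le_trans (@sdD R G Gamma _ _ _) _.
rewrite (sd_take Gamma0 _ _ (fun w => rcap w - blocksum rcap m q w)) lerD//.
apply: le_trans (@sdB R G Gamma _ _ _) _; rewrite lerD//.
  rewrite sd_drop//; apply: sd_bound => // s sr _.
  have /andP[-> /= h] := rcap_bound s; apply: le_trans h _.
  by rewrite ler_nat sr ltnS ltnW.
apply: le_trans (sd_le_norm2 Gamma0 _ _) _; exact: norm2_gap.
Qed.

Lemma sd_blocksum f m q r :
  sd (q * m + r) (blocksum f m q) = Num.sqrt q%:R * sd m f.
Proof.
rewrite (eq_sd (g := fun w => blocksum f m q (take (q * m) w))); last first.
  by move=> w wn _; rewrite -blocksum_take// wn leq_addr.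
rewrite sd_take//; elim: q => [|q IH].
  rewrite sqrtr0 mul0r (eq_sd (g := fun=> 0)) ?sd_cst// => s _ _.
  by rewrite /blocksum big_ord0.
rewrite mulSnr (eq_sd (g := fun w => blocksum f m q (take (q * m) w) +
   f (drop (q * m) w))); last first.
  move=> w wn _; have wq : size (take (q * m) w) = (q * m)%N.
    by rewrite size_takel// wn leq_addr.
  rewrite -{1}(cat_take_drop (q * m) w) -addn1 blocksum_cat//; congr (_ + _).
  by rewrite /blocksum big_ord1 mul0n drop0 take_oversize// size_drop wn addKn.
rewrite sd_indep// IH exprMn sqr_sqrtr// -[in RHS](ger0_norm (sd_ge0 _ m f)).
by rewrite -sqrtr_sqr -sqrtrM// -natr1 mulrDl mul1r.
Qed.

Lemma sd_rcap_approx p q r : (r < 2 ^ p)%N ->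
  `|sd (q * 2 ^ p + r) rcap - Num.sqrt q%:R * sd (2 ^ p) rcap| <=
  10 * kappa * (p + 4)%:R * Num.sqrt q%:R + block_cst p.
Proof.
move=> rp; apply: le_trans (sd_block_approx q rp).
by rewrite -(sd_blocksum rcap (2 ^ p) q r); exact: sd_dist.
Qed.

End BlockError.

(** * Linear growth of the mean capacity *)

Section LinearMean.
Context {R : realType} {G : groupType} (Gamma : {fset G}).
Hypothesis Gamma0 : Gamma != fset0.
Hypothesis Gammasym : symmetric_set Gamma.
Local Notation mean := (@mean R G Gamma).
Local Notation hk := (@hk R G Gamma).
Local Notation capN := (@capN R G Gamma).
Local Notation rcap := (@rcap R G Gamma).
Variable K : R.
Hypothesis hk_le : forall n x, hk n x <= K / n.+1%:R ^+ 3.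

(* The union of the translates of [A] by the inverses of the prefixes of [s].
   Its size grows at rate [capN N A] by reversal of the walk. *)
Fixpoint sweep (A s : seq G) : seq G :=
  if s is x :: s' then [seq (y * x^-1)%g | y <- sweep A s'] ++ A else A.

Lemma mem_sweep A s y : (y \notin sweep A s) = (y \notin A) && avoids A y s.
Proof.
elim: s y => [|x s IH] y /=; first by rewrite andbT.
rewrite mem_cat negb_or andbC; congr (_ && _).
have -> : (y \in [seq (z * x^-1)%g | z <- sweep A s]) = ((y * x)%g \in sweep A s).
  apply/mapP/idP => [[z zs ->]|ys]; first by rewrite mulgVK.
  by exists (y * x)%g => //; rewrite mulgK.
by rewrite IH.
Qed.

(** A letter put in front translates the old union and adds exactly those points of [A] from which
    the lengthened path avoids [A]; their expected number is [capN N.+1 A]. *)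
Lemma mean_sweep A N :
  mean N (fun s => (size (undup (sweep A s)))%:R) = \sum_(j < N.+1) capN j A.
Proof.
elim: N => [|N IH].
  rewrite mean0 big_ord1 /capN /=.
  under eq_bigr do rewrite /escape mean0.
  by rewrite -natr_sum sum1_size.
rewrite big_ord_recr /= -IH.
transitivity (mean N.+1 (fun s => (size (undup (sweep A (behead s))))%:R +
    \sum_(b <- undup A) (avoids A b s)%:R)).
  apply: eq_mean => -[//|x s] _ _ /=.
  rewrite -(sum1_size (undup (_ ++ A))) natr_sum.
  rewrite sum_undup_cat undup_map_inj; last exact: mulIg.
  rewrite big_map -natr_sum sum1_size; congr (_ + _).
  rewrite big_mkcond big_seq [RHS]big_seq; apply: eq_bigr => b.
  rewrite mem_undup => bA.
  have -> : (b \notin [seq (y * x^-1)%g | y <- sweep A s]) = avoids A b (x :: s).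
    rewrite [RHS]/avoids /= -/(avoids A (b * x)%g s) -mem_sweep; congr (~~ _).
    apply/mapP/idP => [[z zs ->]|ys]; first by rewrite mulgVK.
    by exists (b * x)%g => //; rewrite mulgK.
  by case: (avoids _ _ _).
rewrite meanD mean_sum; congr (_ + _).
have := @mean_dropl R G Gamma Gamma0 1 N (fun s => (size (undup (sweep A s)))%:R).
by under eq_mean do rewrite drop1.
Qed.

(** If c z is the number of pairs mapped to z, this is the nonnegativity of the sum over [S] of (1 -
    l * c z) ^ 2. Compared with Cauchy-Schwarz, the free parameter l keeps the bound linear in the
    number of coincidences, so that it can be averaged. *)
Lemma count_distinct (I J : finType) (x : I -> J -> G) (S : seq G) (l : R) :
  uniq S -> (forall i j, x i j \in S) ->
  2 * l * (#|I| * #|J|)%:R - l ^+ 2 *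
    \sum_(i : I) \sum_(i' : I) \sum_(j : J) \sum_(j' : J) (x i j == x i' j')%:R <=
  (size S)%:R.
Proof.
move=> uS xS.
pose c z : R := \sum_(i : I) \sum_(j : J) (x i j == z)%:R.
have one (F : G -> R) y : y \in S -> \sum_(z <- S) (y == z)%:R * F z = F y.
  move=> yS; rewrite (bigD1_seq y)//= eqxx mul1r big1 ?addr0// => z.
  by rewrite eq_sym => /negPf ->; rewrite mul0r.
have sumc (F : G -> R) : \sum_(z <- S) c z * F z = \sum_(i : I) \sum_(j : J) F (x i j).
  under eq_bigr do rewrite mulr_suml.
  rewrite exchange_big; apply: eq_bigr => i _ /=.
  under eq_bigr do rewrite mulr_suml.
  rewrite exchange_big; apply: eq_bigr => j _ /=.
  exact: one.
have c1 : \sum_(z <- S) c z = (#|I| * #|J|)%:R.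
  under eq_bigr do rewrite -[c _]mulr1.
  rewrite (sumc (fun=> 1)); under eq_bigr do rewrite sumr_const.
  by rewrite sumr_const -[_%:R *+ _]mulr_natr -natrM mulnC.
have c2 : \sum_(z <- S) c z ^+ 2 =
    \sum_(i : I) \sum_(i' : I) \sum_(j : J) \sum_(j' : J) (x i j == x i' j')%:R.
  under eq_bigr do rewrite expr2.
  rewrite (sumc c); apply: eq_bigr => i _; rewrite exchange_big /=.
  rewrite exchange_big /=.
  rewrite [RHS]exchange_big /=; apply: eq_bigr => j _.
  rewrite /c; apply: eq_bigr => i' _; apply: eq_bigr => j' _.
  by rewrite eq_sym.
rewrite -c1 -c2 -subr_ge0.
have -> : (size S)%:R - (2 * l * \sum_(z <- S) c z - l ^+ 2 * \sum_(z <- S) c z ^+ 2) =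
    \sum_(z <- S) (1 - l * c z) ^+ 2.
  rewrite -(sum1_size S) natr_sum !mulr_sumr -!sumrB; apply: eq_bigr => z _; ring.
by apply: sumr_ge0 => z _; exact: sqr_ge0.
Qed.

Lemma in_sweep A s a k : a \in A -> (k <= size s)%N ->
  (a * (wprod (take k s))^-1)%g \in sweep A s.
Proof.
move=> aA ks; apply/negPn; rewrite mem_sweep negb_and negbK.
case: k ks => [|k] ks; first by rewrite take0 wprod_nil invg1 mulg1 aA.
apply/orP; right; rewrite /avoids -has_predC; apply/hasP; exists a => /=; last by rewrite negbK.
rewrite scanl_mulgE; apply/mapP; exists k.+1; first by rewrite mem_iota.
by rewrite mulgVK.
Qed.

Definition icb (n : nat) : R := (n.+1%:R ^+ 3)^-1.

Lemma icb_ge0 n : 0 <= icb n. Proof. by rewrite invr_ge0. Qed.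

Lemma prefix_diff_prob n i i' g : (i <= n)%N -> (i' <= n)%N ->
  mean n (fun s => ((wprod (take i s))^-1 * wprod (take i' s) == g)%g%:R) <=
  K * icb (i' - i + (i - i')).
Proof.
have main j j' h : (j <= j' <= n)%N ->
  mean n (fun s => ((wprod (take j s))^-1 * wprod (take j' s) == h)%g%:R) <=
  K * icb (j' - j).
  move=> jn; rewrite (mean_prefixes Gamma0
    (fun u v => ((wprod u)^-1 * wprod v == h)%g%:R) jn).
  apply: mean_bound => // u _ _; apply: le_trans (hk_le _ h).
  rewrite le_eqVlt; apply/orP; left; apply/eqP; apply: eq_mean => b _ _.
  by rewrite wprod_cat mulKg.
move=> iN i'N; have [ii'|i'i] := orP (leq_total i i').
  by rewrite (eqP (_ : i - i' == 0)%N) ?addn0 ?subn_eq0// main// ii'.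
rewrite (eqP (_ : i' - i == 0)%N) ?add0n ?subn_eq0//.
apply: le_trans (main i' i g^-1%g _); last by rewrite i'i.
apply: le_mean => s _ _; rewrite ler_nat.
rewrite -(inj_eq invg_inj) invgM invgK.
by [].
Qed.

(** A coincidence means that the increment of the first walk over p steps equals that of the second
    over q steps. Conditioning on the walk with the shorter stretch leaves a heat kernel at the
    longer time, which is at least half of p + q; hence the factor 8 = 2 ^ 3. *)
Lemma coincidence_prob n N i i' k k' :
  (i <= n)%N -> (i' <= n)%N -> (k <= N)%N -> (k' <= N)%N ->
  mean n (fun s => mean N (fun w =>
    ((wprod (take i s) * (wprod (take k w))^-1)%g ==
     (wprod (take i' s) * (wprod (take k' w))^-1)%g)%:R)) <=
  8 * K * icb (i' - i + (i - i') + (k' - k + (k - k'))).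
Proof.
move=> iN i'N kN k'N.
set p := (i' - i + (i - i'))%N; set q := (k' - k + (k - k'))%N.
have K0 : 0 <= K := K_ge0 hk_le.
have eqE (a b c d : G) : ((a * b^-1)%g == (c * d^-1)%g) = ((a^-1 * c)%g == (b^-1 * d)%g).
  apply/eqP/eqP => [h|h].
    by rewrite -(mulKg a b^-1%g) h -!mulgA mulVg mulg1.
  have -> : c = (a * (b^-1 * d))%g by rewrite -h mulVKg.
  by rewrite mulgA mulgK.
under eq_mean do under eq_mean do rewrite eqE.
have icb8 x y : (y <= x)%N -> icb x <= 8 * icb (x + y).
  move=> yx; rewrite /icb ler_pdivlMr ?exprn_gt0// mulrC.
  rewrite ler_pdivrMr ?exprn_gt0//.
  have -> : 8 = 2 ^+ 3 :> R by ring.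
  by rewrite -exprMn lerXn2r ?nnegrE// -natrM ler_nat; lia.
have [pq|qp] := orP (leq_total p q).
  apply: (@le_trans _ _ (K * icb q)); last first.
    by rewrite (addnC p q); have := ler_wpM2l K0 (icb8 _ _ pq); lra.
  apply: mean_bound => // s _ _; apply: le_trans (prefix_diff_prob _ kN k'N).
  apply: le_mean => w _ _; by rewrite eq_sym.
apply: (@le_trans _ _ (K * icb p)); last first.
  by have := ler_wpM2l K0 (icb8 _ _ qp); lra.
rewrite mean_swap; apply: mean_bound => // w _ _.
exact: (prefix_diff_prob _ iN i'N).
Qed.

Lemma sum_icb n m : \sum_(i < n) \sum_(j < m) icb (i + j) <= 4.
Proof.
apply: (@le_trans _ _ (\sum_(i < n) 2 * @isq R (0 + i))).
  apply: ler_sum => i _; apply: le_trans (sum_icube i m) _.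
  by rewrite add0n gerDl oppr_le0 mulr_ge0// isq_ge0.
rewrite -mulr_sumr; apply: le_trans (ler_wpM2l _ (sum_isq 0 n)) _ => //.
by rewrite invr1; lra.
Qed.

(** The bound of [coincidence_prob] is summable over the two differences, which leaves one free
    position in each walk: coincidences are at most proportional to the number of pairs. Here 128 =
    8 * 16, and 16 collects two doublings by [sum_min_diff] and the 4 of [sum_icb]. *)
Lemma coincidence_sum n N :
  mean n (fun s => mean N (fun w =>
    \sum_(i < n.+1) \sum_(i' < n.+1) \sum_(k < N.+1) \sum_(k' < N.+1)
    ((wprod (take i s) * (wprod (take k w))^-1)%g ==
     (wprod (take i' s) * (wprod (take k' w))^-1)%g)%:R)) <=
  128 * K * (n.+1 * N.+1)%:R.
Proof.
have mean2_sum k (F : 'I_k -> seq G -> seq G -> R) :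
    mean n (fun s => mean N (fun t => \sum_(i < k) F i s t)) =
    \sum_(i < k) mean n (fun s => mean N (F i s)).
  by under eq_mean do rewrite mean_sum; rewrite mean_sum.
pose b (x y : nat) := \sum_(k < N.+1) \sum_(k' < N.+1)
  icb (y + (k' - k + (k - k')))%N.
apply: (@le_trans _ _ (\sum_(i < n.+1) \sum_(i' < n.+1)
   8 * K * b (minn i i') (i' - i + (i - i'))%N)).
  rewrite mean2_sum; apply: ler_sum => i _.
  rewrite mean2_sum; apply: ler_sum => i' _.
  rewrite mean2_sum mulr_sumr; apply: ler_sum => k _.
  rewrite mean2_sum mulr_sumr; apply: ler_sum => k' _.
  by apply: coincidence_prob; rewrite -ltnS ltn_ord.
under eq_bigr do rewrite -mulr_sumr.
rewrite -mulr_sumr.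
have b0 x y : 0 <= b x y.
  by apply: sumr_ge0 => j _; apply: sumr_ge0 => q _; rewrite icb_ge0.
have := @sum_min_diff R n.+1 b b0.
set S := \sum_(i < n.+1) _ => S_le.
have b_le x y : b x y <= 2 * (N.+1%:R * \sum_(q < N.+1) icb (y + q)).
  have := @sum_min_diff R N.+1 (fun _ q => icb (y + q)) (fun _ _ => icb_ge0 _).
  by rewrite [X in _ <= _ * X]sumr_const card_ord -[X in _ <= _ * X]mulr_natl.
have : \sum_(x < n.+1) \sum_(y < n.+1) b x y <=
    8 * (n.+1 * N.+1)%:R.
  apply: (@le_trans _ _ (\sum_(x < n.+1) \sum_(y < n.+1)
     2 * (N.+1%:R * \sum_(q < N.+1) icb (y + q)))).
    by apply: ler_sum => x _; apply: ler_sum => y _.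
  rewrite sumr_const card_ord -mulr_natl -!mulr_sumr natrM.
  have := sum_icb n.+1 N.+1.
  set D := \sum_(i < n.+1) _ => D4.
  have := ler_wpM2l (mulr_ge0 (ler0n R n.+1) (ler0n R N.+1)) D4; lra.
move=> T_le; have S16 : S <= 16 * (n.+1 * N.+1)%:R by move: S_le T_le; lra.
have := ler_wpM2l (K_ge0 hk_le) S16; lra.
Qed.

(** This is also the parameter l used in [count_distinct]: for M pairs it makes 2 l M - l ^ 2 * 128
    K M at least l M. The 1 keeps the denominator positive. *)
Definition speed : R := (128 * K + 1)^-1.

Lemma speed_gt0 : 0 < speed.
Proof. by rewrite invr_gt0; have := K_ge0 hk_le; lra. Qed.

Lemma mean_sum_capN n N : speed * (n.+1 * N.+1)%:R <=
  \sum_(j < N.+1) mean n (fun s => capN j (trace s)).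
Proof.
rewrite -mean_sum; under eq_mean do rewrite -mean_sweep.
set l := speed; have l0 := speed_gt0; rewrite -/l in l0.
have lK : l * (128 * K + 1) = 1.
  by rewrite mulVf// gt_eqF//; have := K_ge0 hk_le; lra.
apply: (@le_trans _ _ (mean n (fun s => mean N (fun w =>
  2 * l * (n.+1 * N.+1)%:R - l ^+ 2 *
    (\sum_(i < n.+1) \sum_(i' < n.+1) \sum_(k < N.+1) \sum_(k' < N.+1)
    ((wprod (take i s) * (wprod (take k w))^-1)%g ==
     (wprod (take i' s) * (wprod (take k' w))^-1)%g)%:R))))); last first.
  apply: le_mean => s sn _; apply: le_mean => w wN _.
  have := @count_distinct 'I_n.+1 'I_N.+1
    (fun i k => (wprod (take i s) * (wprod (take k w))^-1)%g)
    (undup (sweep (trace s) w)) l (undup_uniq _).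
  rewrite !card_ord; apply => i k; rewrite mem_undup; apply: in_sweep.
    rewrite traceE; apply/mapP; exists (i : nat) => //.
    by rewrite mem_iota add0n sn ltn_ord.
  by rewrite wN -ltnS.
under eq_mean do rewrite meanB mean_cst// meanZ.
rewrite meanB mean_cst// meanZ.
have := ler_wpM2l (sqr_ge0 l) (coincidence_sum n N).
set Q := mean n _; set M : R := (n.+1 * N.+1)%:R => hQ.
have M0 : 0 <= M by exact: ler0n.
have := mulr_ge0 (ltW l0) M0; move: hQ lK.
have -> : l ^+ 2 * (128 * K * M) = l * (l * (128 * K + 1)) * M - l * l * M by ring.
move=> hQ lK1 lM; rewrite lK1 in hQ.
by have := mulr_ge0 (sqr_ge0 l) M0; lra.
Qed.

(** [mean_sum_capN] bounds the averages of the truncated capacities over the truncation; by Cesaro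
    these averages converge to the mean capacity itself. *)
Lemma mean_rcap_ge n : speed * n.+1%:R <= mean n rcap.
Proof.
have cv : mean n (fun s => capN N (trace s)) @[N --> \oo] --> mean n rcap.
  apply: (@mean_cvg R G Gamma n (fun N s => capN N (trace s))) => s; exact: capN_cvg.
apply: cvg_ge_all (cesaro cv) _ => N.
rewrite /arithmetic_mean /series /= big_mkord ler_pdivlMl// mulrC -mulrA -natrM.
exact: mean_sum_capN.
Qed.

End LinearMean.

(** * Lower bound on the variance *)

Section VarianceLower.
Context {R : realType} {G : groupType} (Gamma : {fset G}).
Hypothesis Gamma0 : Gamma != fset0.
Hypothesis Gammasym : symmetric_set Gamma.
Local Notation mean := (@mean R G Gamma).
Local Notation rcap := (@rcap R G Gamma).
Local Notation cap := (@cap R G Gamma).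
Local Notation sd := (@sd R G Gamma).
Variable K : R.
Hypothesis hk_le : forall n x, @hk R G Gamma n x <= K / n.+1%:R ^+ 3.

Lemma cap_cat_le A B : cap (A ++ B) <= cap A + cap B.
Proof.
have cvD : (capN Gamma N A + capN Gamma N B : R) @[N --> \oo] --> cap A + cap B.
  by apply: cvgD; exact: capN_cvg.
apply: cvg_ge_all cvD _ => N; apply: le_trans (cap_le_capN Gamma0 N _) _.
exact: capN_cat_le.
Qed.

(* A word that visits at most one new point, used in place of a whole block. *)
Fixpoint bounce (a : G) h : seq G :=
  if h is h'.+1 then [:: a, (a^-1)%g & bounce a h'] else [::].

Lemma size_bounce a h : size (bounce a h) = h.*2.
Proof. by elim: h => //= h ->. Qed.

Lemma trace_bounce a h t :
  trace (bounce a h.+1 ++ t) =i a :: trace t.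
Proof.
have step s : trace [:: a, (a^-1)%g & s] = [:: 1%g, a & trace s].
  by rewrite /trace /= mul1g mulgV.
have in2 x L : (x \in [:: 1%g, a & L]) = [|| x == 1%g, x == a | x \in L].
  by rewrite !inE.
have one x : x == 1%g -> x \in trace t by move=> /eqP ->; exact: mem_head.
elim: h => [|h IH] x.
  have -> : bounce a 1 ++ t = [:: a, (a^-1)%g & t] by [].
  by rewrite step in2 [RHS]in_cons; case: (boolP (x == 1%g)) => [/one->|//]; rewrite orbT.
have -> : bounce a h.+2 ++ t = [:: a, (a^-1)%g & bounce a h.+1 ++ t] by [].
rewrite step in2 IH; rewrite ![x \in a :: _]in_cons.
by case: (x == a); rewrite ?orbT//; case: (boolP (x == 1%g)) => [/one->|].
Qed.

(** The inserted word has product 1, so the walk resumes where it stopped and the range gains at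
    most the point [wprod u * a]. Subadditivity charges at most 1 for it. *)
Lemma rcap_bounce a h u t :
  rcap (u ++ bounce a h ++ t) <= rcap (u ++ t) + 1.
Proof.
case: h => [|h]; first by rewrite lerDl.
have -> : rcap (u ++ bounce a h.+1 ++ t) =
    cap (trace (u ++ t) ++ [:: (wprod u * a)%g]).
  apply: eq_cap => x; rewrite !(trace_cat, mem_cat) -orbA; congr (_ || _).
  have mem_mul L : (x \in [seq (wprod u * y)%g | y <- L]) = ((wprod u)^-1 * x \in L)%g.
    apply/mapP/idP => [[z zL ->]|xL]; first by rewrite mulKg.
    by exists ((wprod u)^-1 * x)%g => //; rewrite mulVKg.
  rewrite !mem_mul trace_bounce in_cons inE orbC; congr (_ || _).
  by rewrite [RHS]inE; apply/eqP/eqP => [<-|->]; rewrite ?mulVKg ?mulKg.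
apply: le_trans (cap_cat_le _ _) _; rewrite lerD2l.
exact: le_trans (cap_le_size Gamma0 _) _.
Qed.

(** Otherwise the mean at time N0 + k L would be at most its value at N0 plus k c, against the lower
    bound k (c + 1) from linear growth; k larger than the mean at N0 gives the contradiction. *)
Lemma mean_rcap_increment L c N0 : 0 <= c -> (0 < L)%N ->
  c + 1 <= @speed R K * L%:R ->
  exists2 n, (N0 + L <= n)%N & c <= mean n rcap - mean (n - L) rcap.
Proof.
move=> c0 L0 hL; apply: contrapT => hn.
have lt n : (N0 <= n)%N -> mean (n + L) rcap < mean n rcap + c.
  move=> nN; rewrite ltNge; apply/negP => h; apply: hn; exists (n + L)%N.
    by rewrite leq_add2r.
  by rewrite addnK lerBrDl.
have lek k : mean (N0 + k * L) rcap <= mean N0 rcap + k%:R * c.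
  elim: k => [|k IH]; first by rewrite mul0n addn0 mul0r addr0.
  rewrite mulSnr addnA -natr1 mulrDl mul1r addrA; apply: ltW.
  by apply: lt_le_trans (lt _ _) _; rewrite ?leq_addr// lerD2r.
have s0 : 0 < @speed R K := speed_gt0 hk_le.
pose k := (Num.truncn (mean N0 rcap)).+1.
have kt : mean N0 rcap < k%:R by exact: truncnS_gt.
have := mean_rcap_ge Gamma0 hk_le (N0 + k * L) => hge.
have := le_trans hge (lek k).
have : speed K * (k * L)%:R <= speed K * (N0 + k * L).+1%:R.
  by rewrite ler_pM2l// ler_nat; lia.
rewrite natrM.
have := ler_wpM2l (ler0n R k) hL; nra.
Qed.

Variable a0 : G.
Hypothesis a0G : a0 \in Gamma.

Let null h (s : seq G) : R := (s == bounce a0 h)%:R.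

Lemma null_word h : bounce a0 h \in words Gamma h.*2.
Proof.
rewrite -(size_bounce a0) mem_words// => x.
elim: h => //= h IH; rewrite !inE => /or3P[/eqP->|/eqP->|]//.
exact: Gammasym.
Qed.

Lemma mean_eq_word n z (F : seq G -> R) : z \in words Gamma n ->
  mean n (fun s => (s == z)%:R * F s) = mean n (fun s => (s == z)%:R) * F z.
Proof.
move=> zw; rewrite -meanZr; apply: eq_mean => s _ _.
by case: eqP => [->|]; rewrite ?mul1r// !mul0r.
Qed.

Definition null_prob h : R := mean h.*2 (null h).

Lemma null_prob_gt0 h : 0 < null_prob h.
Proof.
rewrite /null_prob /mean mulr_gt0 ?invr_gt0 ?exprn_gt0 ?card_gens_gt0//.
rewrite (big_rem _ (null_word h))/= /null eqxx ltr_pwDl//.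
exact: sumr_ge0.
Qed.

Definition cov n (f g : seq G -> R) :=
  mean n (fun s => f s * g s) - mean n f * mean n g.

Lemma cov_le_sd n f g : `|cov n f g| <= sd n f * sd n g.
Proof.
have -> : cov n f g = mean n (fun s => centered Gamma n f s * centered Gamma n g s).
  rewrite /cov /centered.
  transitivity (mean n (fun s => f s * g s - f s * mean n g - mean n f * g s + mean n f * mean n g)).
    by rewrite meanD !meanB meanZr meanZ mean_cst//; ring.
  by apply: eq_mean => s _ _; ring.
rewrite -sqrtr_sqr -[leRHS]ger0_norm ?mulr_ge0 ?sd_ge0// -sqrtr_sqr ler_wsqrtr//.
by rewrite [leRHS]exprMn !sd_sq; exact: mean_CS.
Qed.

(** Given that the block is the back-and-forth word, deleting it leaves x + y independent letters
    and lowers the capacity by at most 1. *)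
Lemma mean_rcap_null h x y :
  mean (x + (h.*2 + y)) (fun w => rcap w * null h (take h.*2 (drop x w))) <=
  null_prob h * (mean (x + y) rcap + 1).
Proof.
rewrite mean_cat [X in _ * (X + _)]mean_cat -[X in _ * (_ + X)](mean_cst Gamma0 x).
rewrite -meanD -meanZ; apply: le_mean => u ux _.
rewrite mean_cat.
under eq_mean => z zh _.
  under eq_mean => t _ _ do rewrite drop_size_cat// take_size_cat// mulrC.
  rewrite meanZ; over.
rewrite (mean_eq_word (fun z => mean y (fun t => rcap (u ++ z ++ t))) (null_word h)).
rewrite ler_wpM2l ?(ltW (null_prob_gt0 h))// -[X in _ <= _ + X](mean_cst Gamma0 y) -meanD.
by apply: le_mean => t _ _; exact: rcap_bounce.
Qed.

(* The number of blocks equal to [bounce a0 h] is negatively correlated with the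
   capacity; Cauchy-Schwarz bounds the deviation of the latter from below. *)
Lemma sd_rcap_ge h q r : (0 < h)%N ->
  mean (q * h.*2 + r) rcap - mean (q * h.*2 + r - h.*2) rcap >= 2 ->
  Num.sqrt q%:R * null_prob h <= sd (q * h.*2 + r) rcap.
Proof.
move=> h0; set n := (q * h.*2 + r)%N => e2.
have [->|q0] := posnP q; first by rewrite sqrtr0 mul0r sd_ge0.
have := cov_le_sd n rcap (blocksum (null h) h.*2 q).
have p0 := null_prob_gt0 h.
have covE : cov n rcap (blocksum (null h) h.*2 q) <= - (q%:R * null_prob h).
  rewrite /cov /blocksum mean_sum.
  under eq_mean do rewrite mulr_sumr.
  rewrite mean_sum mulr_sumr -sumrB.
  have -> : - (q%:R * null_prob h) = \sum_(i < q) - null_prob h.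
    by rewrite sumrN sumr_const card_ord mulr_natl.
  apply: ler_sum => i _.
  have nE : n = (i * h.*2 + (h.*2 + ((q - i.+1) * h.*2 + r)))%N.
    rewrite /n !addnA -mulSnr -mulnDl; congr (_ * _ + _)%N.
    by have := ltn_ord i; lia.
  have n2 : (n - h.*2)%N = (i * h.*2 + ((q - i.+1) * h.*2 + r))%N by rewrite nE; lia.
  have mE : mean n (fun w => null h (take h.*2 (drop (i * h.*2) w))) = null_prob h.
    rewrite nE (mean_dropl Gamma0 _ _ (fun w => null h (take h.*2 w))).
    exact: mean_takel.
  rewrite mE; have := mean_rcap_null h (i * h.*2) ((q - i.+1) * h.*2 + r).
  rewrite -nE -n2 => hm.
  (* Each block contributes to the covariance at most [null_prob h] times 1 minus the increment of
     the mean, and the increment is at least 2. *)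
  have := ler_wpM2l (ltW p0) e2; lra.
rewrite sd_blocksum//.
have s1 : sd h.*2 (null h) <= 1.
  by apply: sd_bound => // s _ _; rewrite ler0n (ler_nat _ _ 1) leq_b1.
set S := sd n rcap => hc.
have qp : 0 < q%:R :> R by rewrite ltr0n.
have S0 : 0 <= S by exact: sd_ge0.
have sq0 : 0 < Num.sqrt q%:R :> R by rewrite sqrtr_gt0.
have h1 : q%:R * null_prob h <= S * Num.sqrt q%:R.
  apply: le_trans (_ : S * (Num.sqrt q%:R * sd h.*2 (null h)) <= _).
    apply: le_trans hc; rewrite lerNr in covE.
    by apply: le_trans covE _; rewrite -normrN ler_norm.
  by rewrite ler_wpM2l// ler_piMr// ltW.
rewrite -(ler_pM2r sq0); apply: le_trans h1.
by rewrite mulrAC -expr2 sqr_sqrtr.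
Qed.

End VarianceLower.

(** * The asymptotic standard deviation *)

Section Sigma.
Context {R : realType} {G : groupType} (Gamma : {fset G}).
Hypothesis Gamma0 : Gamma != fset0.
Hypothesis Gammasym : symmetric_set Gamma.
Local Notation mean := (@mean R G Gamma).
Local Notation rcap := (@rcap R G Gamma).
Local Notation sd := (@sd R G Gamma).
Variable K : R.
Hypothesis hk_le : forall n x, @hk R G Gamma n x <= K / n.+1%:R ^+ 3.
Local Notation kappa := (@kappa R K).

Definition dev_rate n : R := sd n rcap / Num.sqrt n%:R.

(** Block lengths are powers of 16: they are powers of 2 with an explicit root, and in the relative
    error (4 s + 4) / 4 ^ s one factor 2 ^ s cancels the logarithm while the other gives decay. *)
Lemma sqrt_pow16 s : Num.sqrt (16 ^ s)%:R = 4 ^+ s :> R.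
Proof.
have -> : (16 ^ s)%:R = (4 ^+ s) ^+ 2 :> R.
  by rewrite natrX -exprM mulnC exprM; congr (_ ^+ _); ring.
by rewrite sqrtr_sqr ger0_norm// exprn_ge0.
Qed.

Lemma pow16 s : (16 ^ s = 2 ^ (4 * s))%N.
Proof. by rewrite expnM. Qed.

Lemma kappa_pow s : 10 * kappa * (4 * s + 4)%:R / 4 ^+ s <= 40 * kappa / 2 ^+ s.
Proof.
have k0 : 0 <= kappa := kappa_ge0 hk_le.
have s2 : s.+1%:R <= 2 ^+ s :> R by rewrite -natrX ler_nat ltn_expl.
rewrite ler_pdivrMr ?exprn_gt0//.
have -> : 40 * kappa / 2 ^+ s * 4 ^+ s = 40 * kappa * 2 ^+ s.
  have -> : 4 ^+ s = 2 ^+ s * 2 ^+ s :> R by rewrite -exprMn; congr (_ ^+ _); ring.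
  by rewrite mulrA divfK// expf_neq0.
have -> : (4 * s + 4)%:R = 4 * s.+1%:R :> R by rewrite -natrM; congr _%:R; lia.
have := ler_wpM2l k0 s2; lra.
Qed.

Lemma sqrt_block s n : 10 * kappa * (4 * s + 4)%:R * Num.sqrt (n %/ 16 ^ s)%:R <=
  40 * kappa / 2 ^+ s * Num.sqrt n%:R.
Proof.
have p4 : 0 < 4 ^+ s :> R by rewrite exprn_gt0.
have -> : 10 * kappa * (4 * s + 4)%:R * Num.sqrt (n %/ 16 ^ s)%:R =
   (10 * kappa * (4 * s + 4)%:R / 4 ^+ s) * (4 ^+ s * Num.sqrt (n %/ 16 ^ s)%:R).
  by field; rewrite gt_eqF.
have k0 : 0 <= kappa := kappa_ge0 hk_le.
apply: ler_pM; first 2 last.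
- exact: kappa_pow.
- rewrite -sqrt_pow16 -sqrtrM// ler_wsqrtr// -natrM ler_nat mulnC.
  exact: leq_divM.
- apply: divr_ge0; last exact: ltW.
  by apply: mulr_ge0 => //; apply: mulr_ge0.
- by apply: mulr_ge0; [exact: ltW|exact: sqrtr_ge0].
Qed.

Lemma sd_block16 s n :
  sd n (fun w => rcap w - blocksum rcap (16 ^ s) (n %/ 16 ^ s) w) <=
  40 * kappa / 2 ^+ s * Num.sqrt n%:R + @block_cst R K (4 * s).
Proof.
have rp : (n %% 16 ^ s < 2 ^ (4 * s))%N by rewrite -pow16 ltn_mod expn_gt0.
have := sd_block_approx Gamma0 Gammasym hk_le (n %/ 16 ^ s) rp.
rewrite -pow16 -divn_eq => /le_trans; apply; rewrite lerD2r.
exact: sqrt_block.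
Qed.

(** The first error depends on s alone and the second vanishes as n grows with s fixed, which yields
    the Cauchy property. *)
Lemma dev_rate_approx s : exists2 C, 0 <= C & forall n, (0 < n)%N ->
  `|dev_rate n - dev_rate (16 ^ s)| <= 40 * kappa / 2 ^+ s + C / Num.sqrt n%:R.
Proof.
set m := (16 ^ s)%N.
have k0 : 0 <= kappa := kappa_ge0 hk_le.
have c0 : 0 <= @block_cst R K (4 * s).
  by rewrite addr_ge0// mulr_ge0.
have d0 : 0 <= dev_rate m by rewrite divr_ge0 ?sd_ge0 ?sqrtr_ge0.
exists (@block_cst R K (4 * s) + dev_rate m * m%:R).
  by rewrite addr_ge0// mulr_ge0.
move=> n n0.
have rp : (n %% m < 2 ^ (4 * s))%N by rewrite -pow16 ltn_mod expn_gt0.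
have := sd_rcap_approx Gamma0 Gammasym hk_le (n %/ m) rp.
rewrite -pow16 -divn_eq -/m.
have := sqrt_block s n; rewrite -/m.
set E := _ * Num.sqrt _; set D := 40 * kappa / _; set q := (n %/ m)%N.
move=> ED h.
have sn0 : 0 < Num.sqrt n%:R :> R by rewrite sqrtr_gt0 ltr0n.
have m0 : (0 < m)%N by rewrite expn_gt0.
have sm0 : 0 < Num.sqrt m%:R :> R by rewrite sqrtr_gt0 ltr0n.
have n1 : 1 <= n%:R :> R by rewrite ler1n.
(* The loss caused by rounding n down to the multiple q m of the block length. *)
pose t : R := Num.sqrt q%:R * Num.sqrt m%:R / Num.sqrt n%:R.
have t1 : 1 - t <= m%:R / Num.sqrt n%:R.
  have -> : t = Num.sqrt (q * m)%:R / Num.sqrt n%:R by rewrite natrM sqrtrM.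
  rewrite lerBlDr -mulrDl ler_pdivlMr// mul1r.
  have : n%:R <= m%:R + (q * m)%:R :> R.
    by rewrite -natrD ler_nat {1}(divn_eq n m) addnC leq_add2r ltnW// ltn_mod.
  have sq := sqr_sqrtr (ler0n R n); have sqm := sqr_sqrtr (ler0n R (q * m)).
  have : 0 <= Num.sqrt (q * m)%:R :> R by exact: sqrtr_ge0.
  have : 1 <= Num.sqrt n%:R :> R by rewrite -[leLHS]sqrtr1 ler_wsqrtr.
  have : Num.sqrt (q * m)%:R <= Num.sqrt n%:R :> R by rewrite ler_wsqrtr// ler_nat leq_divM.
  move: sq sqm; set X := Num.sqrt n%:R; set Y := Num.sqrt (q * m)%:R => <- <-.
  by move: (m%:R : R) => M; nra.
have t0 : 0 <= 1 - t.
  rewrite subr_ge0 ler_pdivrMr// mul1r -sqrtrM// -natrM ler_wsqrtr// ler_nat leq_divM//.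
have e : dev_rate n - dev_rate m = (sd n rcap - Num.sqrt q%:R * sd m rcap) / Num.sqrt n%:R
   - dev_rate m * (1 - t).
  by rewrite /dev_rate /t; field; rewrite !gt_eqF.
rewrite e; apply: le_trans (ler_normB _ _) _.
rewrite normrM (ger0_norm (_ : 0 <= (Num.sqrt n%:R)^-1)) ?invr_ge0 ?(ltW sn0)//.
rewrite normrM (ger0_norm d0) (ger0_norm t0) [X in _ <= _ + X]mulrDl addrA lerD//.
  rewrite ler_pdivrMr// mulrDl divfK ?gt_eqF//.
  by apply: le_trans h _; rewrite lerD2r.
by rewrite -[leRHS]mulrA ler_wpM2l.
Qed.

Lemma archi_sqrt (C e : R) : 0 < e -> 0 <= C ->
  exists2 N, (0 < N)%N & forall n, (N <= n)%N -> C / Num.sqrt n%:R <= e.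
Proof.
move=> e0 C0; exists (Num.truncn ((C / e) ^+ 2)).+1 => // n nN.
have h : (C / e) ^+ 2 <= n%:R.
  by apply: le_trans (ltW (truncnS_gt _)) _; rewrite ler_nat.
have n0 : 0 < Num.sqrt n%:R :> R by rewrite sqrtr_gt0 ltr0n; exact: leq_trans nN.
rewrite ler_pdivrMr// mulrC -ler_pdivrMr//.
rewrite -[leLHS]ger0_norm ?divr_ge0// ?(ltW e0)// -sqrtr_sqr ler_wsqrtr//.
Qed.

Lemma archi_pow (C e : R) : 0 < e -> 0 <= C -> exists s, C / 2 ^+ s <= e.
Proof.
move=> e0 C0; exists (Num.truncn (C / e)).+1; set s := _.+1.
rewrite ler_pdivrMr ?exprn_gt0// mulrC -ler_pdivrMr//.
apply: le_trans (ltW (truncnS_gt _)) _.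
by rewrite -natrX ler_nat ltnW// ltn_expl.
Qed.

Lemma dev_rate_cvg : exists2 sigma : R, 0 < sigma & dev_rate n @[n --> \oo] --> sigma.
Proof.
have k0 : 0 <= kappa := kappa_ge0 hk_le.
have /cvg_ex[sigma cv] : cvg (dev_rate n @[n --> \oo]).
  apply: cauchy_cvg; apply: cauchy_exP => e e0.
  have e4 : 0 < e / 4 by lra.
  have [s hs] := archi_pow e4 (mulr_ge0 (ler0n R 40) k0).
  have [C C0 hC] := dev_rate_approx s.
  have [N N0 hN] := archi_sqrt e4 C0.
  exists (dev_rate (16 ^ s)); exists N => // n /= nN.
  rewrite /ball /= distrC; apply: le_lt_trans (hC n (leq_trans N0 nN)) _.
  by have := hN n nN; lra.
exists sigma => //.
have [a0 a0G] := fset0Pn _ Gamma0.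
have s0 : 0 < @speed R K := speed_gt0 hk_le.
(* Blocks of length 2 h with [speed] times 2 h at least 3 = 2 + 1, so that the mean capacity gains 2
   over such a length at arbitrarily late times. *)
pose h := (Num.truncn (3 / @speed R K)).+1.
have hs : 3 <= @speed R K * h.*2%:R.
  rewrite mulrC -ler_pdivrMr//; apply: le_trans (ltW (truncnS_gt _)) _.
  by rewrite ler_nat -addnn leq_addr.
(* A nonzero quotient q of n by 2 h satisfies n <= 2 q * 2 h, so the bound of [sd_rcap_ge] divided
   by sqrt n is at least c. It is enough that this occurs beyond every rank, since [dev_rate]
   converges. *)
pose c := null_prob Gamma a0 h / Num.sqrt (2 * h.*2)%:R : R.
have c0 : 0 < c by rewrite divr_gt0 ?null_prob_gt0// sqrtr_gt0 ltr0n.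
apply: lt_le_trans c0 _; rewrite leNgt; apply/negP => sc.
have [N _ hN] := cvgr_lt _ cv _ sc.
have hs' : 2 + 1 <= @speed R K * h.*2%:R by lra.
have [n nN inc] := mean_rcap_increment Gamma0 hk_le N (ler0n R 2)
  (isT : (0 < h.*2)%N) hs'.
have nh : (h.*2 <= n)%N by apply: leq_trans nN; rewrite leq_addl.
have := @sd_rcap_ge R G Gamma Gamma0 Gammasym a0 a0G h (n %/ h.*2) (n %% h.*2) isT.
rewrite -divn_eq => /(_ inc) hsd.
have /= := hN n (leq_trans (leq_addr _ _) nN).
have n0 : 0 < Num.sqrt n%:R :> R by rewrite sqrtr_gt0 ltr0n; exact: leq_trans nh.
rewrite ltNge => /negP; apply; rewrite /dev_rate ler_pdivlMr//; apply: le_trans hsd.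
rewrite /c -mulrA [leLHS]mulrC ler_pM2r ?null_prob_gt0//.
rewrite ler_pdivrMl ?sqrtr_gt0 ?ltr0n// -sqrtrM// ler_wsqrtr// -natrM ler_nat.
have q1 : (0 < n %/ h.*2)%N by rewrite divn_gt0.
have := divn_eq n h.*2; have : (n %% h.*2 < h.*2)%N by rewrite ltn_mod.
set q := (n %/ _)%N in q1 *; nia.
Qed.

End Sigma.

(** * Gaussian smoothing *)

Section GaussSmoothing.
Context {R : realType}.
Local Notation mu := (@lebesgue_measure R).
Implicit Types (f g : R -> R) (s t x y : R).

Lemma expR_taylor2 (t : R) :
  `|expR t - (1 + t + t ^+ 2 / 2)| <= `|t| ^+ 3 * expR `|t|.
Proof.
have cvt (u : R) : series (exp_coeff u) n @[n --> \oo] --> expR u.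
  exact: is_cvg_series_exp_coeff.
have cv3 : series (exp_coeff t) (n + 3)%N @[n --> \oo] --> expR t.
  by rewrite (cvg_shiftn 3 (series (exp_coeff t)) (nbhs (expR t))); exact: cvt.
have h1 : `|series (exp_coeff t) (n + 3)%N - (1 + t + t ^+ 2 / 2)|
    @[n --> \oo] --> `|expR t - (1 + t + t ^+ 2 / 2)|.
  by apply: cvg_norm; apply: cvgB => //; exact: cvg_cst.
have h2 : `|t| ^+ 3 * series (exp_coeff `|t|) n @[n --> \oo] --> `|t| ^+ 3 * expR `|t|.
  by apply: cvgM; [exact: cvg_cst|exact: cvt].
apply: ler_cvg_to h1 h2 _; apply: nearW => n.
rewrite addn3 /series /= big_nat_recl// big_nat_recl// big_nat_recl//.
rewrite /exp_coeff /= expr0 expr1 !divr1 mulr_sumr.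
have -> : forall a b c d : R, a + (b + (c + d)) - (a + b + c) = d by move=> *; ring.
apply: le_trans (ler_norm_sum _ _ _) _; apply: ler_sum => k _.
rewrite normrM normrX mulrA -exprD add3n ler_wpM2l ?exprn_ge0//.
rewrite ger0_norm ?invr_ge0// lef_pV2 ?posrE ?ltr0n ?fact_gt0// ler_nat.
by rewrite !factS; do 3 (apply: leq_trans; last exact: leq_pmull).
Qed.

Lemma normal_pdfN0 x s y : s != 0 ->
  normal_pdf x s y = normal_peak s * expR (- (y - x) ^+ 2 / (s ^+ 2 *+ 2)).
Proof. by move=> s0; rewrite normal_pdfE. Qed.

Lemma normal_pdf_tilt l x s y : s != 0 ->
  expR (l * (y - x)) * normal_pdf x s y =
  expR (l ^+ 2 * s ^+ 2 / 2) * normal_pdf (x + l * s ^+ 2) s y.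
Proof.
move=> s0; rewrite !normal_pdfN0// !(mulrCA (expR _)) -!expRD; congr (_ * expR _).
by field.
Qed.

(** Completing the square in y: the joint density of two Gaussian steps is the density of the
    endpoint z times the conditional density of the middle point y. Integrating y out gives the
    semigroup property. *)
Lemma normal_pdf_mul s t x y z : 0 < s -> 0 < t ->
  normal_pdf x s y * normal_pdf y t z =
  normal_pdf x (Num.sqrt (s ^+ 2 + t ^+ 2)) z *
  normal_pdf ((x * t ^+ 2 + z * s ^+ 2) / (s ^+ 2 + t ^+ 2))
    (s * t / Num.sqrt (s ^+ 2 + t ^+ 2)) y.
Proof.
move=> s0 t0.
have r2 : 0 < s ^+ 2 + t ^+ 2 by rewrite addr_gt0// exprn_gt0.
have rE : Num.sqrt (s ^+ 2 + t ^+ 2) ^+ 2 = s ^+ 2 + t ^+ 2.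
  by rewrite sqr_sqrtr// ltW.
have r0 : 0 < Num.sqrt (s ^+ 2 + t ^+ 2) by rewrite sqrtr_gt0.
set r := Num.sqrt _ in r0 rE *.
rewrite !normal_pdfN0 ?gt_eqF ?divr_gt0 ?mulr_gt0//.
rewrite mulrACA -expRD [RHS]mulrACA -expRD; congr (_ * expR _); last first.
  rewrite expr_div_n exprMn rE; field.
  by rewrite !gt_eqF.
rewrite /normal_peak -!invfM -!sqrtrM; last 2 first.
- by rewrite mulrn_wge0// mulr_ge0 ?sqr_ge0// pi_ge0.
- by rewrite mulrn_wge0// mulr_ge0 ?sqr_ge0// pi_ge0.
congr (Num.sqrt _)^-1; rewrite expr_div_n exprMn.
have : r ^+ 2 != 0 by rewrite expf_neq0// gt_eqF.
by move: (r ^+ 2) (pi : R) => w p w0; field.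
Qed.

(** The expectation of f(x + s Z) for a standard normal Z, the heat semigroup at time s ^ 2 up to
    normalization. *)
Definition gsmooth s f x : R := fine (\int[mu]_y (f y * normal_pdf x s y)%:E).

Definition tame f := measurable_fun [set: R] f /\ forall x, 0 <= f x <= 1.

Lemma integrable_tame s f x : tame f ->
  mu.-integrable [set: R] (fun y => (f y * normal_pdf x s y)%:E).
Proof.
move=> [mf f01]; apply: le_integrable (integrable_normal_pdf x s) => //.
  apply/measurable_EFinP; apply: measurable_funM => //.
  exact: measurable_normal_pdf.
move=> y _; rewrite /= lee_fin normrM; have /andP[f0 f1] := f01 y.
by rewrite (ger0_norm f0) ler_piMl.
Qed.

Lemma gsmoothE s f x : tame f ->
  (\int[mu]_y (f y * normal_pdf x s y)%:E)%E = (gsmooth s f x)%:E.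
Proof.
by move=> tf; rewrite fineK// integrable_fin_num//; exact: integrable_tame.
Qed.

Lemma gsmooth01 s f x : tame f -> 0 <= gsmooth s f x <= 1.
Proof.
move=> tf; rewrite -!lee_fin -gsmoothE//; have [mf f01] := tf; apply/andP; split.
  apply: integral_ge0 => y _; rewrite lee_fin.
  by have /andP[f0 f1] := f01 y; rewrite mulr_ge0// normal_pdf_ge0.
rewrite -(integral_normal_pdf x s); apply: le_integral => //.
- exact: integrable_tame.
- exact: integrable_normal_pdf.
move=> y _; rewrite lee_fin; have /andP[f0 f1] := f01 y.
by rewrite ler_piMl// normal_pdf_ge0.
Qed.

Lemma gsmooth_dist s f g x e : tame f -> tame g ->
  (forall y, `|f y - g y| <= e) -> `|gsmooth s f x - gsmooth s g x| <= e.
Proof.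
move=> tf tg fg.
have intf := integrable_tame s x tf; have intg := integrable_tame s x tg.
have -> : gsmooth s f x - gsmooth s g x =
   \int[mu]_y (f y * normal_pdf x s y - g y * normal_pdf x s y).
  by rewrite RintegralB.
have intB : mu.-integrable [set: R]
   (EFin \o (fun y => f y * normal_pdf x s y - g y * normal_pdf x s y)).
  exact: (integrableB measurableT intf intg).
apply: le_trans (le_normr_Rintegral _ intB) _ => //.
have intN : mu.-integrable [set: R] (EFin \o (fun y => e * normal_pdf x s y)).
  exact: (integrableZl measurableT e (integrable_normal_pdf x s)).
have -> : e = \int[mu]_y (e * normal_pdf x s y).
  by rewrite RintegralZl ?integrable_normal_pdf// /Rintegral integral_normal_pdf /= mulr1.
apply: le_Rintegral => //; first exact: integrable_norm.
move=> y _; rewrite -mulrBl normrM (ger0_norm (normal_pdf_ge0 _ _ _)).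
by rewrite ler_wpM2r// normal_pdf_ge0.
Qed.

Lemma normal_pdf_shift s x y : s != 0 -> normal_pdf x s y = normal_pdf 0 s (y - x).
Proof. by move=> s0; rewrite !normal_pdfN0// subr0. Qed.

Lemma measurable_normal_pdf2 s : s != 0 ->
  measurable_fun [set: R * R] (fun z => normal_pdf z.1 s z.2).
Proof.
move=> s0; under eq_fun do rewrite normal_pdf_shift//.
apply: measurableT_comp; first exact: measurable_normal_pdf.
by apply: measurable_funB; [exact: measurable_snd|exact: measurable_fst].
Qed.

Lemma measurable_gsmooth s f : s != 0 -> tame f -> measurable_fun [set: R] (gsmooth s f).
Proof.
move=> s0 tf; have [mf f01] := tf.
apply/measurable_EFinP.
have -> : EFin \o gsmooth s f = fubini_F mu (fun z : R * R => (f z.2 * normal_pdf z.1 s z.2)%:E).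
  by apply/funext => x; rewrite /= -gsmoothE.
apply: measurable_fun_fubini_tonelli_F.
- apply/measurable_EFinP; apply: measurable_funM; last exact: measurable_normal_pdf2.
  by apply: measurableT_comp => //; exact: measurable_snd.
- move=> z; rewrite lee_fin; have /andP[f0 f1] := f01 z.2.
  by rewrite mulr_ge0// normal_pdf_ge0.
Qed.

Lemma tame_gsmooth s f : s != 0 -> tame f -> tame (gsmooth s f).
Proof.
by move=> s0 tf; split; [exact: measurable_gsmooth|move=> x; exact: gsmooth01].
Qed.

Lemma gsmooth_semigroup s t f x : 0 < s -> 0 < t -> tame f ->
  gsmooth s (gsmooth t f) x = gsmooth (Num.sqrt (s ^+ 2 + t ^+ 2)) f x.
Proof.
move=> s0 t0 tf; have [mf f01] := tf.
have tg : tame (gsmooth t f) by apply: tame_gsmooth; rewrite ?gt_eqF.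
apply: EFin_inj; rewrite -(gsmoothE s x tg) -(gsmoothE _ x tf).
have tge0 y z : (0 <= (f z * normal_pdf y t z * normal_pdf x s y)%:E)%E.
  by rewrite lee_fin; have /andP[f0 f1] := f01 z; rewrite !mulr_ge0// normal_pdf_ge0.
transitivity (\int[mu]_y \int[mu]_z (f z * normal_pdf y t z * normal_pdf x s y)%:E)%E.
  apply: eq_integral => y _; rewrite EFinM -gsmoothE// muleC -ge0_integralZl//.
  - by apply: eq_integral => z _; rewrite -EFinM mulrC.
  - by apply/measurable_EFinP; apply: measurable_funM => //; exact: measurable_normal_pdf.
  - move=> z _; rewrite lee_fin; have /andP[f0 f1] := f01 z.
    by rewrite mulr_ge0// normal_pdf_ge0.
  - by rewrite lee_fin normal_pdf_ge0.
rewrite (@fubini_tonelli _ _ _ _ R mu mu (fun yz : R * R =>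
   (f yz.2 * normal_pdf yz.1 t yz.2 * normal_pdf x s yz.1)%:E)); last 2 first.
- apply/measurable_EFinP; apply: measurable_funM; last first.
    by apply: measurableT_comp; [exact: measurable_normal_pdf|exact: measurable_fst].
  apply: measurable_funM; last by apply: measurable_normal_pdf2; rewrite gt_eqF.
  by apply: measurableT_comp => //; exact: measurable_snd.
- by move=> z; exact: tge0.
apply: eq_integral => z _ /=.
have /andP[f0 f1] := f01 z.
transitivity (\int[mu]_y ((f z * normal_pdf x (Num.sqrt (s ^+ 2 + t ^+ 2)) z)%:E *
   (normal_pdf ((x * t ^+ 2 + z * s ^+ 2) / (s ^+ 2 + t ^+ 2))
    (s * t / Num.sqrt (s ^+ 2 + t ^+ 2)) y)%:E))%E.
  apply: eq_integral => y _; rewrite -EFinM; congr EFin.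
  by rewrite -[LHS]mulrA (mulrC (normal_pdf y t z)) normal_pdf_mul// mulrA.
rewrite ge0_integralZl//.
- by rewrite integral_normal_pdf mule1.
- by apply/measurable_EFinP; exact: measurable_normal_pdf.
- by move=> y _; rewrite lee_fin normal_pdf_ge0.
- by rewrite lee_fin mulr_ge0// normal_pdf_ge0.
Qed.

Lemma normal_mgf l s x : 0 < s ->
  mu.-integrable [set: R] (fun y => (expR (l * (y - x)) * normal_pdf x s y)%:E) /\
  \int[mu]_y (expR (l * (y - x)) * normal_pdf x s y) = expR (l ^+ 2 * s ^+ 2 / 2).
Proof.
move=> s0; have tiltE : (fun y => expR (l * (y - x)) * normal_pdf x s y) =
    (fun y => expR (l ^+ 2 * s ^+ 2 / 2) * normal_pdf (x + l * s ^+ 2) s y).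
  by apply/funext => y; rewrite normal_pdf_tilt// gt_eqF.
split.
  have -> : (fun y => (expR (l * (y - x)) * normal_pdf x s y)%:E) =
     EFin \o (fun y => expR (l * (y - x)) * normal_pdf x s y) by [].
  rewrite tiltE; exact: (integrableZl measurableT _ (integrable_normal_pdf _ _)).
rewrite tiltE RintegralZl//; last exact: integrable_normal_pdf.
by rewrite /Rintegral integral_normal_pdf /= mulr1.
Qed.

Definition gmean s x (h : R -> R) := \int[mu]_y (h (y - x) * normal_pdf x s y).

Lemma gmean_dominated (s x : R) (h : R -> R) (C l : R) : 0 < s -> measurable_fun [set: R] h ->
  (forall u, `|h u| <= C * (expR (l * u) + expR (- l * u))) ->
  mu.-integrable [set: R] (fun y => (h (y - x) * normal_pdf x s y)%:E) /\
  `|gmean s x h| <= C * (2 * expR (l ^+ 2 * s ^+ 2 / 2)).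
Proof.
move=> s0 mh hC.
have [i1 e1] := normal_mgf l x s0; have [i2 e2] := normal_mgf (- l) x s0.
pose b y := expR (l * (y - x)) * normal_pdf x s y + expR (- l * (y - x)) * normal_pdf x s y.
have iD : mu.-integrable [set: R] (EFin \o b) by exact: (integrableD measurableT i1 i2).
have iC : mu.-integrable [set: R] (EFin \o (fun y => C * b y)).
  exact: (integrableZl measurableT C iD).
have hb y : `|h (y - x) * normal_pdf x s y| <= C * b y.
  rewrite normrM (ger0_norm (normal_pdf_ge0 _ _ _)) /b -mulrDl mulrA.
  by rewrite ler_wpM2r ?normal_pdf_ge0.
have ih : mu.-integrable [set: R] (fun y => (h (y - x) * normal_pdf x s y)%:E).
  apply: le_integrable iC => //.
    apply/measurable_EFinP; apply: measurable_funM; last exact: measurable_normal_pdf.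
    by apply: measurableT_comp => //; exact: measurable_funB.
  move=> y _; rewrite /= lee_fin; apply: le_trans (hb y) _; exact: ler_norm.
split => //; apply: le_trans (le_normr_Rintegral _ ih) _ => //.
have -> : C * (2 * expR (l ^+ 2 * s ^+ 2 / 2)) = \int[mu]_y (C * b y).
  rewrite RintegralZl// /b RintegralD// e1 e2 sqrrN; ring.
apply: le_Rintegral => //; first exact: integrable_norm.
Qed.

Lemma expR_absD (v : R) : expR `|v| <= expR v + expR (- v).
Proof.
have := expR_ge0 v; have := expR_ge0 (- v).
by case: (ger0P v) => _; lra.
Qed.

Lemma abs_le_exp (v : R) : `|v| <= expR v + expR (- v).
Proof.
apply: le_trans (expR_absD v); apply: le_trans (expR_ge1Dx _).
by rewrite lerDr.
Qed.

Lemma sqr_le_exp (v : R) : v ^+ 2 <= 2 * (expR v + expR (- v)).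
Proof.
apply: le_trans (ler_wpM2l _ (expR_absD v)) => //.
rewrite -ler_pdivrMl// mulrC -real_normK ?num_real//.
have := @expR_ge1Dxn R `|v| 1 (normr_ge0 v); rewrite (_ : 2`! = 2%N)//; lra.
Qed.

Lemma cube_le_exp (v : R) : `|v| ^+ 3 <= 6 * expR `|v|.
Proof.
have := @expR_ge1Dxn R `|v| 2 (normr_ge0 v); rewrite (_ : 3`! = 6%N)//; lra.
Qed.

Lemma vanishing_slope (a D : R) : 0 <= D ->
  (forall x, 0 < x <= 1 -> a <= D * x) -> a <= 0.
Proof.
move=> D0 h; rewrite leNgt; apply/negP => a0.
have p0 : 0 < D + 1 + a by lra.
have := h (a / (D + 1 + a)); rewrite divr_gt0//= ler_pdivrMr// mul1r.
rewrite lerDr addr_ge0// => /(_ isT); rewrite mulrA ler_pdivlMr//.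
have := mulr_gt0 a0 a0; nra.
Qed.

(** The values at x and -x isolate B, then A; each is bounded by D x for all small x. *)
Lemma vanishing_quadratic (A B D : R) : 0 <= D ->
  (forall x, `|x| <= 1 -> `|A * x + B * x ^+ 2| <= D * `|x| ^+ 3) ->
  A = 0 /\ B = 0.
Proof.
move=> D0 h.
have pm x : 0 < x <= 1 -> `|A * x + B * x ^+ 2| <= D * x ^+ 3 /\
    `|B * x ^+ 2 - A * x| <= D * x ^+ 3.
  move=> /andP[x0 x1]; have := h x; have := h (- x).
  rewrite normrN ger0_norm ?(ltW x0)// => /(_ x1) h1 /(_ x1) h2; split => //.
  by move: h1; rewrite sqrrN mulrN addrC.
have B0 : `|B| <= 0.
  apply: (vanishing_slope D0) => x x01; have [h1 h2] := pm x x01.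
  have /andP[x0 x1] := x01.
  have x2 : 0 < x ^+ 2 by rewrite exprn_gt0.
  rewrite -(ler_pM2r x2) -[X in _ * X](ger0_norm (ltW x2)) -normrM.
  have -> : B * x ^+ 2 = ((A * x + B * x ^+ 2) + (B * x ^+ 2 - A * x)) / 2 by field.
  rewrite normrM [X in _ * X]ger0_norm//.
  have := ler_normD (A * x + B * x ^+ 2) (B * x ^+ 2 - A * x); lra.
have {}B0 : B = 0 by apply/eqP; rewrite -normr_le0.
split => //; apply/eqP; rewrite -normr_le0.
apply: (vanishing_slope D0) => x x01; have [h1 _] := pm x x01.
have /andP[x0 x1] := x01.
rewrite B0 mul0r addr0 normrM (ger0_norm (ltW x0)) in h1.
rewrite -(ler_pM2r x0); apply: le_trans h1 _.
by rewrite -mulrA ler_wpM2l// -expr2 exprS ler_piMl// exprn_ge0// ltW.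
Qed.

(** The 6 of [cube_le_exp], the 2 of [gmean_dominated], and the Gaussian exponential moment for the
    tilt 2 / s. *)
Definition cubic_cst : R := 12 * expR 2.

(** The moments are read off the generating function: tilted by t / s it is exp (t ^ 2 / 2), and
    both it and its expansion with unknown moments are known up to O(|t| ^ 3). By
    [vanishing_quadratic] the coefficients agree. *)
Lemma normal_moments s x : 0 < s ->
  [/\ mu.-integrable [set: R] (fun y => ((y - x) * normal_pdf x s y)%:E),
      mu.-integrable [set: R] (fun y => ((y - x) ^+ 2 * normal_pdf x s y)%:E),
      gmean s x id = 0 & gmean s x (fun u => u ^+ 2) = s ^+ 2].
Proof.
move=> s0; have sn0 : s != 0 by rewrite gt_eqF.
have sV u : s^-1 * u = u / s by rewrite mulrC.
have sVN u : - s^-1 * u = - (u / s) by rewrite mulNr mulrC.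
have [i1 _] : mu.-integrable [set: R] (fun y => (id (y - x) * normal_pdf x s y)%:E) /\
   `|gmean s x id| <= s * (2 * expR (s^-1 ^+ 2 * s ^+ 2 / 2)).
  apply: gmean_dominated => // u; rewrite sV sVN -ler_pdivrMl//.
  by rewrite -[X in X * _]gtr0_norm ?invr_gt0// -normrM mulrC abs_le_exp.
have [i2 _] : mu.-integrable [set: R] (fun y => ((fun u => u ^+ 2) (y - x) * normal_pdf x s y)%:E) /\
   `|gmean s x (fun u => u ^+ 2)| <= (2 * s ^+ 2) * (2 * expR (s^-1 ^+ 2 * s ^+ 2 / 2)).
  apply: gmean_dominated => // u.
  rewrite sV sVN ger0_norm ?sqr_ge0// mulrAC -ler_pdivrMr ?exprn_gt0//.
  by rewrite -expr_div_n sqr_le_exp.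
set m1 := gmean s x id; set m2 := gmean s x _.
have key t : `|t| <= 1 -> `|m1 / s * t + (m2 / s ^+ 2 - 1) / 2 * t ^+ 2| <=
    (cubic_cst + expR 1 + 1) * `|t| ^+ 3.
  move=> t1; pose l := t / s.
  pose rem u := expR (l * u) - (1 + l * u + (l * u) ^+ 2 / 2).
  have [ir hr] : mu.-integrable [set: R] (fun y => (rem (y - x) * normal_pdf x s y)%:E) /\
     `|gmean s x rem| <= (6 * `|t| ^+ 3) * (2 * expR ((2 / s) ^+ 2 * s ^+ 2 / 2)).
    apply: gmean_dominated => // [|u].
      apply: measurable_funB.
        by apply: measurableT_comp => //; exact: measurable_funM.
      apply: measurable_funD; first by apply: measurable_funD => //; exact: measurable_funM.
      by apply: measurable_funM => //; apply: measurable_funX; exact: measurable_funM.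
    apply: le_trans (expR_taylor2 _) _.
    have -> : l * u = t * (u / s) by rewrite /l; ring.
    have -> : 2 / s * u = 2 * (u / s) by ring.
    have -> : - (2 / s) * u = - (2 * (u / s)) by ring.
    set v := u / s.
    have h1 : `|v| ^+ 3 * expR (`|t| * `|v|) <= 6 * (expR (2 * v) + expR (- (2 * v))).
      apply: (@le_trans _ _ (6 * expR `|v| * expR `|v|)).
        apply: ler_pM; rewrite ?exprn_ge0 ?expR_ge0//; first exact: cube_le_exp.
        by rewrite ler_expR ler_piMl.
      rewrite -mulrA -expRD ler_wpM2l//.
      have -> : `|v| + `|v| = `|2 * v| by rewrite [RHS]normrM normr_nat; ring.
      exact: expR_absD.
    rewrite normrM; have := ler_wpM2l (exprn_ge0 3 (normr_ge0 t)) h1.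
    by move: (expR (`|t| * `|v|)) (expR (2 * v)) (expR (- (2 * v))) => e1 e2 e3; nra.
  have [ie ee] := normal_mgf l x s0.
  have remE : gmean s x rem = expR (t ^+ 2 / 2) - (1 + l * m1 + l ^+ 2 / 2 * m2).
    have i0 := integrable_normal_pdf x s.
    have il := integrableZl measurableT l i1.
    have iq := integrableZl measurableT (l ^+ 2 / 2) i2.
    have i01 := integrableD measurableT i0 il.
    have i012 := integrableD measurableT i01 iq.
    have -> : gmean s x rem = \int[mu]_y (expR (l * (y - x)) * normal_pdf x s y -
       ((normal_pdf x s y + l * (id (y - x) * normal_pdf x s y)) +
         l ^+ 2 / 2 * ((fun u => u ^+ 2) (y - x) * normal_pdf x s y))).
      by apply: eq_Rintegral => y _; rewrite /rem /=; ring.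
    rewrite RintegralB// RintegralD// RintegralD// !RintegralZl//.
    rewrite ee {1}/Rintegral integral_normal_pdf /=.
    by congr (expR _ - _); rewrite /l expr_div_n divfK// expf_neq0.
  have t0 := normr_ge0 t.
  have hexp : `|expR (t ^+ 2 / 2) - (1 + t ^+ 2 / 2)| <= (expR 1 + 1) * `|t| ^+ 3.
    have := expR_taylor2 (t ^+ 2 / 2).
    have q1 : `|t ^+ 2 / 2| = `|t| ^+ 2 / 2.
      by rewrite normrM normrX (ger0_norm (_ : 0 <= 2^-1)).
    rewrite q1; have t2 : `|t| ^+ 2 <= 1 by rewrite expr_le1.
    have : expR (`|t| ^+ 2 / 2) <= expR 1 by rewrite ler_expR; lra.
    set E := expR (t ^+ 2 / 2); set w := `|t|; move: (expR (w ^+ 2 / 2)) => E1 hE1 hE.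
    have -> : E - (1 + t ^+ 2 / 2) = (E - (1 + t ^+ 2 / 2 + (t ^+ 2 / 2) ^+ 2 / 2)) +
       (w ^+ 2 / 2) ^+ 2 / 2 by rewrite /w real_normK ?num_real//; ring.
    apply: le_trans (ler_normD _ _) _; rewrite [(expR 1 + 1) * _]mulrDl mul1r.
    have w3 : 0 <= w ^+ 3 by rewrite exprn_ge0.
    have w31 : w ^+ 3 <= 1 by rewrite exprn_ile1.
    apply: lerD.
      apply: le_trans hE _; rewrite mulrC.
      have E10 : 0 <= expR 1 :> R by exact: expR_ge0.
      apply: le_trans (_ : expR 1 * (w ^+ 2 / 2) ^+ 3 <= _).
        by rewrite ler_wpM2r// exprn_ge0// divr_ge0// exprn_ge0.
      rewrite ler_wpM2l//.
      have -> : (w ^+ 2 / 2) ^+ 3 = w ^+ 3 * w ^+ 3 / 8 by field.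
      nra.
    rewrite ger0_norm; last by rewrite divr_ge0 ?exprn_ge0 ?divr_ge0 ?exprn_ge0.
    have -> : (w ^+ 2 / 2) ^+ 2 / 2 = w ^+ 3 * w / 8 by field.
    by have := ler_wpM2l w3 t1; rewrite mulr1 -/w; move: w3; move: (w ^+ 3 * w) (w ^+ 3) => a b; lra.
  have e2 : expR ((2 / s) ^+ 2 * s ^+ 2 / 2) = expR 2.
    by congr expR; field.
  rewrite e2 remE in hr.
  have -> : m1 / s * t + (m2 / s ^+ 2 - 1) / 2 * t ^+ 2 =
     (expR (t ^+ 2 / 2) - (1 + t ^+ 2 / 2)) - (expR (t ^+ 2 / 2) - (1 + l * m1 + l ^+ 2 / 2 * m2)).
    by rewrite /l; field.
  apply: le_trans (ler_normB _ _) _; rewrite /cubic_cst.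
  move: hexp hr; lra.
have D0 : 0 <= cubic_cst + expR 1 + 1 by rewrite /cubic_cst !addr_ge0 ?mulr_ge0 ?expR_ge0.
have [A0 B0] := vanishing_quadratic D0 key.
split => //.
  by move/eqP: A0; rewrite mulf_eq0 invr_eq0 (negPf sn0) orbF => /eqP.
have : m2 / s ^+ 2 = 1 by lra.
by move=> /(congr1 (fun z => z * s ^+ 2)); rewrite divfK ?mul1r// expf_neq0.
Qed.

(** The linear term integrates to 0, the quadratic one to the variance, and the cubic remainder is
    dominated by exponentials. *)
Lemma gsmooth_taylor s x f (a b C : R) : 0 < s -> tame f -> 0 <= C ->
  (forall u, `|f (x + u) - (f x + a * u + b * u ^+ 2 / 2)| <= C * `|u| ^+ 3) ->
  `|gsmooth s f x - (f x + b * s ^+ 2 / 2)| <= C * cubic_cst * s ^+ 3.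
Proof.
move=> s0 tf C0 hf; have sn0 : s != 0 by rewrite gt_eqF.
have [i1 i2 e1 e2] := normal_moments x s0.
have i0 := integrable_normal_pdf x s.
have ic := integrableZl measurableT (f x) i0.
have il := integrableZl measurableT a i1.
have iq := integrableZl measurableT (b / 2) i2.
have i01 := integrableD measurableT ic il.
have i012 := integrableD measurableT i01 iq.
have it := integrable_tame s x tf.
pose rem u := f (x + u) - (f x + a * u + b * u ^+ 2 / 2).
have mrem : measurable_fun [set: R] rem.
  apply: measurable_funB.
    by apply: measurableT_comp => //; [case: tf|exact: measurable_funD].
  apply: measurable_funD.
    by apply: measurable_funD => //; exact: measurable_funM.
  by apply: measurable_funM => //; apply: measurable_funM => //; exact: exprn_measurable.
have [_ hr] : mu.-integrable [set: R] (fun y => (rem (y - x) * normal_pdf x s y)%:E) /\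
     `|gmean s x rem| <= (6 * C * s ^+ 3) * (2 * expR (s^-1 ^+ 2 * s ^+ 2 / 2)).
  apply: gmean_dominated => // u; apply: le_trans (hf u) _.
  have -> : s^-1 * u = u / s by rewrite mulrC.
  have -> : - s^-1 * u = - (u / s) by rewrite mulNr mulrC.
  suff h : `|u| ^+ 3 <= 6 * s ^+ 3 * (expR (u / s) + expR (- (u / s))).
    by have := ler_wpM2l C0 h; lra.
  apply: le_trans (_ : s ^+ 3 * (6 * expR `|u / s|) <= _); last first.
    have := ler_wpM2l (exprn_ge0 3 (ltW s0)) (expR_absD (u / s)); lra.
  rewrite -ler_pdivrMl ?exprn_gt0//; apply: le_trans (cube_le_exp _).
  by rewrite normrM normfV (gtr0_norm s0) expr_div_n mulrC.
have -> : gsmooth s f x - (f x + b * s ^+ 2 / 2) = gmean s x rem.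
  have -> : gmean s x rem = \int[mu]_y (f y * normal_pdf x s y -
       ((f x * normal_pdf x s y + a * ((y - x) * normal_pdf x s y)) +
         b / 2 * ((y - x) ^+ 2 * normal_pdf x s y))).
    by apply: eq_Rintegral => y _; rewrite /rem (_ : x + (y - x) = y); ring.
  rewrite RintegralB// RintegralD// RintegralD// !RintegralZl//.
  rewrite [\int[mu]_y normal_pdf x s y]/Rintegral integral_normal_pdf /=.
  rewrite -[X in a * X]/(gmean s x id) e1 -[X in b / 2 * X]/(gmean s x (fun u => u ^+ 2)) e2.
  by rewrite /gsmooth /Rintegral; ring.
apply: le_trans hr _; rewrite exprVn mulVf ?expf_neq0// /cubic_cst.
have e12 : expR (1 / 2) <= expR 2 :> R by rewrite ler_expR; lra.
have Cs : 0 <= C * s ^+ 3 by rewrite mulr_ge0// exprn_ge0// ltW.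
have := ler_wpM2l Cs e12; lra.
Qed.

End GaussSmoothing.

(** * Smooth test functions *)

Section TestFunctions.
Context {R : realType}.
Implicit Types (f g : R -> R) (C e x y u : R).

(* The functions [g] and [h] play the role of the first two derivatives. *)
Definition taylor C f := exists g h : R -> R, forall x u,
  `|f (x + u) - (f x + g x * u + h x * u ^+ 2 / 2)| <= C * `|u| ^+ 3.

Lemma taylor_ge0 C f : taylor C f -> 0 <= C.
Proof.
move=> [g [h H]]; have := le_trans (normr_ge0 _) (H 0 1).
by rewrite normr1 expr1n mulr1.
Qed.

Lemma taylorD C D f g : taylor C f -> taylor D g -> taylor (C + D) (fun x => f x + g x).
Proof.
move=> [f1 [f2 Hf]] [g1 [g2 Hg]]; exists (fun x => f1 x + g1 x), (fun x => f2 x + g2 x) => x u.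
rewrite [leRHS]mulrDl; apply: le_trans _ (lerD (Hf x u) (Hg x u)).
by apply: le_trans _ (ler_normD _ _); rewrite le_eqVlt; apply/orP; left; apply/eqP; congr `|_|; ring.
Qed.

Lemma taylorZ C k f : taylor C f -> taylor (`|k| * C) (fun x => k * f x).
Proof.
move=> [f1 [f2 Hf]]; exists (fun x => k * f1 x), (fun x => k * f2 x) => x u.
rewrite -[leRHS]mulrA; apply: le_trans _ (ler_wpM2l (normr_ge0 k) (Hf x u)).
by rewrite -normrM le_eqVlt; apply/orP; left; apply/eqP; congr `|_|; ring.
Qed.

Lemma taylor_cst k : taylor 0 (fun=> k : R).
Proof.
exists (fun=> 0), (fun=> 0) => x u.
by rewrite !mul0r !addr0 subrr normr0.
Qed.

Lemma taylor_affine C f a b : taylor C f -> taylor (C * `|a| ^+ 3) (fun x => f (a * x + b)).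
Proof.
move=> [f1 [f2 Hf]].
exists (fun x => a * f1 (a * x + b)), (fun x => a ^+ 2 * f2 (a * x + b)) => x u.
rewrite -[leRHS]mulrA -[X in _ <= _ * X]exprMn -normrM.
apply: le_trans _ (Hf (a * x + b) (a * u)).
rewrite le_eqVlt; apply/orP; left; apply/eqP; congr `|_|.
have -> : a * (x + u) + b = a * x + b + a * u by ring.
ring.
Qed.

Definition cubic_part x : R := Num.max x 0 ^+ 3.

Lemma cubic_partE x : cubic_part x = if 0 <= x then x ^+ 3 else 0.
Proof. by rewrite /cubic_part; case: (lerP 0 x) => h //; rewrite expr0n. Qed.

Lemma taylor_cubic_part : taylor 1 cubic_part.
Proof.
exists (fun x => if 0 <= x then 3 * x ^+ 2 else 0), (fun x => if 0 <= x then 6 * x else 0).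
move=> x u; rewrite mul1r !cubic_partE.
case: (lerP 0 x) => x0; case: (lerP 0 (x + u)) => xu0.
- have -> : (x + u) ^+ 3 - (x ^+ 3 + 3 * x ^+ 2 * u + 6 * x * u ^+ 2 / 2) = u ^+ 3 by field.
  by rewrite normrX.
- have u0 : u < 0 by lra.
  have -> : 0 - (x ^+ 3 + 3 * x ^+ 2 * u + 6 * x * u ^+ 2 / 2) = u ^+ 3 - (x + u) ^+ 3 by field.
  rewrite (ltr0_norm u0) -[u]opprK; move: x0 xu0; set v := - u => x0 xu0.
  have v0 : 0 < v by rewrite oppr_gt0.
  have : u = - v by rewrite opprK.
  move: v v0 xu0 => v v0 xu0 uv; rewrite uv in xu0 *.
  have w0 : 0 <= v - x by lra.
  have -> : (- v) ^+ 3 - (x - v) ^+ 3 = - (v ^+ 3 - (v - x) ^+ 3) by ring.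
  have := exprn_ge0 3 w0.
  have : (v - x) ^+ 3 <= v ^+ 3 by rewrite lerXn2r ?nnegrE//; lra.
  by move=> h1 h2; rewrite normrN ger0_norm ?opprK; lra.
- have u0 : 0 < u by lra.
  rewrite !mul0r !addr0 subr0 (gtr0_norm u0) ger0_norm ?exprn_ge0//.
  by rewrite lerXn2r ?nnegrE//; lra.
- by rewrite !mul0r !addr0 subrr normr0 exprn_ge0.
Qed.

(* The integral of the quadratic B-spline with knots 0, 1, 2, 3. *)
Definition ramp x : R :=
  (cubic_part x + (-3) * cubic_part (x - 1) + 3 * cubic_part (x - 2) +
   (-1) * cubic_part (x - 3)) / 6.

(** The coefficients give (1 + 3 + 3 + 1) / 6, rounded up to 2. *)
Lemma taylor_ramp : taylor 2 ramp.
Proof.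
have sh k : taylor 1 (fun x => cubic_part (x - k)).
  have := taylor_affine 1 (- k) taylor_cubic_part; rewrite normr1 expr1n mulr1.
  by under eq_fun do rewrite mul1r.
have := taylorD (taylorD (taylorD taylor_cubic_part (taylorZ (-3) (sh 1)))
   (taylorZ 3 (sh 2))) (taylorZ (-1) (sh 3)).
move=> /(taylorZ 6^-1) => -[g [h H]]; exists g, h => x u.
rewrite /ramp ![_ / 6]mulrC; apply: le_trans (H x u) _.
rewrite !normrN normr1 !(ger0_norm (_ : 0 <= 6^-1)) ?invr_ge0// !(ger0_norm (ler0n R 3)).
by rewrite ler_wpM2r ?exprn_ge0//; lra.
Qed.

Lemma ramp_le0 x : x <= 0 -> ramp x = 0.
Proof.
move=> x0; rewrite /ramp /cubic_part !max_r ?expr0n /=; try lra.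
Qed.

Lemma ramp_ge3 x : 3 <= x -> ramp x = 1.
Proof. by move=> x3; rewrite /ramp /cubic_part !max_l; try lra; field. Qed.

Lemma ramp01 x : 0 <= ramp x <= 1.
Proof.
have [x0|x0] := lerP x 0; first by rewrite ramp_le0// lexx ler01.
have [x3|x3] := lerP 3 x; first by rewrite ramp_ge3// lexx ler01.
rewrite /ramp /cubic_part (max_l (ltW x0)) (max_r (_ : x - 3 <= 0)) ?expr0n /=; last by lra.
have [x1|x1] := lerP x 1.
  rewrite !max_r ?expr0n /=; try lra.
  rewrite !mulr0 !addr0.
  have h0 : 0 <= x ^+ 3 by rewrite exprn_ge0// ltW.
  have h1 : x ^+ 3 <= 1 by rewrite exprn_ile1// ltW.
  by apply/andP; split; lra.
have [x2|x2] := lerP x 2.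
  rewrite (max_l (_ : 0 <= x - 1)) ?(max_r (_ : x - 2 <= 0)) ?expr0n /=; try lra.
  rewrite !mulr0 !addr0; move: x1 x2; have -> : x = (x - 1) + 1 by ring.
  move: (x - 1) => z z0 z1; rewrite addrK.
  have {}z0 : 0 <= z by lra.
  have {}z1 : 0 <= 1 - z by lra.
  have := mulr_ge0 (sqr_ge0 z) z1; have := mulr_ge0 (sqr_ge0 (1 - z)) z0.
  have := sqr_ge0 (1 - z).
  by move=> h1 h2 h3; apply/andP; split; nra.
rewrite (max_l (_ : 0 <= x - 1)) ?(max_l (_ : 0 <= x - 2)); try lra.
rewrite !mulr0 !addr0; move: x2 x3; have -> : x = (x - 2) + 2 by ring.
move: (x - 2) => z z0 z1.
have -> : (z + 2) ^+ 3 + -3 * (z + 2 - 1) ^+ 3 + 3 * (z + 2 - 2) ^+ 3 = 6 - (1 - z) ^+ 3 by ring.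
have h0 : 0 <= (1 - z) ^+ 3 by rewrite exprn_ge0//; lra.
have h1 : (1 - z) ^+ 3 <= 1 by rewrite exprn_ile1//; lra.
by apply/andP; split; lra.
Qed.

Lemma measurable_ramp : measurable_fun [set: R] ramp.
Proof.
have mc k : measurable_fun [set: R] (fun x => cubic_part (x - k)).
  by apply: measurable_funX; apply: measurable_maxr => //; exact: measurable_funB.
have m0 : measurable_fun [set: R] cubic_part.
  by apply: measurable_funX; exact: measurable_maxr.
apply: measurable_funM => //; apply: measurable_funD.
  apply: measurable_funD; last exact: measurable_funM.
  by apply: measurable_funD => //; exact: measurable_funM.
exact: measurable_funM.
Qed.

(** A smoothed indicator of []-oo, x0]], descending from 1 to 0 between x0 and x0 + 3 e. *)
Definition soft_step e x0 y := 1 - ramp (e^-1 * y + - (e^-1 * x0)).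

Lemma tame_soft_step e x0 : tame (soft_step e x0).
Proof.
split => [|y]; last by rewrite /soft_step; have := ramp01 (e^-1 * y + - (e^-1 * x0)); lra.
apply: measurable_funB => //; apply: measurableT_comp; first exact: measurable_ramp.
by apply: measurable_funD => //; exact: measurable_funM.
Qed.

Lemma taylor_soft_step e x0 : taylor (2 * `|e^-1| ^+ 3) (soft_step e x0).
Proof.
have := taylorD (taylor_cst 1) (taylorZ (-1) (taylor_affine e^-1 (- (e^-1 * x0)) taylor_ramp)).
rewrite normrN normr1 mul1r add0r => -[g [h H]]; exists g, h => x u.
by rewrite /soft_step; have := H x u; rewrite !mulN1r.
Qed.

Lemma soft_step_le e x0 y : 0 < e -> y <= x0 -> soft_step e x0 y = 1.
Proof.
move=> e0 yx; rewrite /soft_step ramp_le0 ?subr0// -mulrBr.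
by rewrite pmulr_rle0 ?invr_gt0// subr_le0.
Qed.

Lemma soft_step_ge e x0 y : 0 < e -> x0 + 3 * e <= y -> soft_step e x0 y = 0.
Proof.
move=> e0 yx; rewrite /soft_step ramp_ge3 ?subrr// -mulrBr ler_pdivlMl//; lra.
Qed.

(** The coefficients of the expansion are bounded by comparing it at u = 1 and u = -1 with the
    oscillation of f, which is at most 1. The same oscillation settles |u| >= 1. *)
Lemma taylor_lipschitz C f : tame f -> taylor C f ->
  forall x u, `|f (x + u) - f x| <= (3 * C + 2) * `|u|.
Proof.
move=> [_ f01] tf x u; have C0 := taylor_ge0 tf; move: tf => [g [h H]].
have bnd a b : `|f a - f b| <= 1.
  have /andP[a0 a1] := f01 a; have /andP[b0 b1] := f01 b.
  by rewrite ler_norml; apply/andP; split; lra.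
have [u1|u1] := lerP 1 `|u|; first by apply: le_trans (bnd _ _) _; nra.
have := H x 1; have := H x (- 1).
rewrite normrN normr1 !expr1n sqrrN expr1n !mulr1 => h1 h2.
have gC : `|g x| <= C + 1.
  move: h1 h2; rewrite !ler_norml => /andP[a1 a2] /andP[b1 b2].
  have := bnd (x + 1) (x - 1); rewrite ler_norml => /andP[c1 c2].
  by apply/andP; split; lra.
have hC : `|h x| <= 2 * C + 2.
  move: h1 h2; rewrite !ler_norml => /andP[a1 a2] /andP[b1 b2].
  have := bnd (x + 1) x; rewrite ler_norml => /andP[c1 c2].
  have := bnd (x - 1) x; rewrite ler_norml => /andP[d1 d2].
  by apply/andP; split; lra.
have -> : f (x + u) - f x = (f (x + u) - (f x + g x * u + h x * u ^+ 2 / 2)) +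
   (g x * u + h x / 2 * u ^+ 2) by ring.
apply: le_trans (ler_normD _ _) _.
apply: le_trans (lerD (H x u) (ler_normD _ _)) _.
rewrite (normrM (g x)) (normrM (h x / 2)) (normrM (h x)) (normrX 2 u).
rewrite (ger0_norm (_ : 0 <= 2^-1))//.
have u0 := normr_ge0 u.
have u2 : `|u| ^+ 2 <= `|u| by rewrite expr2 ler_piMl// ltW.
have u3 : `|u| ^+ 3 <= `|u| by apply: le_trans u2; rewrite exprS ler_piMl ?exprn_ge0// ltW.
have := ler_wpM2l C0 u3.
have := ler_pM (normr_ge0 (g x)) u0 gC (lexx `|u|).
have := ler_pM (normr_ge0 (h x)) (exprn_ge0 2 u0) hC u2.
have -> : `|h x| / 2 * `|u| ^+ 2 = (`|h x| * `|u| ^+ 2) / 2 by ring.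
move: (`|g x| * `|u|) (`|h x| * `|u| ^+ 2) => a b h5 h6 h7.
lra.
Qed.

Lemma gsmooth_near f r x L : 0 < r -> tame f -> 0 <= L ->
  (forall u, `|f (x + u) - f x| <= L * `|u|) ->
  `|gsmooth r f x - f x| <= L * (2 * expR 1) * r.
Proof.
move=> r0 tf L0 hL.
pose d u := f (x + u) - f x.
have [_ hr] : (@lebesgue_measure R).-integrable [set: R]
     (fun y => (d (y - x) * normal_pdf x r y)%:E) /\
     `|gmean r x d| <= (L * r) * (2 * expR (r^-1 ^+ 2 * r ^+ 2 / 2)).
  apply: gmean_dominated => // [|u].
    apply: measurable_funB => //; apply: measurableT_comp; first by case: tf.
    exact: measurable_funD.
  apply: le_trans (hL u) _; rewrite -mulrA ler_wpM2l//.
  have -> : r^-1 * u = u / r by rewrite mulrC.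
  have -> : - r^-1 * u = - (u / r) by rewrite mulNr mulrC.
  rewrite -ler_pdivrMl//; apply: le_trans (abs_le_exp _).
  by rewrite normrM normfV (gtr0_norm r0) mulrC.
have -> : gsmooth r f x - f x = gmean r x d.
  have i0 := integrable_normal_pdf x r.
  have ic := integrableZl measurableT (f x) i0.
  have it := integrable_tame r x tf.
  have -> : gmean r x d = \int[lebesgue_measure]_y (f y * normal_pdf x r y -
       f x * normal_pdf x r y).
    by apply: eq_Rintegral => y _; rewrite /d (_ : x + (y - x) = y); ring.
  rewrite RintegralB// !RintegralZl//.
  by rewrite [X in _ = _ - f x * X]/Rintegral integral_normal_pdf /= mulr1.
apply: le_trans hr _; rewrite exprVn mulVf ?expf_neq0 ?gt_eqF//.
have e12 : expR (1 / 2) <= expR 1 :> R by rewrite ler_expR; lra.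
have := ler_wpM2l (mulr_ge0 L0 (ltW r0)) e12; lra.
Qed.

(** By the semigroup property the larger smoothing is the smaller one applied to f smoothed with
    variance t ^ 2 - s ^ 2, and the latter is close to f since f is Lipschitz. *)
Lemma gsmooth_sd f s t x C : 0 < s -> s <= t -> tame f -> taylor C f ->
  `|gsmooth t f x - gsmooth s f x| <=
  (3 * C + 2) * (2 * expR 1) * Num.sqrt (t ^+ 2 - s ^+ 2).
Proof.
move=> s0 st tf yf; have C0 := taylor_ge0 yf.
have [->|ts] := eqVneq t s; first by rewrite !subrr normr0 sqrtr0 mulr0.
have {}ts : s < t by rewrite lt_neqAle eq_sym ts.
have r2 : 0 < t ^+ 2 - s ^+ 2 by rewrite subr_gt0 ltrXn2r// ?nnegrE// ltW// (lt_trans s0).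
have r0 : 0 < Num.sqrt (t ^+ 2 - s ^+ 2) by rewrite sqrtr_gt0.
have -> : gsmooth t f x = gsmooth s (gsmooth (Num.sqrt (t ^+ 2 - s ^+ 2)) f) x.
  have e : Num.sqrt (s ^+ 2 + Num.sqrt (t ^+ 2 - s ^+ 2) ^+ 2) = t.
    rewrite sqr_sqrtr ?ltW// addrC subrK sqrtr_sqr ger0_norm// ltW//.
    exact: lt_trans ts.
  by rewrite (gsmooth_semigroup x s0 r0 tf) e.
apply: gsmooth_dist => //; first by apply: tame_gsmooth; rewrite ?gt_eqF.
move=> y; apply: gsmooth_near => //; first by lra.
by move=> u; exact: taylor_lipschitz.
Qed.

End TestFunctions.

(** * Lindeberg replacement *)

Section Lindeberg.
Context {R : realType} {G : groupType} (Gamma : {fset G}).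
Hypothesis Gamma0 : Gamma != fset0.
Local Notation mean := (@mean R G Gamma).
Local Notation sd := (@sd R G Gamma).
Local Notation centered := (@centered R G Gamma).
Local Notation blocksum := (@blocksum R G).
Implicit Types (U : seq G -> R) (f : R -> R).

Lemma tame_mean n U f : tame f -> tame (fun x => mean n (fun s => f (x + U s))).
Proof.
move=> [mf f01]; split => [|x].
  apply: measurable_funM => //.
  apply: measurable_sum => s; apply: measurableT_comp => //.
  exact: measurable_funD.
apply/andP; split; first by apply: mean_ge0 => s _ _; have /andP[] := f01 (x + U s).
by apply: mean_bound => // s _ _; have /andP[] := f01 (x + U s).
Qed.

Lemma taylor_mean n U C f : taylor C f -> taylor C (fun x => mean n (fun s => f (x + U s))).
Proof.
move=> [g [h H]].
exists (fun x => mean n (fun s => g (x + U s))), (fun x => mean n (fun s => h (x + U s))) => x u.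
rewrite -mulrA -!meanZr -!meanD -meanB; apply: le_trans (norm_mean_le _ _ _) _.
apply: mean_bound => // s _ _.
by have := H (x + U s) u; rewrite addrAC mulrA.
Qed.

(** Quantifying over all test functions with the same constant, and over all shifts, makes the
    property stable under sums: the partial averages of f are again admissible. *)
Definition gauss_close n U C delta := forall f x, tame f -> taylor C f ->
  `|mean n (fun s => f (x + centered n U s)) - gsmooth (sd n U) f x| <= delta.

(** Both means agree with [f x + h x * sd n U ^+ 2 / 2] up to third order, since the first two
    moments match. *)
Lemma gauss_close_bounded n U C b : 0 < sd n U ->
  (forall s, size s = n -> {subset s <= Gamma} -> `|centered n U s| <= b) -> 0 <= b ->
  gauss_close n U C (C * (1 + @cubic_cst R) * b ^+ 3).
Proof.
move=> s0 Ub b0 f x tf yf; have C0 := taylor_ge0 yf; move: (yf) => [g [h H]].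
have sb : sd n U <= b by exact: norm2_bound.
have h1 := gsmooth_taylor s0 tf C0 (H x).
have h2 : `|mean n (fun s => f (x + centered n U s)) -
    (f x + h x * sd n U ^+ 2 / 2)| <= C * b ^+ 3.
  have -> : f x + h x * sd n U ^+ 2 / 2 = mean n (fun s =>
      f x + g x * centered n U s + h x * centered n U s ^+ 2 / 2).
    rewrite !meanD mean_cst// meanZ mean_centered// mulr0 addr0 sd_sq.
    by rewrite meanZr meanZ.
  rewrite -meanB; apply: le_trans (norm_mean_le _ _ _) _; apply: mean_bound => // s sn sG.
  apply: le_trans (H x _) _; rewrite ler_wpM2l// lerXn2r ?nnegrE// Ub//.
have c0 : 0 <= @cubic_cst R by rewrite mulr_ge0 ?expR_ge0.
have h3 : C * @cubic_cst R * sd n U ^+ 3 <= C * @cubic_cst R * b ^+ 3.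
  by rewrite ler_wpM2l ?mulr_ge0// lerXn2r ?nnegrE// ltW.
have -> : mean n (fun s => f (x + centered n U s)) - gsmooth (sd n U) f x =
   (mean n (fun s => f (x + centered n U s)) - (f x + h x * sd n U ^+ 2 / 2)) -
   (gsmooth (sd n U) f x - (f x + h x * sd n U ^+ 2 / 2)) by ring.
apply: le_trans (ler_normB _ _) _; lra.
Qed.

(** One replacement at a time: the mean over the second piece is a test function to which the first
    hypothesis applies, then the second hypothesis is used under the smoothing, and the semigroup
    property merges the two Gaussians. *)
Lemma gauss_close_sum n m U V C d e : 0 < sd n U -> 0 < sd m V ->
  gauss_close n U C d -> gauss_close m V C e ->
  gauss_close (n + m) (fun w => U (take n w) + V (drop n w)) C (d + e).
Proof.
move=> U0 V0 hU hV f x tf yf.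
rewrite sd_indep// -(gsmooth_semigroup _ U0 V0)//.
pose f2 y := mean m (fun t => f (y + centered m V t)).
have tf2 : tame f2 by exact: tame_mean.
have -> : mean (n + m) (fun w => f (x + centered (n + m)
     (fun w => U (take n w) + V (drop n w)) w)) =
   mean n (fun s => f2 (x + centered n U s)).
  rewrite mean_cat; apply: eq_mean => s sn _; apply: eq_mean => t _ _.
  rewrite /centered meanD mean_takel// mean_dropl// take_size_cat// drop_size_cat//.
  congr f; ring.
rewrite -[X in `|X - _|](subrK (gsmooth (sd n U) f2 x)) -addrA.
apply: le_trans (ler_normD _ _) _; apply: lerD.
  by apply: hU => //; exact: taylor_mean.
apply: gsmooth_dist => //; first by apply: tame_gsmooth; rewrite ?gt_eqF.
by move=> y; exact: hV.
Qed.

Lemma eq_gauss_close n U V C d :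
  (forall s, size s = n -> {subset s <= Gamma} -> U s = V s) ->
  gauss_close n U C d -> gauss_close n V C d.
Proof.
move=> UV hU f x tf yf; rewrite -(eq_sd UV).
have -> : mean n (fun s => f (x + centered n V s)) =
    mean n (fun s => f (x + centered n U s)).
  by apply: eq_mean => s sn sG; rewrite /centered -(eq_mean UV) -UV.
exact: hU.
Qed.

Lemma gauss_close_blocksum m q V C d : 0 < sd m V -> (0 < q)%N ->
  gauss_close m V C d ->
  gauss_close (q * m) (blocksum V m q) C (q%:R * d).
Proof.
move=> V0 + hV; elim: q => // q IH _.
have [->|q0] := posnP q.
  rewrite mul1n mul1r; apply: eq_gauss_close hV => s sm _.
  by rewrite /blocksum big_ord1 mul0n drop0 take_oversize// sm.
rewrite mulSnr -natr1 mulrDl mul1r.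
apply: (@eq_gauss_close _ (fun w => blocksum V m q (take (q * m) w) + V (drop (q * m) w))).
  move=> w wn _; have wq : size (take (q * m) w) = (q * m)%N.
    by rewrite size_takel// wn leq_addr.
  rewrite -[in RHS](cat_take_drop (q * m) w) -addn1 (blocksum_cat Gamma0)//; congr (_ + _).
  by rewrite /blocksum big_ord1 mul0n drop0 take_oversize// size_drop wn addKn.
apply: gauss_close_sum => //; last exact: IH.
have := sd_blocksum Gamma0 V m q 0; rewrite addn0 => ->.
by rewrite mulr_gt0// sqrtr_gt0 ltr0n.
Qed.

Lemma gauss_close_takel n m U C d : gauss_close n U C d ->
  gauss_close (n + m) (fun w => U (take n w)) C d.
Proof.
move=> hU f x tf yf; rewrite sd_take//.
have -> : mean (n + m) (fun w => f (x + centered (n + m) (fun w => U (take n w)) w)) =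
    mean n (fun s => f (x + centered n U s)); last exact: hU.
rewrite -(mean_takel Gamma0 n m); apply: eq_mean => w _ _.
by rewrite /centered mean_takel.
Qed.

Lemma mean_lipschitz n U V C f : tame f -> taylor C f ->
  `|mean n (fun s => f (centered n U s)) - mean n (fun s => f (centered n V s))| <=
  (3 * C + 2) * sd n (fun s => U s - V s).
Proof.
move=> tf yf; rewrite -meanB; apply: le_trans (norm_mean_le _ _ _) _.
have C0 := taylor_ge0 yf.
apply: (@le_trans _ _ (mean n (fun s => (3 * C + 2) *
   `|centered n (fun s => U s - V s) s|))); last first.
  by rewrite meanZ ler_wpM2l ?mean_norm_le//; lra.
apply: le_mean => s _ _.
have := taylor_lipschitz tf yf (centered n V s) (centered n (fun s => U s - V s) s).
congr (`|f _ - _| <= _); rewrite /centered meanB; ring.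
Qed.

End Lindeberg.

(** * Convergence of the distribution functions *)

Section FiniteCLT.
Context {R : realType} {G : groupType} (Gamma : {fset G}).
Hypothesis Gamma0 : Gamma != fset0.
Hypothesis Gammasym : symmetric_set Gamma.
Local Notation mean := (@mean R G Gamma).
Local Notation rcap := (@rcap R G Gamma).
Local Notation sd := (@sd R G Gamma).
Local Notation centered := (@centered R G Gamma).
Local Notation dev_rate := (@dev_rate R G Gamma).
Variable K : R.
Hypothesis hk_le : forall n x, @hk R G Gamma n x <= K / n.+1%:R ^+ 3.
Local Notation kappa := (@kappa R K).
Local Notation cubic_cst := (@cubic_cst R).

Lemma sdZ n k (U : seq G -> R) : sd n (fun w => k * U w) = `|k| * sd n U.
Proof.
rewrite /sd /norm2 -sqrtr_sqr -sqrtrM ?sqr_ge0// -meanZ; congr Num.sqrt.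
by apply: eq_mean => w _ _; rewrite /centered meanZ -mulrBr exprMn.
Qed.

Lemma gsmooth_sd_abs (f : R -> R) s t x C : 0 < s -> 0 < t -> tame f -> taylor C f ->
  `|gsmooth t f x - gsmooth s f x| <=
  (3 * C + 2) * (2 * expR 1) * Num.sqrt `|t ^+ 2 - s ^+ 2|.
Proof.
move=> s0 t0 tf yf; have [st|ts] := orP (le_total s t).
  by rewrite [X in Num.sqrt X]ger0_norm ?gsmooth_sd// subr_ge0 lerXn2r// nnegrE ltW.
rewrite distrC [X in Num.sqrt X]ler0_norm ?opprB ?gsmooth_sd//.
by rewrite subr_le0 lerXn2r// nnegrE ltW.
Qed.

Variable sigma : R.
Hypothesis sigma0 : 0 < sigma.
Hypothesis dev_rate_sigma : dev_rate n @[n --> \oo] --> sigma.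

Let scale n : R := (sigma * Num.sqrt n%:R)^-1.

(** Three errors add up: replacing the capacity by the sum over blocks, replacing the blocks by
    Gaussians, and correcting the variance of the block sum to 1. The second is at most of order n *
    n^(-3/2) for fixed s, one cubic error per block. *)
Lemma clt_error s n f C : (16 ^ s <= n)%N -> 0 < dev_rate (16 ^ s) ->
  tame f -> taylor C f ->
  `|mean n (fun w => f (centered n (fun w => scale n * rcap w) w)) - gsmooth 1 f 0| <=
  (3 * C + 2) / sigma * (40 * kappa / 2 ^+ s) +
  ((3 * C + 2) / sigma * block_cst K (4 * s) +
   C * (1 + cubic_cst) * (16 ^ s).+1%:R ^+ 3 / sigma ^+ 3) / Num.sqrt n%:R +
  (3 * C + 2) * (2 * expR 1) *
    Num.sqrt (`|1 - (dev_rate (16 ^ s) / sigma) ^+ 2| +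
      (dev_rate (16 ^ s) / sigma) ^+ 2 * (16 ^ s)%:R / Num.sqrt n%:R).
Proof.
set m := (16 ^ s)%N => mn am tf yf; set q := (n %/ m)%N; set k := scale n.
have C0 := taylor_ge0 yf.
have m0 : (0 < m)%N by rewrite expn_gt0.
have n0 : (0 < n)%N := leq_trans m0 mn.
have q0 : (0 < q)%N by rewrite divn_gt0.
have sn0 : 0 < Num.sqrt n%:R :> R by rewrite sqrtr_gt0 ltr0n.
have sm0 : 0 < Num.sqrt m%:R :> R by rewrite sqrtr_gt0 ltr0n.
have sq0 : 0 < Num.sqrt q%:R :> R by rewrite sqrtr_gt0 ltr0n.
have n1 : 1 <= Num.sqrt n%:R :> R by rewrite -[leLHS]sqrtr1 ler_wsqrtr// ler1n.
have k0 : 0 < k by rewrite invr_gt0 mulr_gt0.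
have vm0 : 0 < sd m rcap.
  by move: am; rewrite /dev_rate pmulr_lgt0// invr_gt0.
pose U w := k * rcap w.
pose V w := blocksum U m q w.
have VE w : V w = k * blocksum rcap m q w by rewrite /V /blocksum mulr_sumr.
have step1 : `|mean n (fun w => f (centered n U w)) - mean n (fun w => f (centered n V w))| <=
   (3 * C + 2) / sigma * (40 * kappa / 2 ^+ s) +
   (3 * C + 2) / sigma * block_cst K (4 * s) / Num.sqrt n%:R.
  apply: le_trans (mean_lipschitz Gamma0 _ _ _ tf yf) _.
  rewrite (eq_sd (g := fun w => k * (rcap w - blocksum rcap m q w))); last first.
    by move=> w _ _; rewrite VE mulrBr.
  rewrite sdZ (gtr0_norm k0).
  apply: le_trans (_ : (3 * C + 2) * (k * (40 * kappa / 2 ^+ s * Num.sqrt n%:R +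
     block_cst K (4 * s))) <= _).
    rewrite ler_wpM2l//; first by lra.
    by rewrite ler_wpM2l ?(ltW k0)//; exact: sd_block16.
  rewrite le_eqVlt; apply/orP; left; apply/eqP; rewrite /k /scale; field.
  by rewrite expf_neq0// !gt_eqF.
have sdU : sd m U = k * sd m rcap by rewrite sdZ gtr0_norm.
have sdV : sd n V = Num.sqrt q%:R * (k * sd m rcap).
  rewrite /V {1}(divn_eq n m) sd_blocksum// sdU//.
have step2 : `|mean n (fun w => f (centered n V w)) - gsmooth (sd n V) f 0| <=
   C * (1 + cubic_cst) * m.+1%:R ^+ 3 / sigma ^+ 3 / Num.sqrt n%:R.
  have gm : gauss_close Gamma m U C (C * (1 + cubic_cst) * (k * m.+1%:R) ^+ 3).
    apply: gauss_close_bounded => //; [by rewrite sdU mulr_gt0| |by rewrite mulr_ge0// ltW].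
    move=> w wm wG; rewrite /centered /U meanZ -mulrBr normrM (gtr0_norm k0).
    rewrite ler_wpM2l ?(ltW k0)//.
    have /andP[a1 a2] := @rcap_bound R G Gamma Gamma0 w; rewrite wm in a2.
    have b1 : 0 <= mean m rcap.
      by apply: mean_ge0 => z _ _; have /andP[] := @rcap_bound R G Gamma Gamma0 z.
    have b2 : mean m rcap <= m.+1%:R.
      by apply: mean_bound => // z zm _; have /andP[_] := @rcap_bound R G Gamma Gamma0 z; rewrite zm.
    by rewrite ler_norml; apply/andP; split; lra.
  have gV : gauss_close Gamma n V C (q%:R * (C * (1 + cubic_cst) * (k * m.+1%:R) ^+ 3)).
    have := gauss_close_takel Gamma0 (n %% m)
      (gauss_close_blocksum Gamma0 (_ : 0 < sd m U) q0 gm).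
    rewrite sdU mulr_gt0// -divn_eq => /(_ isT); apply: eq_gauss_close => w wn _.
    by rewrite /V -(blocksum_take Gamma0)// wn leq_divM.
  have := gV f 0 tf yf; under eq_mean do rewrite add0r.
  move=> /le_trans; apply.
  have qn : q%:R <= Num.sqrt n%:R ^+ 2 :> R.
    by rewrite sqr_sqrtr// ler_nat leq_div.
  have c0 : 0 <= cubic_cst by rewrite mulr_ge0 ?expR_ge0.
  set A := C * (1 + cubic_cst).
  have A0 : 0 <= A by rewrite mulr_ge0//; lra.
  have -> : A * m.+1%:R ^+ 3 / sigma ^+ 3 / Num.sqrt n%:R =
     Num.sqrt n%:R ^+ 2 * (A * (k * m.+1%:R) ^+ 3).
    by rewrite /k /scale; field; rewrite !gt_eqF.
  by rewrite ler_wpM2r// mulr_ge0// exprn_ge0// mulr_ge0// ltW.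
have sdV0 : 0 < sd n V by rewrite sdV !mulr_gt0.
have step3 : `|gsmooth (sd n V) f 0 - gsmooth 1 f 0| <=
  (3 * C + 2) * (2 * expR 1) * Num.sqrt (`|1 - (dev_rate m / sigma) ^+ 2| +
      (dev_rate m / sigma) ^+ 2 * m%:R / Num.sqrt n%:R).
  apply: le_trans (gsmooth_sd_abs 0 ltr01 sdV0 tf yf) _.
  rewrite ler_wpM2l//; first by rewrite !mulr_ge0 ?expR_ge0//; lra.
  rewrite ler_wsqrtr// expr1n distrC.
  set B := (dev_rate m / sigma) ^+ 2.
  have B0 : 0 <= B by exact: sqr_ge0.
  pose t : R := (q * m)%:R / n%:R.
  have nR : 0 < n%:R :> R by rewrite ltr0n.
  have -> : sd n V ^+ 2 = B * t.
    rewrite sdV !exprMn sqr_sqrtr// /B /t /k /scale /dev_rate exprVn.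
    have -> : (q * m)%:R = q%:R * m%:R :> R by exact: natrM.
    set v := sd m rcap.
    have -> : (v / Num.sqrt m%:R / sigma) ^+ 2 = v ^+ 2 / m%:R / sigma ^+ 2.
      by rewrite -[in RHS](sqr_sqrtr (ler0n R m)); field; rewrite !gt_eqF.
    have -> : (sigma * Num.sqrt n%:R) ^- 2 = (sigma ^+ 2 * n%:R)^-1.
      by rewrite exprMn sqr_sqrtr ?ler0n.
    by field; rewrite !gt_eqF// ltr0n.
  have t1 : t <= 1 by rewrite ler_pdivrMr// mul1r ler_nat leq_divM.
  have tm : 1 - t <= m%:R / Num.sqrt n%:R.
    apply: (@le_trans _ _ (m%:R / n%:R)).
      rewrite lerBlDr -mulrDl ler_pdivlMr// mul1r -natrD ler_nat.
      by rewrite {1}(divn_eq n m) addnC leq_add2r ltnW// ltn_mod.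
    rewrite ler_wpM2l// lef_pV2 ?posrE// -[leRHS]sqr_sqrtr//.
    by rewrite expr2 ler_peMl// ltW.
  have -> : 1 - B * t = (1 - B) + B * (1 - t) by ring.
  apply: le_trans (ler_normD _ _) _; rewrite lerD2l normrM !ger0_norm// ?subr_ge0//.
  by rewrite -mulrA ler_wpM2l.
have -> : mean n (fun w => f (centered n (fun w => k * rcap w) w)) - gsmooth 1 f 0 =
  (mean n (fun w => f (centered n U w)) - mean n (fun w => f (centered n V w))) +
  (mean n (fun w => f (centered n V w)) - gsmooth (sd n V) f 0) +
  (gsmooth (sd n V) f 0 - gsmooth 1 f 0) by ring.
apply: le_trans (ler_normD _ _) _; rewrite lerD//.
apply: le_trans (ler_normD _ _) _; apply: le_trans (lerD step1 step2) _.
by rewrite -addrA -mulrDl.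
Qed.

Lemma smooth_clt f C e : tame f -> taylor C f -> 0 < e ->
  exists N, forall n, (N <= n)%N ->
  `|mean n (fun w => f (centered n (fun w => scale n * rcap w) w)) - gsmooth 1 f 0| <= e.
Proof.
move=> tf yf e0; have C0 := taylor_ge0 yf.
have kap0 : 0 <= kappa := kappa_ge0 hk_le.
have cc0 : 0 <= cubic_cst by rewrite mulr_ge0 ?expR_ge0.
set L := (3 * C + 2) / sigma; set M := (3 * C + 2) * (2 * expR 1).
have L0 : 0 <= L by rewrite divr_ge0 ?(ltW sigma0)//; lra.
have M0 : 0 < M by rewrite !mulr_gt0 ?expR_gt0//; lra.
have e3 : 0 < e / 3 by lra.
have [s0 hs0] := archi_pow e3 (mulr_ge0 L0 (mulr_ge0 (ler0n R 40) kap0)).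
(* Squared because the variance error enters under a root. *)
pose eta := (e / 3 / M) ^+ 2.
have eta0 : 0 < eta by rewrite exprn_gt0// divr_gt0.
have eta2 : 0 < eta / 2 by lra.
have cvB : (1 - (dev_rate n / sigma) ^+ 2) @[n --> \oo] --> (0 : R).
  have -> : (0 : R) = 1 - (sigma / sigma) * (sigma / sigma).
    by rewrite divff ?gt_eqF// mulr1 subrr.
  under eq_fun do rewrite expr2.
  apply: cvgB; first exact: cvg_cst.
  by apply: cvgM; apply: cvgM => //; exact: cvg_cst.
have [N1 _ hN1] := cvgr0_norm_le _ cvB _ eta2.
have [N2 _ hN2] := cvgr_gt _ dev_rate_sigma _ sigma0.
(* The block scale is fixed before n. It makes the block error small and brings [dev_rate (16 ^ s)]
   close to sigma, as [16 ^ s] exceeds s and hence both ranks. *)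
pose s := maxn s0 (maxn N1 N2).
have s16 : (maxn N1 N2 <= 16 ^ s)%N.
  apply: leq_trans (ltnW (ltn_expl s (isT : 1 < 16)%N)).
  by rewrite /s leq_max leqnn orbT.
have hB := hN1 (16 ^ s)%N (leq_trans (leq_maxl _ _) s16).
have hA := hN2 (16 ^ s)%N (leq_trans (leq_maxr _ _) s16).
rewrite /= in hB hA.
have hs : L * (40 * kappa / 2 ^+ s) <= e / 3.
  apply: le_trans hs0; rewrite [leLHS]mulrA; apply: ler_wpM2l.
    by rewrite mulr_ge0// mulr_ge0.
  by rewrite lef_pV2 ?posrE ?exprn_gt0// ler_weXn2l ?leq_maxl// ler1n.
pose D := L * block_cst K (4 * s) + C * (1 + cubic_cst) * (16 ^ s).+1%:R ^+ 3 / sigma ^+ 3.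
have D0 : 0 <= D.
  have b0 : 0 <= block_cst K (4 * s) by rewrite addr_ge0// mulr_ge0.
  apply: addr_ge0; first exact: mulr_ge0.
  by rewrite divr_ge0 ?exprn_ge0 ?(ltW sigma0)// mulr_ge0 ?exprn_ge0// mulr_ge0// addr_ge0.
have [N3 N30 hN3] := archi_sqrt e3 D0.
have [N4 N40 hN4] := archi_sqrt eta2
  (mulr_ge0 (sqr_ge0 (dev_rate (16 ^ s) / sigma)) (ler0n R (16 ^ s))).
exists (maxn (16 ^ s) (maxn N3 N4)) => n; rewrite !geq_max => /and3P[n1 n3 n4].
apply: le_trans (clt_error n1 hA tf yf) _.
rewrite -/L -/M -/D.
have h3 := hN3 n n3; have h4 := hN4 n n4.
have hM : M * Num.sqrt (`|1 - (dev_rate (16 ^ s) / sigma) ^+ 2| +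
   (dev_rate (16 ^ s) / sigma) ^+ 2 * (16 ^ s)%:R / Num.sqrt n%:R) <= e / 3.
  rewrite mulrC -ler_pdivlMr//.
  have -> : e / 3 / M = Num.sqrt eta.
    by rewrite sqrtr_sqr ger0_norm// ltW// divr_gt0.
  by rewrite ler_wsqrtr//; lra.
have -> : e = e / 3 + e / 3 + e / 3 by field.
by rewrite !lerD.
Qed.

End FiniteCLT.

(** * Distribution function of the standard normal law *)

Section NormalCdf.
Context {R : realType}.
Local Notation mu := (@lebesgue_measure R).
Local Notation normal := (@normal_prob R 0 1).

Definition normal_cdf (x : R) : R := fine (normal `]-oo, x]%classic).

Lemma normal_cdfE x : normal `]-oo, x]%classic = (normal_cdf x)%:E.
Proof. by rewrite fineK// fin_num_measure. Qed.

Lemma gsmooth_le_cdf f x : tame f -> (forall y, x <= y -> f y = 0) ->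
  gsmooth 1 f 0 <= normal_cdf x.
Proof.
move=> tf f0; rewrite -lee_fin -gsmoothE// -normal_cdfE /normal_prob.
have [mf f01] := tf.
have mfp : measurable_fun setT (fun y => (f y * normal_pdf 0 1 y)%:E).
  apply/measurable_EFinP; apply: measurable_funM => //; exact: measurable_normal_pdf.
have mp : measurable_fun setT (fun y : R => (normal_pdf 0 1 y)%:E).
  by apply/measurable_EFinP; exact: measurable_normal_pdf.
rewrite [leRHS]integral_mkcond; apply: ge0_le_integral => //.
- by move=> y _; rewrite lee_fin mulr_ge0 ?normal_pdf_ge0//; have /andP[] := f01 y.
- apply: (measurable_restrictT _ _).1; [exact: measurable_itv|exact: measurable_funTS].
move=> y _; rewrite patchE mem_setE in_itv/=; have [yx|xy] := leP y x.
  by rewrite lee_fin ler_piMl ?normal_pdf_ge0//; have /andP[] := f01 y.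
by rewrite f0 ?mul0r// ltW.
Qed.

Lemma cdf_le_gsmooth f x : tame f -> (forall y, y <= x -> f y = 1) ->
  normal_cdf x <= gsmooth 1 f 0.
Proof.
move=> tf f0; rewrite -lee_fin -gsmoothE// -normal_cdfE /normal_prob.
have [mf f01] := tf.
have mfp : measurable_fun setT (fun y => (f y * normal_pdf 0 1 y)%:E).
  apply/measurable_EFinP; apply: measurable_funM => //; exact: measurable_normal_pdf.
have mp : measurable_fun setT (fun y : R => (normal_pdf 0 1 y)%:E).
  by apply/measurable_EFinP; exact: measurable_normal_pdf.
have fp y : 0 <= f y * normal_pdf 0 1 y.
  by rewrite mulr_ge0 ?normal_pdf_ge0//; have /andP[] := f01 y.
rewrite [leLHS]integral_mkcond; apply: ge0_le_integral => //.
- by move=> y _; rewrite patchE; case: ifP => // _; rewrite lee_fin normal_pdf_ge0.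
- apply: (measurable_restrictT _ _).1; [exact: measurable_itv|exact: measurable_funTS].
move=> y _; rewrite patchE mem_setE in_itv/=; have [yx|xy] := leP y x.
  by rewrite f0 ?mul1r.
by rewrite lee_fin.
Qed.

Lemma normal_cdf_lip x h : 0 <= h ->
  normal_cdf (x + h) <= normal_cdf x + normal_peak 1 * h.
Proof.
move=> h0; rewrite -lee_fin EFinD -!normal_cdfE.
have xh : x <= x + h by rewrite lerDl.
have -> : `]-oo, x + h]%classic = `]-oo, x] `|` `]x, x + h] :> set R.
  by rewrite -itv_bndbnd_setU// bnd_simp.
apply: le_trans (measureU2 _ _ _) _ => //.
rewrite leeD2l//.
rewrite /normal_prob.
apply: (@le_trans _ _ (\int[mu]_(y in `]x, (x + h)%R]) (normal_peak 1)%:E)%E).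
  apply: ge0_le_integral => //.
  - by move=> y _; rewrite lee_fin normal_pdf_ge0.
  - by apply/measurable_EFinP; apply: measurable_funTS; exact: measurable_normal_pdf.
  - by move=> y _; rewrite lee_fin normal_pdf_ub.
rewrite (integral_cst mu)//=.
rewrite lebesgue_measure_itv/= lte_fin ltrDl.
case: ltP => h1; last by rewrite mule0 lee_fin mulr_ge0// normal_peak_ge0.
by rewrite -EFinD -EFinM addrAC subrr add0r.
Qed.

End NormalCdf.

(** * From smooth test functions to distribution functions *)

Section CdfLimit.
Context {R : realType} {G : groupType} (Gamma : {fset G}).
Hypothesis Gamma0 : Gamma != fset0.
Hypothesis Gammasym : symmetric_set Gamma.
Local Notation mean := (@mean R G Gamma).
Local Notation rcap := (@rcap R G Gamma).
Local Notation dev_rate := (@dev_rate R G Gamma).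
Variable K : R.
Hypothesis hk_le : forall n x, @hk R G Gamma n x <= K / n.+1%:R ^+ 3.
Variable sigma : R.
Hypothesis sigma0 : 0 < sigma.
Hypothesis dev_rate_sigma : dev_rate n @[n --> \oo] --> sigma.

Definition rcap_cdf n (x : R) : R :=
  mean n (fun w => ((rcap w - mean n rcap) / (sigma * Num.sqrt n%:R) <= x)%R%:R).

(** The indicator of []-oo, x]] lies between the soft steps starting at x - 3 h and at x. Their
    Gaussian means differ from [normal_cdf x] by at most the normal mass of an interval of length 3
    h, made smaller than e / 2 by the choice of h. *)
Lemma rcap_cdf_cvg x : rcap_cdf n x @[n --> \oo] --> normal_cdf x.
Proof.
have pk0 : 0 < @normal_peak R 1 by exact: normal_peak_gt0.
apply/cvgrPdist_le => e e0.
pose h := e / (8 * (1 + @normal_peak R 1)).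
have h0 : 0 < h by rewrite divr_gt0// mulr_gt0// addr_gt0.
have ph : normal_peak 1 * (3 * h) <= e / 2.
  have -> : e = h * (8 * (1 + normal_peak 1)).
    by rewrite /h mulfVK// gt_eqF// mulr_gt0// addr_gt0.
  by have := mulr_gt0 pk0 h0; lra.
have e2 : 0 < e / 2 by lra.
have [N1 hN1] := smooth_clt Gamma0 Gammasym hk_le sigma0 dev_rate_sigma
  (tame_soft_step h x) (taylor_soft_step h x) e2.
have [N2 hN2] := smooth_clt Gamma0 Gammasym hk_le sigma0 dev_rate_sigma
  (tame_soft_step h (x - 3 * h)) (taylor_soft_step h (x - 3 * h)) e2.
exists (maxn N1 N2) => // n /=; rewrite geq_max => /andP[n1 n2].
have {n1 hN1} := hN1 n n1; have {n2 hN2} := hN2 n n2.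
pose S w := (sigma * Num.sqrt n%:R)^-1 * rcap w; rewrite -/S.
set W := mean n (fun w => soft_step h (x - 3 * h) _).
set V := mean n (fun w => soft_step h x _).
have SE w : centered Gamma n S w = (rcap w - mean n rcap) / (sigma * Num.sqrt n%:R).
  by rewrite /centered /S meanZ -mulrBr mulrC.
have WF : W <= rcap_cdf n x.
  apply: le_mean => w _ _; rewrite SE; set y := (_ / _).
  have [yx|xy] := leP y x.
    by have [_ /(_ y) /andP[]] := tame_soft_step h (x - 3 * h).
  by rewrite soft_step_ge// subrK ltW.
have FV : rcap_cdf n x <= V.
  apply: le_mean => w _ _; rewrite SE; set y := (_ / _).
  have [yx|xy] := leP y x; first by rewrite soft_step_le.
  by have [_ /(_ y) /andP[]] := tame_soft_step h x.
rewrite !ler_norml => /andP[a1 a2] /andP[b1 b2].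
have c1 := gsmooth_le_cdf (tame_soft_step h x) (fun y => @soft_step_ge R h x y h0).
have c2 := cdf_le_gsmooth (tame_soft_step h (x - 3 * h))
  (fun y => @soft_step_le R h (x - 3 * h) y h0).
have h3 : 0 <= 3 * h by lra.
have := normal_cdf_lip x h3; have := normal_cdf_lip (x - 3 * h) h3; rewrite subrK.
by move=> d1 d2; apply/andP; split; lra.
Qed.

End CdfLimit.

(** * From word averages to the random walk *)

Section Transfer.
Context {R : realType} {G : groupType} (Gamma : {fset G}).
Context (disp : measure_display) (T : measurableType disp) (P : probability T R).
Variable X : nat -> T -> G.
Hypothesis Gamma0 : Gamma != fset0.
Hypothesis Gammagen : generates Gamma.
Hypothesis Gammasym : symmetric_set Gamma.
Hypothesis Xrand : random_elements X.
Hypothesis Xind : mutually_independent P X.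
Hypothesis Xunif : forall n, uniform_on P Gamma (X n).
Local Notation mean := (@mean R G Gamma).
Local Notation rcap := (@rcap R G Gamma).
Local Notation words := (@words G Gamma).
Local Notation q := (#|` Gamma|%:R : R).

Lemma generates_word g : exists2 s, {subset s <= Gamma} & g = wprod s.
Proof.
pose H : {pred G} := [pred g : G | `[< exists2 s, {subset s <= Gamma} & g = wprod s >]].
have HE x : (x \in H) = `[< exists2 s, {subset s <= Gamma} & x = wprod s >] by [].
suff: g \in H by rewrite HE => /asboolP.
apply: (Gammagen (H := H)); last first.
  move=> a aG; rewrite HE; apply/asboolP; exists [:: a].
    by move=> x; rewrite inE => /eqP ->.
  by rewrite wprod_cons wprod_nil mulg1.
split; first by rewrite HE; apply/asboolP; exists [::]; rewrite ?wprod_nil.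
move=> x y; rewrite !HE => /asboolP[s sG ->] /asboolP[t tG ->].
apply/asboolP; exists (s ++ map (fun a => a^-1)%g (rev t)).
  move=> a; rewrite mem_cat => /orP[/sG//|/mapP[b]].
  by rewrite mem_rev => /tG bG ->; exact: Gammasym.
rewrite wprod_cat; congr (_ * _)%g; elim: t {tG} => [|b t IH].
  by rewrite wprod_nil invg1.
by rewrite rev_cons map_rcons -cats1 wprod_cat -IH !wprod_cons wprod_nil mulg1 invgM.
Qed.

(** Needed for measurability: an event depending on several steps is decomposed according to the
    value of each step, and this union has to be countable. *)
Lemma countable_group : countable [set: G].
Proof.
have -> : [set: G] =
    (fun js : seq nat => wprod (map (nth 1%g Gamma) js)) @` [set: seq nat].
  apply/seteqP; split=> // g _; have [s sG ->] := generates_word g.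
  exists (map (fun a => index a Gamma) s) => //=; congr wprod.
  rewrite -map_comp -[RHS]map_id; apply/eq_in_map => a as_ /=.
  by rewrite nth_index// sG.
exact: card_le_trans (card_image_le _ _) (countableP _).
Qed.

Definition steps k n w : seq G := [seq X i w | i <- iota k n].

Lemma size_steps k n w : size (steps k n w) = n.
Proof. by rewrite size_map size_iota. Qed.

Lemma measurable_steps k n (B : set (seq G)) :
  measurable [set w | B (steps k n w)].
Proof.
elim: n k B => [|n IH] k B.
  have [h|h] := pselect (B [::]).
    by rewrite (_ : [set w | _] = setT)//; apply/seteqP; split.
  by rewrite (_ : [set w | _] = set0)//; apply/seteqP; split.
have -> : [set w | B (steps k n.+1 w)] =
  \bigcup_g (X k @^-1` [set g] `&` [set w | B (g :: steps k.+1 n w)]).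
  apply/seteqP; split => w /=; first by move=> Bw; exists (X k w).
  by move=> [g _ [/= <-]].
apply: countable_bigcupT_measurable; first exact: countable_group.
move=> g; apply: measurableI; first exact: Xrand.
exact: (IH k.+1 (fun s => B (g :: s))).
Qed.

Lemma prob_steps_eq n s : s \in words n ->
  P [set w | steps 0 n w = s] = ((q ^+ n)^-1)%:E.
Proof.
move=> /in_words[sn sG].
pose J : {fset nat} := [fset i in iota 0 n]%fset.
have JE i : (i \in J) = (i < n)%N by rewrite !inE/= mem_iota.
have -> : [set w | steps 0 n w = s] =
   \bigcap_(j in [set` J]) (X j @^-1` [set nth 1%g s j]).
  apply/seteqP; split => [w /= <- j /=|w /= h].
    by rewrite JE => jn; rewrite (nth_map 0%N) ?size_iota// nth_iota.
  apply: (@eq_from_nth _ 1%g); first by rewrite size_steps.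
  move=> i; rewrite size_steps => i_n; rewrite (nth_map 0%N) ?size_iota// nth_iota//.
  by apply: h => /=; rewrite JE.
rewrite (Xind J (fun j => [set nth 1%g s j])).
rewrite (eq_big_seq (fun=> (q^-1)%:E)); last first.
  move=> i; rewrite JE => i_n; apply: Xunif; apply: sG; apply: mem_nth.
  by rewrite sn.
have cJ : #|` J| = n by rewrite card_fseq undup_id ?iota_uniq// size_iota.
rewrite big_const_seq count_predT cJ -exprVn; elim: (n) => [//|m IH].
by rewrite iterS IH -EFinM exprS.
Qed.

Lemma words_uniq n : uniq (words n).
Proof.
elim: n => [//|n IH] /=; apply: allpairs_uniq => //; first exact: fset_uniq.
by move=> [a s] [b t] _ _ /= [-> ->].
Qed.

Lemma size_words n : size (words n) = (#|` Gamma| ^ n)%N.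
Proof. by elim: n => [//|n IH] /=; rewrite size_allpairs IH expnS. Qed.

Lemma prob_steps_in n r : uniq r -> {subset r <= words n} ->
  P [set w | steps 0 n w \in r] = ((size r)%:R / q ^+ n)%:E.
Proof.
elim: r => [_ _|s r IH /= /andP[sr ur] rw].
  by rewrite (_ : [set w | _] = set0) ?measure0 ?mul0r//; apply/seteqP; split.
have -> : [set w | steps 0 n w \in s :: r] =
  [set w | steps 0 n w = s] `|` [set w | steps 0 n w \in r].
  apply/seteqP; split => w /=; rewrite inE.
    by move=> /orP[/eqP|]; [left|right].
  by move=> [->|->]; rewrite ?eqxx ?orbT.
rewrite measureU; last 1 first.
- by apply/seteqP; split => w //= [-> h]; rewrite h in sr.
- have ps : P [set w | steps 0 n w = s] = ((q ^+ n)^-1)%:E.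
    by apply: prob_steps_eq; apply: rw; rewrite inE eqxx.
  have pr : P [set w | steps 0 n w \in r] = ((size r)%:R / q ^+ n)%:E.
    by apply: IH => // x xr; apply: rw; rewrite inE xr orbT.
  apply: eq_trans (congr2 _ ps pr) _.
  by rewrite -EFinD -natr1 mulrDl mul1r addrC.
- exact: (measurable_steps 0 n (fun t => t = s)).
- exact: (measurable_steps 0 n (fun t => t \in r)).
Qed.

(** Uniformity prescribes only the probabilities of the generators; as those of the words in
    generators already add up to 1, steps outside [Gamma] form a null event. *)
Lemma steps_words_ae n : P (~` [set w | steps 0 n w \in words n]) = 0%E.
Proof.
rewrite probability_setC; last exact: (measurable_steps 0 n (fun t => t \in words n)).
rewrite prob_steps_in ?words_uniq// size_words natrX divff ?subee//.
by rewrite expf_neq0// gt_eqF// card_gens_gt0.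
Qed.

Lemma prob_steps n (B : set (seq G)) :
  P [set w | B (steps 0 n w)] = (mean n (fun s => (`[< B s >])%:R))%:E.
Proof.
pose r := [seq s <- words n | `[< B s >]].
pose W := [set w | steps 0 n w \in words n].
have mW : measurable W by exact: (measurable_steps 0 n (fun t => t \in words n)).
rewrite (measureDI P (measurable_steps 0 n B) mW).
rewrite (@subset_measure0 _ _ _ P _ (~` W)); last 1 first.
- exact: steps_words_ae.
- have -> : [set w | B (steps 0 n w)] `&` W = [set w | steps 0 n w \in r].
    apply/seteqP; split => w /=; rewrite mem_filter.
      by move=> [Bw ->]; rewrite andbT; apply/asboolP.
    by move=> /andP[/asboolP].
  rewrite add0e; apply: (eq_trans (@prob_steps_in n r _ _)).
  - by rewrite filter_uniq ?words_uniq.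
  - by move=> s; rewrite mem_filter => /andP[].
  rewrite mulrC /mean size_filter -sum1_count natr_sum big_mkcond.
  by congr (_ * _)%:E; apply: eq_bigr => s _; case: asboolP.
- exact: measurableD (measurable_steps 0 n B) mW.
- exact: measurableC.
- by move=> w [].
Qed.

Lemma walkE g n w : walk X g n w = (g * wprod (steps 0 n w))%g.
Proof.
elim: n => [|n IH]; first by rewrite /= wprod_nil mulg1.
by rewrite /steps -addn1 iotaD map_cat wprod_cat mulgA addn1/= wprod_cons wprod_nil mulg1 -IH.
Qed.

Lemma take_steps k n w : (k <= n)%N -> take k (steps 0 n w) = steps 0 k w.
Proof. by move=> kn; rewrite /steps -map_take take_iota (minn_idPl kn). Qed.

Lemma avoids_steps (r : seq G) g n w : avoids r g (steps 0 n w) =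
  all (fun k => walk X g k w \notin r) (iota 1 n).
Proof.
rewrite /avoids scanl_mulgE all_map size_steps; apply: eq_in_all => k /=.
by rewrite mem_iota add1n ltnS => /andP[_ kn]; rewrite take_steps// walkE.
Qed.

Lemma return_time_pinfty (r : seq G) g w :
  return_time (R := R) [set` r] (walk X g ^~ w) = +oo%E <->
  forall n, avoids r g (steps 0 n w).
Proof.
rewrite /return_time ereal_inf_pinfty; split => [h n|h x /=].
  rewrite avoids_steps; apply/allP => k; rewrite mem_iota => /andP[k1 _].
  apply/negP => kr; have : (k%:R%:E : \bar R) = +oo%E by apply: h; exists k.
  by [].
move=> [n [n1 nr] _]; have := h n; rewrite avoids_steps => /allP/(_ n).
by rewrite mem_iota n1 add1n ltnS leqnn nr => /(_ isT).
Qed.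

(** Continuity from above: never returning is the decreasing intersection of the events of not
    returning within n steps. *)
Lemma escape_cvg_prob (r : seq G) g :
  (escape Gamma n r g)%:E @[n --> \oo] -->
  P [set w | return_time (R := R) [set` r] (walk X g ^~ w) = +oo%E].
Proof.
have -> : [set w | return_time (R := R) [set` r] (walk X g ^~ w) = +oo%E] =
   \bigcap_n [set w | avoids r g (steps 0 n w)].
  apply/seteqP; split => w /=; first by move/return_time_pinfty => h n _; exact: h.
  by move=> h; apply/return_time_pinfty => n; exact: h.
have mE n : measurable [set w | avoids r g (steps 0 n w)].
  exact: (measurable_steps 0 n (fun s => avoids r g s)).
have := @nonincreasing_cvg_mu _ _ _ P (fun n => [set w | avoids r g (steps 0 n w)]).
move=> H; have {H} := H _ mE _ _.
have -> : P \o (fun n => [set w | avoids r g (steps 0 n w)]) =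
    fun n => (escape Gamma n r g)%:E.
  apply/funext => n /=; rewrite (prob_steps n (fun s => avoids r g s)).
  by congr EFin; apply: eq_mean => s _ _; rewrite asboolb.
apply; first by rewrite (le_lt_trans (probability_le1 _ _))// ltry.
  by apply: bigcap_measurable => // n _; exact: mE.
move=> m n mn; apply/subsetPset => w /=; rewrite !avoids_steps => /allP h.
apply/allP => k; rewrite mem_iota => /andP[k1 km]; apply: h.
by rewrite mem_iota k1 (leq_trans km)// leq_add2l.
Qed.

Lemma capacity_seq (r : seq G) : capacity P X [set` r] = (cap Gamma r)%:E.
Proof.
pose p g := P [set w | return_time (R := R) [set` r] (walk X g ^~ w) = +oo%E].
have pf g : p g \is a fin_num.
  apply: fin_num_measure; rewrite (_ : [set w | _] =
     \bigcap_n [set w | avoids r g (steps 0 n w)]).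
    apply: bigcap_measurable => // n _.
    exact: (measurable_steps 0 n (fun s => avoids r g s)).
  apply/seteqP; split => w /=; first by move/return_time_pinfty => h n _; exact: h.
  by move=> h; apply/return_time_pinfty => n; exact: h.
have cp g : escape Gamma n r g @[n --> \oo] --> fine (p g).
  have := @escape_cvg_prob r g; rewrite -/(p g) -(fineK (pf g)).
  by move/fine_cvg.
have -> : capacity P X [set` r] = (\esum_(g in [set` undup r]) p g)%E.
  rewrite /capacity (_ : [set` undup r] = [set` r])//.
  by apply/seteqP; split => x /=; rewrite mem_undup.
rewrite esum_fset//; last exact: finite_seq.
rewrite -fsbig_seq ?undup_uniq//.
under eq_bigr do rewrite -(fineK (pf _)).
rewrite sumEFin; congr EFin.
symmetry; apply: cvg_lim => //.
rewrite /capN; elim: (undup r) => [|g t IH].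
  by under eq_fun do rewrite big_nil; rewrite big_nil; exact: cvg_cst.
by under eq_fun do rewrite big_cons; rewrite big_cons; exact: cvgD.
Qed.

Lemma range_capacityE n w : range_capacity P X n w = rcap (steps 0 n w).
Proof.
rewrite /range_capacity /rcap.
suff -> : walk_range X n w = [set` trace (steps 0 n w)] by rewrite capacity_seq.
apply/seteqP; split => x /=.
  move=> [k kn <-]; rewrite traceE size_steps; apply/mapP; exists k.
    by rewrite mem_iota add0n ltnS.
  by rewrite walkE mul1g take_steps.
rewrite traceE size_steps => /mapP[k]; rewrite mem_iota add0n ltnS => kn ->.
by exists k => //; rewrite walkE mul1g take_steps.
Qed.

Lemma measurable_fun_steps n (f : seq G -> R) D :
  measurable_fun D (fun w => (f (steps 0 n w))%:E).
Proof.
apply/measurable_EFinP; apply: measurable_funTS => _ B mB.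
by rewrite setTI; exact: (measurable_steps 0 n (fun s => B (f s))).
Qed.

Lemma integral_steps_in n (f : seq G -> R) r : (forall s, 0 <= f s) ->
  uniq r -> {subset r <= words n} ->
  (\int[P]_(w in [set w | steps 0 n w \in r]) (f (steps 0 n w))%:E)%E =
  ((q ^+ n)^-1 * \sum_(s <- r) f s)%:E.
Proof.
move=> f0; elim: r => [_ _|s r IH /= /andP[sr ur] rw].
  rewrite big_nil mulr0 (_ : [set w | _] = set0) ?integral_set0//.
  by apply/seteqP; split.
have -> : [set w | steps 0 n w \in s :: r] =
  [set w | steps 0 n w = s] `|` [set w | steps 0 n w \in r].
  apply/seteqP; split => w /=; rewrite inE.
    by move=> /orP[/eqP|]; [left|right].
  by move=> [->|->]; rewrite ?eqxx ?orbT.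
have ms : measurable [set w | steps 0 n w = s].
  exact: (measurable_steps 0 n (fun t => t = s)).
have mr : measurable [set w | steps 0 n w \in r].
  exact: (measurable_steps 0 n (fun t => t \in r)).
rewrite ge0_integral_setU//; last 1 first.
- by apply/disj_set2P; apply/seteqP; split => w //= [-> h]; rewrite h in sr.
- rewrite IH//; last by move=> x xr; apply: rw; rewrite inE xr orbT.
  rewrite (eq_integral (fun=> (f s)%:E)); last by move=> w; rewrite inE/= => ->.
  have ps : P [set w | steps 0 n w = s] = ((q ^+ n)^-1)%:E.
    by apply: prob_steps_eq; apply: rw; rewrite inE eqxx.
  rewrite integral_cst// [X in (_ * X + _)%E]ps.
  by rewrite -EFinM -EFinD big_cons mulrDr (mulrC (f s)).
- exact: measurable_fun_steps.
- by move=> w _; rewrite lee_fin.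
Qed.

Lemma integral_steps n (f : seq G -> R) : (forall s, 0 <= f s) ->
  (\int[P]_w (f (steps 0 n w))%:E)%E = (mean n f)%:E.
Proof.
move=> f0; rewrite -integral_steps_in ?words_uniq//.
set W := [set w | _].
have mW : measurable W by exact: (measurable_steps 0 n (fun t => t \in words n)).
rewrite -(setUv W) ge0_integral_setU//.
- rewrite [X in (_ + X)%E]null_set_integral ?adde0//.
  + exact: measurableC.
  + exact: measurable_fun_steps.
  + exact: steps_words_ae.
- exact: measurableC.
- exact: measurable_fun_steps.
- by move=> w _; rewrite lee_fin.
- by apply/disj_set2P; rewrite setICr.
Qed.

Lemma expectation_range_capacity n :
  'E_P[range_capacity P X n]%E = (mean n rcap)%:E.
Proof.
rewrite unlock -integral_steps//; last by move=> s; have /andP[] := @rcap_bound R G Gamma Gamma0 s.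
by apply: eq_integral => w _; rewrite range_capacityE.
Qed.

Lemma range_capacity_cdf sigma n x :
  pushforward P (fun w => (range_capacity P X n w - fine 'E_P[range_capacity P X n])
                  / (sigma * Num.sqrt n%:R)) `]-oo, x]%classic =
  (rcap_cdf Gamma sigma n x)%:E.
Proof.
rewrite expectation_range_capacity/= /pushforward.
rewrite (_ : _ @^-1` _ = [set w |
  ((rcap (steps 0 n w) - mean n rcap) / (sigma * Num.sqrt n%:R) <= x)%R]); last first.
  by apply/seteqP; split => w /=; rewrite in_itv/= range_capacityE.
rewrite (prob_steps n
  (fun s => ((rcap s - mean n rcap) / (sigma * Num.sqrt n%:R) <= x)%R)).
by congr EFin; apply: eq_mean => s _ _; rewrite asboolb.
Qed.

End Transfer.

Theorem theorem1p2 (R : realType) (G : groupType) (Gamma : {fset G}) (d : nat)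
    (disp : measure_display) (T : measurableType disp) (P : probability T R)
    (X : nat -> T -> G) :
  generates Gamma ->
  symmetric_set Gamma ->
  polynomial_growth R Gamma d ->
  random_elements X ->
  mutually_independent P X ->
  (forall n, uniform_on P Gamma (X n)) ->
  (6 <= d)%N ->
  exists sigma : R, 0 < sigma /\
    converges_in_distribution P
      (fun n w => (range_capacity P X n w - fine 'E_P[range_capacity P X n])
                  / (sigma * Num.sqrt n%:R))
      (normal_prob 0 1).
Proof.
move=> gen sym growth rX iX uX d6.
have Gamma0 := growth_gens growth d6.
have [kappa kappa1 vol] := volume_ge sym growth d6.
have hk_le := hk_decay Gamma0 sym kappa1 vol.
have [sigma sigma0 cv] := dev_rate_cvg Gamma0 sym hk_le.
exists sigma; split=> // x _.
under eq_fun do rewrite (range_capacity_cdf Gamma0 gen sym rX iX uX).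
suff : (rcap_cdf Gamma sigma n x)%:E @[n --> \oo] --> normal_prob 0 1 `]-oo, x]%classic by [].
rewrite normal_cdfE; apply: cvg_EFin; first exact: nearW.
exact: (rcap_cdf_cvg Gamma0 sym hk_le sigma0 cv).
Qed.
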